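(* Let $\{X_n\}_{n\in\mathbf{Z}}$ be a purely nondeterministic stationary process whose AR coefficients $a_n$ satisfy $\sum_{n=0}^{\infty}|a_n|<\infty$. Then for all $n\in\mathbf{N}$, $m\in\mathbf{N}\cup\{0\}$ and $j=1,\ldots,n$, the limit $\lim_{M\to\infty}\sum_{k=1}^{M} g_k^m(n,j)$ exists and $$\phi_{n,j}^m=\lim_{M\to\infty}\sum_{k=1}^{M} g_k^m(n,j),$$ that is, $$P_{[-n,-1]}X_m=\sum_{j=1}^{n}\Big\{\lim_{M\to\infty}\sum_{k=1}^{M} g_k^m(n,j)\Big\}X_{-j}.$$
   Context: $\mathbf{N}=\{1,2,\ldots\}$. A stationary process $\{X_k:k\in\mathbf{Z}\}$ is a real, zero-mean, weakly stationary process on a probability space $(\Omega,\mathcal{F},P)$, with autocovariance $\gamma(n)=E[X_nX_0]$. $H$ is the closed real linear span of $\{X_k:k\in\mathbf{Z}\}$ in $L^2(\Omega,\mathcal{F},P)$, with inner product $(Y,Z)=E[YZ]$. For an interval $I$, $H_I$ is the closed linear span of $\{X_k:k\in I\cap\mathbf{Z}\}$ and $P_I$ is the orthogonal projection of $H$ onto $H_I$. $\{X_n\}$ is purely nondeterministic (PND) if $\bigcap_{n=-\infty}^{\infty}H_{(-\infty,n]}=\{0\}$; equivalently, it has a positive spectral density $\Delta$ (an even, nonnegative, integrable function on $[-\pi,\pi]$ with $\gamma(n)=\int_{-\pi}^{\pi}e^{in\lambda}\Delta(\lambda)\,d\lambda$) such that $\int_{-\pi}^{\pi}|\log\Delta(\lambda)|\,d\lambda<\infty$.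 For PND $\{X_n\}$ define $$h(z)=\sqrt{2\pi}\exp\Big\{\frac{1}{4\pi}\int_{-\pi}^{\pi}\frac{e^{i\lambda}+z}{e^{i\lambda}-z}\log\Delta(\lambda)\,d\lambda\Big\},\qquad |z|<1.$$ The MA coefficients $c_n$ and AR coefficients $a_n$ are the real sequences defined by $h(z)=\sum_{n\ge0}c_nz^n$ and $-1/h(z)=\sum_{n\ge0}a_nz^n$ for $|z|<1$. For $n\in\mathbf{N}$, $m\in\mathbf{N}\cup\{0\}$, the real numbers $\phi^m_{n,j}$ ($1\le j\le n$) are uniquely determined by $P_{[-n,-1]}X_m=\sum_{j=1}^{n}\phi^m_{n,j}X_{-j}$ (here $X_{-n},\ldots,X_{-1}$ are linearly independent). For $m,j\in\mathbf{N}\cup\{0\}$ put $b_j^m=\sum_{k=0}^{m}c_ka_{j+m-k}$. For $n\in\mathbf{N}$ and $m,j\in\mathbf{N}\cup\{0\}$ define recursively $$b_1^m(n,j)=b_j^m,\qquad b_{k+1}^m(n,j)=\sum_{m_1=0}^{\infty}b_{n+1+m_1}^m\,b_k^{m_1}(n,j),\quad k=1,2,\ldots$$ (when $\sum|a_n|<\infty$ these sums converge absolutely). For $m\in\mathbf{N}\cup\{0\}$, $n\in\mathbf{N}$, $j=1,\ldots,n$, put $g_k^m(n,j)=b_k^m(n,j)$ for $k=1,3,5,\ldots$ and $g_k^m(n,j)=b_k^m(n,n+1-j)$ for $k=2,4,6,\ldots$. *)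

(* Defs.v *)
From mathcomp Require Import all_boot all_order all_algebra.
From mathcomp Require Import all_classical all_reals all_analysis.
From mathcomp Require Export complex.

Set Implicit Arguments.
Unset Strict Implicit.
Unset Printing Implicit Defensive.

Import Order.TTheory GRing.Theory Num.Theory.
Import numFieldNormedType.Exports.

Local Open Scope classical_set_scope.
Local Open Scope ring_scope.
Local Open Scope complex_scope.

Section Process.
Context {d : measure_display} {T : measurableType d} {R : realType}.
Variables (P : probability T R) (X : int -> T -> R).

(* Elements of L^2(P) are represented by functions in [Lfun P 2%:E]; equalities
   in L^2(P) are equalities almost everywhere. *)
Definition inner (Y Z : T -> R) : R := fine 'E_P[Y \* Z].

Definition autocov (n : int) : R := inner (X n) (X 0).

Definition stationary_process : Prop :=
  [/\ forall k, X k \in Lfun P 2%:E,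
      forall k, 'E_P[X k]%E = 0%E
    & forall n k : int, inner (X (n + k)) (X k) = autocov n].

Definition lin_span (I : interval int) : set (T -> R) :=
  [set Y | exists (s : seq int) (a : int -> R),
     {subset s <= I} /\ Y = \sum_(k <- s) a k *: X k].

(* H_I: the elements of L^2(P) that are limits, in the L^2 norm, of elements of
   the linear span. *)
Definition closed_span (I : interval int) : set (T -> R) :=
  [set Y | Y \in Lfun P 2%:E /\
     forall e : R, 0 < e -> exists2 Z, lin_span I Z &
       ('N[P]_2%:E[EFin \o (Y \- Z)%R] < e%:E)%E].

(* Z is a version of the orthogonal projection P_I Y. *)
Definition is_proj (I : interval int) (Y Z : T -> R) : Prop :=
  closed_span I Z /\ forall W, closed_span I W -> inner (Y \- Z) W = 0.

Definition purely_nondeterministic : Prop :=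
  \bigcap_(n in [set: int]) closed_span `]-oo, n]
    `<=` [set Y | ae_eq P setT Y (cst 0)].

(* Only the values phi j with 1 <= j <= n matter. *)
Definition predictor_coef (n m : nat) (phi : nat -> R) : Prop :=
  is_proj `[- n%:Z, - 1] (X m%:Z)
    (\sum_(1 <= j < n.+1) phi j *: X (- j%:Z)).

End Process.

Section Spectral.
Context {R : realType}.
Implicit Types (Delta : R -> R) (z : R[i]).

Definition cexp z : R[i] :=
  (expR (complex.Re z) * cos (complex.Im z)) +i*
  (expR (complex.Re z) * sin (complex.Im z)).

Definition cis (t : R) : R[i] := cexp (0 +i* t).

Definition cintegral (f : R -> R[i]) : R[i] :=
  (\int[lebesgue_measure]_(x in `[- pi, pi]) complex.Re (f x)) +i*
  (\int[lebesgue_measure]_(x in `[- pi, pi]) complex.Im (f x)).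

Definition spectral_density (gamma : int -> R) Delta : Prop :=
  [/\ {in `[- pi, pi], forall x, Delta (- x) = Delta x},
      {in `[- pi, pi], forall x, 0 <= Delta x},
      lebesgue_measure.-integrable `[- pi, pi] (EFin \o Delta)
    & forall n : int,
        (gamma n)%:C = cintegral (fun x => cis (n%:~R * x) * (Delta x)%:C)].

(* Positivity is required almost everywhere, since [ln] is 0 on the nonpositive
   reals and the integrability of the logarithm alone would not exclude zeros. *)
Definition positive_log_integrable Delta : Prop :=
  {ae lebesgue_measure, forall x, `[- pi, pi]%classic x -> 0 < Delta x} /\
  lebesgue_measure.-integrable `[- pi, pi] (fun x => (ln (Delta x))%:E).

Definition outer_fun Delta z : R[i] :=
  (Num.sqrt (2 * pi))%:C *
  cexp ((4 * pi)^-1%:C *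
    cintegral (fun x => (cis x + z) / (cis x - z) * (ln (Delta x))%:C)).

Definition disc_expansion (f : R[i] -> R[i]) (u : nat -> R) : Prop :=
  forall z, `|z| < 1 ->
    series (fun n => ((u n)%:C * z ^+ n : R[i]^o)) @ \oo --> (f z : R[i]^o).

Definition MA_coef Delta (c : nat -> R) : Prop :=
  disc_expansion (outer_fun Delta) c.

Definition AR_coef Delta (a : nat -> R) : Prop :=
  disc_expansion (fun z => - (outer_fun Delta z)^-1) a.

End Spectral.

Section Coefficients.
Context {R : realType}.
Variables c a : nat -> R.

Definition bcoef (m j : nat) : R := \sum_(k < m.+1) c k * a (j + m - k)%N.

(* [bsucc n p m j] is b_{p+1}^m(n,j). *)
Fixpoint bsucc (n p m j : nat) : R :=
  if p is q.+1 then
    limn (series (fun m1 => bcoef m (n + 1 + m1)%N * bsucc n q m1 j))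
  else bcoef m j.

(* b_k^m(n,j), meaningful for 1 <= k only. *)
Definition biter (n k m j : nat) : R := bsucc n k.-1 m j.

Definition gcoef (n k m j : nat) : R :=
  if odd k then biter n k m j else biter n k m (n + 1 - j)%N.

Definition gsum (n m j M : nat) : R := \sum_(1 <= k < M.+1) gcoef n k m j.

End Coefficients.

(* Main.v *)
Require Import Defs.
From mathcomp Require Import all_boot all_order all_algebra.
From mathcomp Require Import all_classical all_reals all_analysis.
From mathcomp Require Import measurable_realfun ring lra zify.

Set Implicit Arguments.
Unset Strict Implicit.
Unset Printing Implicit Defensive.

Import Order.TTheory GRing.Theory Num.Theory.
Import numFieldNormedType.Exports.

Local Open Scope classical_set_scope.
Local Open Scope ring_scope.

(** The finite predictor is a limit of alternating projections. Represent a
    vector [Y] of [H] by [i |-> (Y, X_i)], and write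
    [e_k = - sum_p a_p X_(k-p)] for the innovations. Starting from [X_m], one
    repeatedly projects onto the past [H_(-oo,-1]] and applies the reflection
    [i |-> -n-1-i]; projecting kills the components along [e_0, e_1, ...], so the
    squared norm drops by [sum_(k >= 0) (Y, e_k)^2] and these components tend to
    zero along the iteration. The AR expansion of the [k]-th iterate has, at
    [X_(-1), ..., X_(-n)], exactly the partial sums [sum_(l <= k) g_l^m(n,j)] as
    coefficients (in reverse order for even [k]), and the vanishing of the
    innovation components forces the remaining coefficients to zero. Hence the
    partial sums satisfy the normal equations in the limit, and inverting the Toeplitz matrix of [gamma] gives the claim.

    The only facts about the process needed for this are [a * c = - delta],
    [sum_p a_p gamma(p+i) = - c_i] (with [c_i = 0] for [i < 0]) and
    [gamma(0) = sum c_k^2]. They hold on circles of radius [r < 1] for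
    [|h|^2 = 2 pi exp(P_r[log Delta])] by integrating Fourier series termwise;
    they pass to [r -> 1] because [exp(P_r[log Delta]) <= P_r[Delta]] (Jensen),
    so that the L1 distance between the two sides is the difference of their
    means, which tends to zero. *)

(** * Sums weighted by a summable sequence *)

(** In the iteration no limit in [H] is formed: a vector is known only through its inner products
    with the [X_i] and through a bound on its norm, tested on finite combinations. Bounded pointwise
    convergence of functionals replaces norm convergence, and absolute summability of [a] makes
    every series in [a] continuous for it. The MA coefficients are only square summable, so there
    [c] enters through finite sums alone: at each index the projection sees finitely many
    innovations, and their completeness is used as the vanishing of [gam 0 - sum_(k < N) c_k^2] in
    the limit. The recursion for [b_k^m] unfolds at its first step, while the AR coefficients change
    at the last step of the iteration. The two are matched by treating each increment as a linear
    and continuous functional of the starting vector: the first step turns [X_m] into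
    [sum_(q >= 1) b_q^m X_(-q)], the terms [q <= n] stay in the window [-n, ..., -1] and contribute
    nothing, and [X_(-n-1-m1)] is the starting vector for [m1]. This is the origin of the shift
    [n + 1 + m1]. *)

Lemma cvg_sum_seq (R : realType) (I : eqType) (U : Type) (F : set_system U)
    (FF : Filter F) (r : seq I) (f : I -> U -> R) (l : I -> R) :
  (forall i, i \in r -> f i @ F --> l i) ->
  (fun x => \sum_(i <- r) f i x) @ F --> \sum_(i <- r) l i.
Proof.
elim: r => [|i r IHr] fl.
  by rewrite big_nil; under eq_fun do rewrite big_nil; exact: cvg_cst.
rewrite big_cons; under eq_fun do rewrite big_cons.
apply: cvgD; first by apply: fl; rewrite mem_head.
by apply: IHr => j jr; apply: fl; rewrite inE jr orbT.
Qed.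

Lemma cvg_sumr (R : realType) (I : eqType) (U : Type) (F : set_system U)
    (FF : Filter F) (r : seq I) (f : I -> U -> R) (l : I -> R) :
  (forall i, f i @ F --> l i) ->
  (fun x => \sum_(i <- r) f i x) @ F --> \sum_(i <- r) l i.
Proof. by move=> fl; apply: cvg_sum_seq => i _; exact: fl. Qed.

Lemma lim_series0 (R : realType) (u : nat -> R) :
  (forall n, u n = 0) -> limn (series u) = 0.
Proof.
move=> u0; apply: (cvg_lim (@Rhausdorff R)).
by rewrite /series /=; under eq_fun do rewrite big1//; exact: cvg_cst.
Qed.

Section WeightedSums.
Context {R : realType}.
Variable a : nat -> R.
Hypothesis cva : cvgn [normed series a].

(** [limn] returns a default value on divergent sequences; the lemmas below therefore bound [f],
    which makes the series absolutely convergent. *)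
Definition wsum (f : nat -> R) : R := limn (series (fun p => a p * f p)).
Definition l1 : R := limn [normed series a].

Lemma nseries_le_l1 n : series (fun p => `|a p|) n <= l1.
Proof.
apply: nondecreasing_cvgn_le => //.
by apply/nondecreasing_series => k _ _; rewrite normr_ge0.
Qed.

Lemma l1_ge0 : 0 <= l1.
Proof. by apply: le_trans (nseries_le_l1 0); rewrite /series /= big_geq. Qed.

Implicit Types (f g : nat -> R) (B C k : R).

Lemma wsum_cvg f B : (forall p, `|f p| <= B) ->
  cvgn (series (fun p => a p * f p)).
Proof.
move=> fB; apply: normed_cvg.
apply: (@series_le_cvg _ _ (fun p => `|a p| * B)) => //.
- by move=> p /=.
- by move=> p; apply: mulr_ge0 => //; exact: le_trans (fB 0%N).
- by move=> p /=; rewrite normrM ler_wpM2l.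
have -> : (fun p => `|a p| * B) = B *: (fun p => `|a p|).
  by apply/funext => p; rewrite /= mulrC.
exact: is_cvg_seriesZ.
Qed.

(** The error depends on [f] only through its bound [B], so one truncation index serves a whole
    bounded family; [wsum_lim] rests on this. *)
Lemma wsum_tail f B (K : nat) : (forall p, `|f p| <= B) ->
  `|wsum f - series (fun p => a p * f p) K|
    <= B * (l1 - series (fun p => `|a p|) K).
Proof.
move=> fB.
have B0 : 0 <= B by exact: le_trans (fB 0%N).
have cf := wsum_cvg fB.
have cf' : (fun n => `|series (fun p => a p * f p) n - series (fun p => a p * f p) K|)
  @ \oo --> `|wsum f - series (fun p => a p * f p) K|.
  by apply: cvg_norm; apply: cvgB => //; exact: cvg_cst.
rewrite -(cvg_lim (@Rhausdorff R) cf').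
apply: limr_le; first by apply/cvg_ex; eexists; exact: cf'.
near=> n.
have Kn : (K <= n)%N by near: n; exists K.
rewrite sub_series_geq //.
apply: (le_trans (ler_norm_sum _ _ _)).
apply: (@le_trans _ _ (B * \sum_(K <= k < n) `|a k|)).
  by rewrite mulr_sumr ler_sum // => i _; rewrite normrM mulrC ler_wpM2r.
rewrite ler_wpM2l //.
have <- := sub_series_geq (fun p => `|a p|) Kn.
by rewrite lerD2r nseries_le_l1.
Unshelve. all: by end_near. Qed.

Lemma wsum_bound f B : (forall p, `|f p| <= B) -> `|wsum f| <= B * l1.
Proof.
by move=> /(wsum_tail 0); rewrite /series /= !big_geq // !subr0.
Qed.

Lemma wsum_cvgn f B : (forall p, `|f p| <= B) ->
  series (fun p => a p * f p) @ \oo --> wsum f.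
Proof. exact: wsum_cvg. Qed.

Lemma wsumZ k f B : (forall p, `|f p| <= B) ->
  wsum (fun p => k * f p) = k * wsum f.
Proof.
move=> fB; rewrite /wsum.
have -> : (fun p => a p * (k * f p)) = k *: (fun p => a p * f p).
  by apply/funext => p; rewrite /= mulrCA.
by rewrite lim_seriesZ //; exact: wsum_cvg fB.
Qed.

Lemma wsumD f g B C : (forall p, `|f p| <= B) -> (forall p, `|g p| <= C) ->
  wsum (fun p => f p + g p) = wsum f + wsum g.
Proof.
move=> fB gC; rewrite /wsum -lim_seriesD; [|exact: wsum_cvg fB|exact: wsum_cvg gC].
by congr (limn (series _)); apply/funext => p; rewrite mulrDr.
Qed.

Lemma wsumN f B : (forall p, `|f p| <= B) ->
  wsum (fun p => - f p) = - wsum f.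
Proof.
move=> /(wsumZ (-1)); under eq_fun do rewrite mulN1r.
by rewrite mulN1r.
Qed.

Lemma wsumB f g B C : (forall p, `|f p| <= B) -> (forall p, `|g p| <= C) ->
  wsum (fun p => f p - g p) = wsum f - wsum g.
Proof.
move=> fB gC; rewrite -(wsumN gC); apply: (wsumD fB (C := C)) => p.
by rewrite normrN.
Qed.

Lemma wsum0 : wsum (fun=> 0) = 0.
Proof.
by have := @wsumZ 0 (fun=> 0) 0; rewrite !mul0r => -> // p; rewrite normr0.
Qed.

Lemma wsum_sum (I : eqType) (s : seq I) (k : I -> R) (F : I -> nat -> R) B :
  (forall i p, `|F i p| <= B) ->
  wsum (fun p => \sum_(i <- s) k i * F i p) = \sum_(i <- s) k i * wsum (F i).
Proof.
move=> FB; elim: s => [|i s IHs].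
  by under eq_fun do rewrite big_nil; rewrite big_nil wsum0.
under eq_fun do rewrite big_cons.
rewrite (@wsumD _ _ (`|k i| * B) (\sum_(i <- s) `|k i| * B)).
- by rewrite big_cons IHs (wsumZ _ (FB i)).
- by move=> p; rewrite normrM ler_wpM2l.
- move=> p; apply: le_trans (ler_norm_sum _ _ _) _; apply: ler_sum => j _.
  by rewrite normrM ler_wpM2l.
Qed.

(** Dominated convergence for the weights [a]: by [wsum_tail] one index [K] controls all tails, and
    the first [K] terms converge as a finite sum. *)
Lemma wsum_lim (F : nat -> nat -> R) g B :
  (forall N p, `|F N p| <= B) -> (forall p, F ^~ p @ \oo --> g p) ->
  (fun N => wsum (F N)) @ \oo --> wsum g.
Proof.
move=> FB Fg.
have gB p : `|g p| <= B.
  rewrite -(cvg_lim (@Rhausdorff R) (cvg_norm (Fg p))).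
  apply: limr_le; last by near=> N; exact: FB.
  by apply/cvg_ex; eexists; apply: cvg_norm; exact: Fg.
have B0 : 0 <= B by exact: le_trans (gB 0%N).
apply/cvgrPdist_le => e e0.
have tl : (fun K => B * (l1 - series (fun p => `|a p|) K)) @ \oo --> 0.
  rewrite -[X in _ --> X](mulr0 B) -[X in B * X](subrr l1).
  by apply: cvgM; [exact: cvg_cst | apply: cvgB; [exact: cvg_cst | exact: cva]].
have e3 : 0 < e / 3 by rewrite divr_gt0.
have /cvgrPdist_le /(_ _ e3) [K _ HK] := tl.
move: (HK K (leqnn K)) => /=; rewrite sub0r normrN => /(le_trans (ler_norm _)) tK.
have sK : (fun N => series (fun p => a p * F N p) K) @ \oo --> series (fun p => a p * g p) K.
  rewrite /series /=; apply: cvg_sumr => i.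
  by apply: cvgM; [exact: cvg_cst | exact: Fg].
have /cvgrPdist_le /(_ _ e3) := sK.
move=> Hs; near=> N.
have HN : `|series (fun p => a p * g p) K - series (fun p => a p * F N p) K| <= e / 3.
  by near: N; exact: Hs.
have H1 := le_trans (wsum_tail K gB) tK.
have H2 := le_trans (wsum_tail K (FB N)) tK.
rewrite (_ : wsum g - _ = (wsum g - series (fun p => a p * g p) K) +
  (series (fun p => a p * g p) K - series (fun p => a p * F N p) K) -
  (wsum (F N) - series (fun p => a p * F N p) K)); last by ring.
rewrite (_ : e = e / 3 + e / 3 + e / 3); last by field.
apply: le_trans (ler_normB _ _) _; apply: lerD => //.
by apply: le_trans (ler_normD _ _) _; exact: lerD.
Unshelve. all: by end_near. Qed.

(** Truncating the inner sum at [N] leaves a finite sum that commutes with the outer one; both sides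
    are limits of this identity. *)
Lemma wsum_swap (F : nat -> nat -> R) B : (forall p l, `|F p l| <= B) ->
  wsum (fun p => wsum (F p)) = wsum (fun l => wsum (F ^~ l)).
Proof.
move=> FB.
have B0 : 0 <= B by exact: le_trans (FB 0%N 0%N).
have H1 : (fun N => wsum (fun p => \sum_(0 <= l < N) a l * F p l)) @ \oo
    --> wsum (fun p => wsum (F p)).
  apply: (@wsum_lim _ _ (B * l1)).
    move=> N p; apply: le_trans (ler_norm_sum _ _ _) _.
    apply: (@le_trans _ _ (B * series (fun p => `|a p|) N)).
      rewrite /series /= mulr_sumr ler_sum // => i _.
      by rewrite normrM mulrC ler_wpM2r.
    by rewrite ler_wpM2l// nseries_le_l1.
  by move=> p; exact: (wsum_cvgn (FB p)).
have H2 : (fun N => \sum_(0 <= l < N) a l * wsum (F ^~ l)) @ \oo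
    --> wsum (fun l => wsum (F ^~ l)).
  by apply: (@wsum_cvgn _ (B * l1)) => l; exact: (wsum_bound (FB ^~ l)).
apply: (cvg_unique (@Rhausdorff R) H1).
suff -> : (fun N => wsum (fun p => \sum_(0 <= l < N) a l * F p l)) =
  (fun N => \sum_(0 <= l < N) a l * wsum (F ^~ l)) by [].
by apply/funext => N; apply: wsum_sum => i p; exact: FB.
Qed.

Lemma wsum_split f (k : nat) B : (forall p, `|f p| <= B) ->
  wsum f = \sum_(p < k) a p * f p
    + limn (series (fun p => a (k + p)%N * f (k + p)%N)).
Proof.
move=> fB; set g := fun p => a p * f p.
have cg : series g @ \oo --> wsum f by exact: wsum_cvgn fB.
have cg' : (fun n => series g (k + n)%N) @ \oo --> wsum f.
  under eq_fun do rewrite addnC.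
  by move: cg; rewrite -(cvg_shiftn k).
have E : series (fun p => g (k + p)%N) = (fun n => series g (k + n)%N - series g k).
  apply/funext => n; rewrite sub_series_geq ?leq_addr// /series /=.
  have -> : \sum_(k <= i < k + n) g i = \sum_(0 + k <= i < k + n) g i by rewrite add0n.
  by rewrite big_addn addKn; apply: eq_bigr => i _; rewrite addnC.
have -> : limn (series (fun p => g (k + p)%N)) = wsum f - series g k.
  rewrite E; apply: (cvg_lim (@Rhausdorff R)).
  by apply: cvgB => //; exact: cvg_cst.
by rewrite /series /= big_mkord addrC subrK.
Qed.

(** An indicator under [wsum] turns a finite sum whose length grows with [N] into a sum over all
    indices, within reach of [wsum_lim]. *)
Lemma wsum_finite f B (N : nat) : (forall p, `|f p| <= B) ->
  wsum (fun p => (p < N)%:R * f p) = \sum_(0 <= p < N) a p * f p.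
Proof.
move=> fB; have gB p : `|(p < N)%:R * f p| <= B.
  by case: ltnP => _; rewrite ?mul1r ?mul0r ?normr0//; exact: le_trans (fB 0%N).
rewrite (wsum_split N gB) [X in _ + X](_ : _ = 0) ?addr0.
  by rewrite big_mkord; apply: eq_bigr => i _; rewrite ltn_ord mul1r.
by apply: lim_series0 => p; rewrite ltnNge leq_addr mul0r mulr0.
Qed.

(** Squared norms of truncated innovations are square partial sums of a double series; here both
    truncations are removed at once. *)
Lemma wsum_square (F : nat -> nat -> R) B : (forall p q, `|F p q| <= B) ->
  (fun N => \sum_(0 <= p < N) a p * \sum_(0 <= q < N) a q * F p q) @ \oo
    --> wsum (fun p => wsum (F p)).
Proof.
move=> FB.
have B0 : 0 <= B by exact: le_trans (FB 0%N 0%N).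
have GB (N p : nat) : `|\sum_(0 <= q < N) a q * F p q| <= B * l1.
  apply: le_trans (ler_norm_sum _ _ _) _.
  apply: (@le_trans _ _ (B * series (fun p => `|a p|) N)).
    rewrite /series /= mulr_sumr ler_sum // => i _.
    by rewrite normrM mulrC ler_wpM2r.
  by rewrite ler_wpM2l// nseries_le_l1.
under eq_fun => N do rewrite -(@wsum_finite _ (B * l1) N (GB N)).
apply: (@wsum_lim _ _ (B * l1)) => [N p|p].
  case: ltnP => _; rewrite ?mul1r ?GB ?mul0r ?normr0//.
  by rewrite mulr_ge0 ?l1_ge0.
apply: cvg_trans (wsum_cvgn (FB p)).
apply: near_eq_cvg; near=> N.
have -> : (p < N)%N by near: N; exists p.+1.
by rewrite mul1r.
Unshelve. all: by end_near. Qed.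

End WeightedSums.

Lemma cvgn_normed_shift (R : realType) (a : nat -> R) k :
  cvgn [normed series a] -> cvgn [normed series (fun p => a (k + p)%N)].
Proof.
move=> cva; have := cva; rewrite -(is_cvg_series_restrict k) => c.
have -> : [normed series (fun p => a (k + p)%N)] =
    (fun n => \sum_(k <= i < n + k) `|a i|).
  apply/funext => n; rewrite /series /= -{2}[k]add0n big_addn addnK.
  by apply: eq_bigr => i _; rewrite addnC.
case/cvg_ex: c => l; rewrite -(cvg_shiftn k) => cl.
by apply/cvg_ex; exists l; exact: cl.
Qed.

(** * Convolution *)

Section Convolution.
Variable R : comNzRingType.
Implicit Types f g h : nat -> R.

Definition conv f g (n : nat) : R := \sum_(j < n.+1) f j * g (n - j)%N.

(** Identifies [conv] with a coefficient of a product of truncated polynomials, so that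
    commutativity and associativity come from the polynomial ring. *)
Lemma conv_coef f g (n N : nat) : (n < N)%N ->
  conv f g n = ((\poly_(i < N) f i) * (\poly_(i < N) g i))`_n.
Proof.
move=> nN; rewrite coefM; apply: eq_bigr => j _; rewrite !coef_poly.
by rewrite (leq_ltn_trans (leq_subr _ _) nN) (leq_ltn_trans _ nN)// -ltnS.
Qed.

Lemma convC f g n : conv f g n = conv g f n.
Proof. by rewrite !(@conv_coef _ _ _ n.+1) // mulrC. Qed.

Lemma convA f g h n : conv f (conv g h) n = conv (conv f g) h n.
Proof.
have E (u v w : nat -> R) : conv u (conv v w) n =
    ((\poly_(i < n.+1) u i) * ((\poly_(i < n.+1) v i) * (\poly_(i < n.+1) w i)))`_n.
  rewrite coefM; apply: eq_bigr => j _; rewrite coef_poly ltn_ord.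
  by rewrite (@conv_coef v w (n - j) n.+1)// ltnS leq_subr.
by rewrite E [RHS]convC E; congr (_`_n); rewrite mulrA mulrC.
Qed.
End Convolution.

(** * Two inequalities for real quadratics *)

Section Real.
Variable R : realType.
Implicit Types x C E T : R.

Lemma deg2_discr (p q r : R) : 0 <= p ->
  (forall x, 0 <= p * x ^+ 2 + 2 * q * x + r) -> q ^+ 2 <= p * r.
Proof.
rewrite le_eqVlt => /predU1P[<-|p0] H.
  rewrite mul0r; have [->|q0] := eqVneq q 0; first by rewrite expr0n.
  (* With zero leading coefficient the quadratic is affine; at this point its value is -1. *)
  have := H (- (r + 1) / (2 * q)); rewrite mul0r add0r.
  rewrite (_ : _ * _ + r = -1); first by rewrite ler0N1.
  by field.
have := H (- q / p).
rewrite (_ : _ + r = r - q ^+ 2 / p); last by field; rewrite gt_eqF.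
by rewrite subr_ge0 ler_pdivrMr // mulrC.
Qed.

(* Optimising over [v] turns boundedness on the enlarged space into a decrease of
   the norm by [E]. *)
Lemma quad_drop x C E T : 0 <= E -> E <= C -> 0 <= T ->
  (forall v, (x + v * E) ^+ 2 <= C * (T + v ^+ 2 * E)) ->
  x ^+ 2 <= (C - E) * T.
Proof.
move=> E0 EC T0 H.
have [Ez|En] := eqVneq E 0.
  by have := H 0; rewrite Ez !mul0r expr0n /= !mul0r !addr0 subr0.
have Ep : 0 < E by rewrite lt_neqAle eq_sym En.
(* The hypothesis is a nonnegative quadratic in [v] with leading coefficient [E * (C - E)], and [D]
   is its discriminant inequality. The difference of the two sides of [D] is [C * E] times that of
   the goal. *)
have D : (x * E) ^+ 2 <= (E * (C - E)) * (C * T - x ^+ 2).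
  have -> : (x * E) ^+ 2 = (- (x * E)) ^+ 2 by rewrite sqrrN.
  apply: deg2_discr => [|v]; first by rewrite mulr_ge0 ?subr_ge0.
  have := H v; rewrite -subr_ge0.
  by rewrite [X in 0 <= X](_ : _ = E * (C - E) * v ^+ 2 + 2 * - (x * E) * v + (C * T - x ^+ 2)); last by ring.
have Cp : 0 < C by exact: lt_le_trans EC.
rewrite -(ler_pM2l (mulr_gt0 Cp Ep)) -subr_ge0.
rewrite -subr_ge0 in D.
by rewrite [X in 0 <= X](_ : _ = E * (C - E) * (C * T - x ^+ 2) - (x * E) ^+ 2); last by ring.
Qed.
End Real.

(** * Functionals on the span of a stationary sequence *)

Section Functionals.
Context {R : realType}.
Variables (gam : int -> R) (c a : nat -> R).
Implicit Types (s t : seq (R * int)) (f g : int -> R) (C : R).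

(** [cext (i - k)] is [(X_i, e_k)]; the zero extension says that [X_i] is orthogonal to later
    innovations. *)
Definition cext (i : int) : R := if i is Posz k then c k else 0.
(* With [f i = (Y, X_i)] and [t] listing pairs (coefficient, index), [eval f t] is
   [(Y, sum_t)] and [gram s t] is [(sum_s, sum_t)]. *)
Definition eval f t : R := \sum_(x <- t) x.1 * f x.2.
Definition gram s t : R :=
  \sum_(x <- s) \sum_(y <- t) x.1 * y.1 * gam (x.2 - y.2).
(* The inner product of [sum_t] with the innovation [e_k]. *)
Definition innov_coord t (k : int) : R := \sum_(y <- t) y.1 * cext (y.2 - k).
(* [f] comes from a vector of squared norm at most [C]. *)
Definition gram_bounded C f : Prop := forall t, eval f t ^+ 2 <= C * gram t t.
Definition scale_vec (k : R) t := [seq (k * x.1, x.2) | x <- t].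
(** The functional that represents the finite combination [t] itself. *)
Definition gram_fun t (i : int) : R := \sum_(x <- t) x.1 * gam (i - x.2).

Hypothesis gam_psd : forall t, 0 <= gram t t.
Hypothesis gam_even : forall i, gam (- i) = gam i.

Lemma eval_cat f s t : eval f (s ++ t) = eval f s + eval f t.
Proof. by rewrite /eval big_cat. Qed.

Lemma eval_scale_vec f k t : eval f (scale_vec k t) = k * eval f t.
Proof. by rewrite /eval big_map mulr_sumr; apply: eq_bigr => x _; rewrite mulrA. Qed.

Lemma gramE s t : gram s t = eval (gram_fun t) s.
Proof.
apply: eq_bigr => x _; rewrite /gram_fun mulr_sumr.
by apply: eq_bigr => y _; rewrite mulrA.
Qed.

Lemma gramC s t : gram s t = gram t s.
Proof.
rewrite /gram exchange_big; apply: eq_bigr => x _; apply: eq_bigr => y _.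
by rewrite -gam_even opprB [y.1 * _]mulrC.
Qed.

Lemma gram_catl s1 s2 t : gram (s1 ++ s2) t = gram s1 t + gram s2 t.
Proof. by rewrite !gramE eval_cat. Qed.

Lemma gram_scll k s t : gram (scale_vec k s) t = k * gram s t.
Proof. by rewrite !gramE eval_scale_vec. Qed.

Lemma gram_cat s t :
  gram (s ++ t) (s ++ t) = gram s s + 2 * gram t s + gram t t.
Proof.
rewrite gram_catl gramC gram_catl [gram t (s ++ t)]gramC gram_catl [gram s t]gramC; ring.
Qed.

Lemma gram_cauchy_schwarz s t : gram s t ^+ 2 <= gram s s * gram t t.
Proof.
rewrite mulrC; apply: deg2_discr => // x.
have := gam_psd (s ++ scale_vec x t).
rewrite gram_cat gram_scll [gram (scale_vec x t) (scale_vec x t)]gram_scll [gram t (scale_vec x t)]gramC gram_scll.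
by rewrite [gram t s]gramC [X in 0 <= X -> _](_ : _ = gram t t * x ^+ 2 + 2 * gram s t * x + gram s s); last ring.
Qed.

Lemma gram_bounded_gram_fun s : gram_bounded (gram s s) (gram_fun s).
Proof. by move=> t; rewrite -gramE mulrC gram_cauchy_schwarz. Qed.

Lemma gram_bounded_le C D f : C <= D -> gram_bounded C f -> gram_bounded D f.
Proof. by move=> CD fC t; apply: le_trans (fC t) _; rewrite ler_wpM2r. Qed.

Lemma gram1 k i l j : gram [:: (k, i)] [:: (l, j)] = k * l * gam (i - j).
Proof. by rewrite /gram !big_seq1. Qed.

(** Both [X_0 + X_i] and [X_0 - X_i] have nonnegative squared norm. *)
Lemma gam_bound i : `|gam i| <= gam 0.
Proof.
have H (e : R) : e ^+ 2 = 1 -> 0 <= gam 0 + e * gam i.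
  move=> e1; have := gam_psd ([:: (1, 0)] ++ [:: (e, i)]).
  rewrite gram_cat !gram1 !subrr subr0 -(expr2 e) e1; lra.
have := H 1 (expr1n _ _); have := H (- 1) (etrans (sqrrN 1) (expr1n _ _)).
by rewrite ler_norml => *; lra.
Qed.

Lemma gam0_ge0 : 0 <= gam 0.
Proof. exact: le_trans (gam_bound 0). Qed.

Lemma gram_le s : gram s s <= (\sum_(x <- s) `|x.1|) ^+ 2 * gam 0.
Proof.
rewrite /gram expr2 mulr_suml mulr_suml; apply: ler_sum => x _.
rewrite mulr_sumr mulr_suml; apply: ler_sum => y _.
apply: le_trans (ler_norm _) _; rewrite !normrM ler_wpM2l ?mulr_ge0//.
exact: gam_bound.
Qed.

(** A bound on [|f i|] that avoids a square root: [f i ^+ 2 <= C * gam 0], and a nonnegative number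
    is at most 1 or at most its square. *)
Definition sup_bound C : R := C * gam 0 + 1.

Lemma gram_bounded_sup_bound C f i : gram_bounded C f -> `|f i| <= sup_bound C.
Proof.
move=> /(_ [:: (1, i)]); rewrite /eval big_seq1 gram1 subrr !mul1r /sup_bound => H.
have [//|/ltW] := leP `|f i| 1; first by move=> f1; apply: le_trans f1 _; rewrite lerDr; apply: le_trans H; rewrite sqr_ge0.
move=> f1; apply: le_trans (_ : `|f i| ^+ 2 <= _); first by rewrite expr2 ler_peMl.
by rewrite real_normK ?num_real//; apply: le_trans H _; rewrite lerDl.
Qed.

(** * Innovations *)

Hypothesis cva : cvgn [normed series a].
Hypothesis ca : forall n, conv c a n = - (n == 0%N)%:R.
Hypothesis YW : forall i : int, wsum a (fun p => gam (p%:Z + i)) = - cext i.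

(* [(Y, e_k)] for the innovation [e_k = - sum_p a_p X_(k-p)]. *)
Definition innov (k : int) f : R := - wsum a (fun p => f (k - p%:Z)).

Lemma cext_bound i : `|cext i| <= gam 0 * l1 a.
Proof. by rewrite -normrN -YW; apply: wsum_bound => // p; exact: gam_bound. Qed.

(** By causality the series is a finite sum, the convolution of [a] and [c], which [ca] evaluates.
    This is the source of the orthonormality of the innovations. *)
Lemma wsum_cext (i : int) : wsum a (fun p => cext (i - p%:Z)) = - (i == 0)%:R.
Proof.
case: i => [n|n]; last first.
  rewrite [X in wsum _ X](_ : _ = fun=> 0) ?wsum0 ?oppr0//.
  by apply/funext => p; rewrite (_ : Negz n - p%:Z = Negz (n + p))//; lia.
rewrite [X in wsum _ X](_ : _ = fun p => (p < n.+1)%:R * cext (n%:Z - p%:Z)); last first.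
  apply/funext => p; case: ltnP => pn; first by rewrite mul1r.
  by rewrite mul0r (_ : n%:Z - p%:Z = Negz (p - n.+1))//; lia.
rewrite (wsum_finite _ _ (fun p => cext_bound (n%:Z - p%:Z)))//.
rewrite -ca convC /conv big_mkord; apply: eq_bigr => j _.
by rewrite subzn// -ltnS.
Qed.

(** The first [N] lags of [sum_(i < K) mu_i e_(k i)]. An innovation is an infinite combination,
    whereas [gram_bounded] speaks of finite lists only. *)
Definition innov_list (K N : nat) (mu : nat -> R) (k : nat -> int) : seq (R * int) :=
  [seq (mu i * - a p, k i - p%:Z) | i <- index_iota 0 K, p <- index_iota 0 N].

Lemma eval_innov_list f B K mu k : (forall i, `|f i| <= B) ->
  (fun N => eval f (innov_list K N mu k)) @ \oo --> \sum_(0 <= i < K) mu i * innov (k i) f.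
Proof.
move=> fB.
have -> : (fun N => eval f (innov_list K N mu k)) = (fun N => \sum_(0 <= i < K)
    mu i * - series (fun p => a p * f (k i - p%:Z)) N).
  apply/funext => N; rewrite /eval big_allpairs_dep; apply: eq_bigr => i _.
  by rewrite /series /= -sumrN mulr_sumr; apply: eq_bigr => p _ /=; ring.
apply: cvg_sumr => i; apply: cvgM; first exact: cvg_cst.
by apply: cvgN; apply: wsum_cvgn => //.
Qed.

Lemma gram_fun_bound t i : `|gram_fun t i| <= sup_bound (gram t t).
Proof. exact: gram_bounded_sup_bound (gram_bounded_gram_fun t). Qed.

Lemma innov_sub f g B C k : (forall i, `|f i| <= B) -> (forall i, `|g i| <= C) ->
  innov k (fun i => f i - g i) = innov k f - innov k g.
Proof.
move=> fB gC; rewrite /innov (wsumB cva (fun p => fB (k - p%:Z)) (fun p => gC (k - p%:Z))).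
by rewrite opprB opprK addrC.
Qed.

Lemma innov_gram_fun t k : innov k (gram_fun t) = innov_coord t k.
Proof.
rewrite /innov /gram_fun.
rewrite (@wsum_sum _ _ cva _ t (fun x => x.1) (fun x p => gam (k - p%:Z - x.2)) (gam 0)).
  rewrite -sumrN; apply: eq_bigr => y _; rewrite -mulrN; congr (_ * _).
  rewrite -[RHS]opprK -YW; congr (- wsum _ _); apply/funext => p.
  by rewrite -gam_even; congr gam; ring.
by move=> *; exact: gam_bound.
Qed.

(** Orthonormality of the innovations: the cross term of [e_(k i)] and [e_(k j)] tends to a double
    series, whose inner sum is given by [YW] and whose outer sum by [wsum_cext]. Injectivity of [k]
    keeps distinct terms orthogonal. *)
Lemma gram_innov_list K mu (k : nat -> int) : injective k ->
  (fun N => gram (innov_list K N mu k) (innov_list K N mu k)) @ \oo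
    --> \sum_(0 <= i < K) mu i ^+ 2.
Proof.
move=> kinj.
have -> : (fun N => gram (innov_list K N mu k) (innov_list K N mu k)) = (fun N =>
    \sum_(0 <= i < K) \sum_(0 <= j < K) mu i * mu j *
      \sum_(0 <= p < N) a p * \sum_(0 <= q < N) a q * gam (q%:Z + (k i - k j - p%:Z))).
  apply/funext => N; rewrite /gram big_allpairs_dep; apply: eq_bigr => i _.
  under eq_bigr do rewrite big_allpairs_dep.
  rewrite exchange_big; apply: eq_bigr => j _; rewrite mulr_sumr.
  apply: eq_bigr => p _; rewrite mulrA mulr_sumr; apply: eq_bigr => q _ /=.
  rewrite (_ : k i - _ - _ = q%:Z + (k i - k j - p%:Z)); ring.
have -> : \sum_(0 <= i < K) mu i ^+ 2 = \sum_(0 <= i < K) \sum_(0 <= j < K)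
    mu i * mu j * (i == j)%:R.
  rewrite !big_mkord; apply: eq_bigr => i _.
  rewrite big_mkord (bigD1 i)//= eqxx mulr1 big1 ?addr0// => j /negPf.
  by rewrite -val_eqE /= eq_sym => ->; rewrite mulr0.
apply: cvg_sumr => i; apply: cvg_sumr => j; apply: cvgM; first exact: cvg_cst.
have -> : (i == j)%:R = wsum a (fun p => wsum a (fun q => gam (q%:Z + (k i - k j - p%:Z)))).
  under eq_fun do rewrite YW.
  rewrite -[LHS]opprK (_ : (i == j) = (k i - k j == 0)); last by rewrite subr_eq0 (inj_eq kinj).
  rewrite -wsum_cext.
  have := @wsumZ _ _ cva (-1) _ _ (fun p => cext_bound (k i - k j - p%:Z)).
  by under eq_fun do rewrite mulN1r; rewrite mulN1r => ->.
by apply: (wsum_square _ (B := gam 0)) => // p q; exact: gam_bound.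
Qed.

(** Letting the number of lags grow extends the bound to [t + sum_i mu_i e_(k i)], whose squared
    norm is the bracket on the right. *)
Lemma gram_bounded_ext C f t K mu (k : nat -> int) : injective k -> gram_bounded C f ->
  (eval f t + \sum_(0 <= i < K) mu i * innov (k i) f) ^+ 2 <=
  C * (gram t t + 2 * \sum_(0 <= i < K) mu i * innov_coord t (k i)
       + \sum_(0 <= i < K) mu i ^+ 2).
Proof.
move=> kinj fC.
have H1 : (fun N => eval f (t ++ innov_list K N mu k) ^+ 2) @ \oo -->
    (eval f t + \sum_(0 <= i < K) mu i * innov (k i) f) ^+ 2.
  under eq_fun do rewrite eval_cat expr2.
  rewrite expr2; apply: cvgM; (apply: cvgD; [exact: cvg_cst|]);
    by apply: eval_innov_list => i; exact: gram_bounded_sup_bound.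
have H2 : (fun N => C * gram (t ++ innov_list K N mu k) (t ++ innov_list K N mu k)) @ \oo -->
  C * (gram t t + 2 * \sum_(0 <= i < K) mu i * innov_coord t (k i) + \sum_(0 <= i < K) mu i ^+ 2).
  under eq_fun do rewrite gram_cat.
  apply: cvgM; first exact: cvg_cst.
  apply: cvgD; last exact: gram_innov_list.
  apply: cvgD; first exact: cvg_cst.
  apply: cvgM; first exact: cvg_cst.
  under eq_fun do rewrite gramE; under eq_bigr do rewrite -innov_gram_fun.
  by apply: eval_innov_list => i; exact: gram_fun_bound.
apply: ler_cvg_to H1 H2 _.
by near=> N; exact: fC.
Unshelve. all: by end_near. Qed.

(** * Reflection and projection onto the past *)

Lemma cext_neg (i : int) : i < 0 -> cext i = 0.
Proof. by case: i. Qed.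

(* Time reversal exchanging [(-oo, -1]] and [[-n, +oo)]. *)
Definition mirror (n : nat) f (i : int) : R := f (- n%:Z - 1 - i).
(* The projection onto [H_(-oo,-1]]: subtract the components along the
   innovations [e_0, e_1, ...], of which only finitely many see [X_i]. *)
Definition past_proj f (i : int) : R := if i is Posz m then
  f i - \sum_(0 <= k < m.+1) cext (i - k%:Z) * innov k%:Z f else f i.

(** Innovations later than [i] are orthogonal to [X_i], so the range of subtraction may be enlarged;
    a finite list of indices then admits a common range. *)
Lemma past_projE f (i : int) (K : nat) : i < K%:Z ->
  past_proj f i = f i - \sum_(0 <= k < K) cext (i - k%:Z) * innov k%:Z f.
Proof.
case: i => [m|m] mK; last first.
  by rewrite /= big1 ?subr0// => k _; rewrite cext_neg ?mul0r//; lia.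
rewrite /= (@big_cat_nat _ _ _ m.+1 0 K)//=.
rewrite [X in _ - (_ + X)]big_nat_cond [X in _ - (_ + X)]big1 ?addr0// => k /andP[/andP[mk _] _].
by rewrite cext_neg ?mul0r//; lia.
Qed.

(** Time reversal is an isometry because [gam] is even. *)
Lemma gram_bounded_mirror n C f : gram_bounded C f -> gram_bounded C (mirror n f).
Proof.
move=> fC t; pose t' := [seq (x.1, - n%:Z - 1 - x.2) | x <- t].
have -> : eval (mirror n f) t = eval f t' by rewrite /eval big_map.
suff -> : gram t t = gram t' t' by exact: fC.
rewrite /gram big_map; apply: eq_bigr => x _; rewrite big_map.
by apply: eq_bigr => y _ /=; rewrite -gam_even; congr (_ * gam _); ring.
Qed.

Lemma index_bounded t : exists K : nat, forall x, x \in t -> x.2 < K%:Z.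
Proof.
elim: t => [|x t [K IH]]; first by exists 0%N.
exists (maxn `|x.2|%N.+1 K) => y; rewrite inE => /predU1P[->|/IH].
  by move: (x.2) => z; lia.
by move: (y.2) (`|x.2|%N.+1) => z w; lia.
Qed.

Lemma eval_past_proj f t (K : nat) : (forall x, x \in t -> x.2 < K%:Z) ->
  eval (past_proj f) t = eval f t - \sum_(0 <= k < K) innov_coord t k%:Z * innov k%:Z f.
Proof.
move=> tK; rewrite /eval big_seq.
under eq_bigr => x xt do rewrite (past_projE _ (tK x xt)) mulrBr.
rewrite sumrB -!big_seq; congr (_ - _).
rewrite big_seq; under eq_bigr do rewrite mulr_sumr.
rewrite -big_seq exchange_big; apply: eq_bigr => k _.
by rewrite /innov_coord mulr_suml; apply: eq_bigr => x _; rewrite mulrA.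
Qed.

Lemma Posz_inj : injective Posz.
Proof. by move=> x y []. Qed.

(** Bessel's inequality: testing the bound on the combination whose coefficients are the components
    themselves gives [E ^+ 2 <= C * E] for their sum of squares [E]. *)
Lemma innov_le C f (K : nat) : 0 <= C -> gram_bounded C f ->
  \sum_(0 <= k < K) innov k%:Z f ^+ 2 <= C.
Proof.
move=> C0 fC.
have := @gram_bounded_ext C f [::] K (fun k => innov k%:Z f) Posz Posz_inj fC.
rewrite /eval /gram !big_nil !add0r [X in 2 * X]big1; last first.
  by move=> i _; rewrite /innov_coord big_nil mulr0.
rewrite mulr0 add0r; under eq_bigr do rewrite -expr2.
set E := \sum_(_ <= _ < _) _.
have : 0 <= E by rewrite sumr_ge0// => i _; rewrite sqr_ge0.
rewrite le_eqVlt => /predU1P[<-//|E0].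
by rewrite expr2 ler_pM2r.
Qed.

(** Pythagoras in terms of bounds. The range [K1] also covers the indices of [t], so that on [t] the
    projection subtracts exactly the innovations below [K1]; the squares beyond [K] are dropped at
    the end. *)
Lemma gram_bounded_past_proj C f (K : nat) : 0 <= C -> gram_bounded C f ->
  gram_bounded (C - \sum_(0 <= k < K) innov k%:Z f ^+ 2) (past_proj f).
Proof.
move=> C0 fC t; have [K0 K0t] := index_bounded t.
pose K1 := maxn K K0.
have K1t x : x \in t -> x.2 < K1%:Z by rewrite /K1 => /K0t; move: (x.2) => z; lia.
pose E := \sum_(0 <= k < K1) innov k%:Z f ^+ 2.
have E0 : 0 <= E by rewrite sumr_ge0// => i _; rewrite sqr_ge0.
apply: (@le_trans _ _ ((C - E) * gram t t)); last first.
  rewrite ler_wpM2r// lerD2l lerN2 /E.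
  rewrite (@big_cat_nat _ _ _ K 0 K1)//= ?leq_maxl//.
  by rewrite lerDl sumr_ge0// => i _; rewrite sqr_ge0.
apply: quad_drop => //; first exact: innov_le.
(* Subtracting [innov_coord t k] replaces [t] by its projection onto the past; [v] scales the future
   part of [f], over which [quad_drop] optimises. The squared norm becomes [gram t t + v ^+ 2 * E]
   minus the sum of the [innov_coord t k ^+ 2], and this last sum is discarded. *)
move=> v; pose mu k := v * innov k%:Z f - innov_coord t k%:Z.
have := @gram_bounded_ext C f t K1 mu Posz Posz_inj fC.
rewrite (_ : eval f t + _ = eval (past_proj f) t + v * E); last first.
  rewrite (eval_past_proj f K1t) -addrA; congr (_ + _).
  rewrite addrC mulr_sumr -sumrB; apply: eq_bigr => k _; rewrite /mu; ring.
move=> /le_trans; apply; rewrite ler_wpM2l// -addrA lerD2l.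
rewrite mulr_sumr -big_split /= mulr_sumr; apply: ler_sum => k _.
rewrite -subr_ge0 /mu [X in 0 <= X](_ : _ = innov_coord t k%:Z ^+ 2); last by ring.
by rewrite sqr_ge0.
Qed.

Lemma gram_bounded_past_proj_le C f : 0 <= C -> gram_bounded C f -> gram_bounded C (past_proj f).
Proof.
move=> C0 /(gram_bounded_past_proj 0 C0); rewrite big_geq// subr0; exact.
Qed.

Lemma innov_bound f B k : (forall i, `|f i| <= B) -> `|innov k f| <= B * l1 a.
Proof. by move=> fB; rewrite normrN; apply: wsum_bound. Qed.

Lemma innov_past_proj_neg f (k : nat) : innov (Negz k) (past_proj f) = innov (Negz k) f.
Proof.
congr (- wsum _ _); apply/funext => p.
by rewrite (_ : Negz k - p%:Z = Negz (k + p))//; lia.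
Qed.

(** Of the subtracted terms only [l = k] meets [e_k], by [wsum_cext], and it cancels the
    component. *)
Lemma innov_past_proj_pos f B (k : nat) : (forall i, `|f i| <= B) -> innov k%:Z (past_proj f) = 0.
Proof.
move=> fB; rewrite /innov.
have -> : (fun p => past_proj f (k%:Z - p%:Z)) = (fun p => f (k%:Z - p%:Z) +
    \sum_(l <- index_iota 0 k.+1) - innov l%:Z f * cext (k%:Z - l%:Z - p%:Z)).
  apply/funext => p; rewrite (@past_projE _ _ k.+1); last by lia.
  rewrite -sumrN; congr (_ + _); apply: eq_bigr => l _.
  by rewrite mulNr mulrC; congr (- (_ * cext _)); ring.
have czB (i : nat) p := cext_bound (k%:Z - i%:Z - p%:Z).
rewrite (wsumD cva (B := B) (C := \sum_(l <- index_iota 0 k.+1) `|innov l%:Z f| * (gam 0 * l1 a))) //; last first.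
  move=> p; apply: le_trans (ler_norm_sum _ _ _) _; apply: ler_sum => l _.
  by rewrite normrM normrN ler_wpM2l.
rewrite (wsum_sum cva _ _ czB).
under [X in _ + X]eq_bigr do rewrite wsum_cext mulrN mulNr opprK.
rewrite big_nat_recr//= subrr eqxx mulr1 big_nat_cond big1 ?add0r; last first.
  move=> l /andP[/andP[_ lk] _]; rewrite (_ : (_ == 0) = false) ?mulr0//; lia.
by rewrite /innov subrr oppr0.
Qed.

(* The double sum behind [- sum_l a_l e_(i+l)] is symmetric in its two indices, so
   this functional commutes with time reversal. *)
Definition dual_innov (i : int) f : R := - wsum a (fun l => innov (i + l%:Z) f).
(* The coefficient of [X_(-1-s)] in the AR expansion of the projection onto
   [H_(-oo,-1]]. *)
Definition ar_part (s : nat) f : R := - conv a (fun q => innov (Negz q) f) s.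
Definition tail_sum (j : nat) (r : nat -> R) : R :=
  limn (series (fun p => a (j + p)%N * r p)).

Lemma dual_innov_mirror n f B i : (forall i, `|f i| <= B) ->
  dual_innov i (mirror n f) = dual_innov (- n%:Z - 1 - i) f.
Proof.
move=> fB; rewrite /dual_innov /innov /mirror.
have E (F : nat -> nat -> R) : (forall l p, `|F l p| <= B) ->
    wsum a (fun l => - wsum a (F l)) = - wsum a (fun l => wsum a (F l)).
  by move=> FB; apply: (wsumN cva (B := B * l1 a)) => l; exact: wsum_bound.
rewrite (E (fun l p => f (- n%:Z - 1 - (i + l%:Z - p%:Z))))//.
rewrite (E (fun l p => f (- n%:Z - 1 - i + l%:Z - p%:Z)))// !opprK.
rewrite (@wsum_swap _ _ cva _ B)//.
congr wsum; apply/funext => p; congr wsum; apply/funext => l.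
by congr f; ring.
Qed.

(** Seen from the index [-1-s], the lags [l <= s] reach past innovations and the lags [l > s] reach
    [e_0, e_1, ...]; the sum is cut between them. *)
Lemma dual_innov_split f B (s : nat) : (forall i, `|f i| <= B) ->
  dual_innov (Negz s) f = ar_part s f - tail_sum s.+1 (fun p => innov p%:Z f).
Proof.
move=> fB; rewrite /dual_innov (@wsum_split _ _ cva _ s.+1 (B * l1 a)); last first.
  by move=> p; exact: innov_bound.
rewrite opprD; congr (- _ - _).
  apply: eq_bigr => j _; rewrite (_ : Negz s + _ = Negz (s - j))//.
  have := ltn_ord j; lia.
congr (limn (series _)); apply/funext => p.
by rewrite (_ : Negz s + _ = p%:Z)//; lia.
Qed.

Lemma tail_sum0 j : tail_sum j (fun=> 0) = 0.
Proof.
by apply: lim_series0 => p; rewrite mulr0.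
Qed.

(** * AR coefficients along the iteration *)

Definition alternate_step n f := past_proj (mirror n f).

(** The projection leaves the past innovations, hence [ar_part], unchanged, and the reflection sends
    [dual_innov] at [-1-s] to its value at [s - n]. Since the future components of [f] vanish, this
    value is an AR coefficient of [f] for [s < n] and zero for [s >= n]. The future components
    created by the reflection supply the tail. *)
Lemma ar_part_alternate_step n f B (s : nat) : (forall i, `|f i| <= B) ->
  (forall p : nat, innov p%:Z f = 0) ->
  ar_part s (alternate_step n f) = (if (s < n)%N then ar_part (n - s.+1) f else 0)
    + tail_sum s.+1 (fun p => innov p%:Z (mirror n f)).
Proof.
move=> fB f0.
have JB i : `|mirror n f i| <= B by exact: fB.
have -> : ar_part s (alternate_step n f) = ar_part s (mirror n f).
  by congr (- _); apply: eq_bigr => j _; rewrite innov_past_proj_neg.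
have /eqP := dual_innov_split s JB; rewrite (dual_innov_mirror _ _ fB) eq_sym subr_eq => /eqP ->.
congr (_ + _); case: ltnP => sn.
  rewrite (_ : - n%:Z - 1 - Negz s = Negz (n - s.+1)); last by lia.
  rewrite (dual_innov_split _ fB) [X in _ - X](_ : _ = 0) ?subr0//.
  by under eq_fun do rewrite f0; rewrite tail_sum0.
rewrite /dual_innov [X in wsum _ X](_ : _ = fun=> 0) ?wsum0 ?oppr0//.
apply/funext => l; rewrite (_ : _ + _ = (s - n + l)%N%:Z) ?f0//; lia.
Qed.

Definition alternate n k f := iter k (alternate_step n) f.

Lemma alternate_gram_bounded n k C f : 0 <= C -> gram_bounded C f -> gram_bounded C (alternate n k f).
Proof.
move=> C0 fC; elim: k => //= k IH.
by apply: gram_bounded_past_proj_le => //; exact: gram_bounded_mirror.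
Qed.

(** Each step spends the square of this component out of the bound [C], and the remainder stays
    nonnegative; so the squares are summable. *)
Lemma innov_to0 n (p : nat) C f : 0 <= C -> gram_bounded C f ->
  (fun k => innov p%:Z (mirror n (alternate n k f))) @ \oo --> 0.
Proof.
move=> C0 fC; pose r k := innov p%:Z (mirror n (alternate n k f)).
have H k : 0 <= C - \sum_(0 <= i < k) r i ^+ 2 /\
    gram_bounded (C - \sum_(0 <= i < k) r i ^+ 2) (alternate n k f).
  elim: k => [|k [IH1 IH2]]; first by rewrite big_geq// subr0.
  rewrite big_nat_recr//= opprD addrA; set D := C - _ in IH1 IH2 *.
  have HJ := gram_bounded_mirror n IH2.
  have rE : r k ^+ 2 <= \sum_(0 <= q < p.+1) innov q%:Z (mirror n (alternate n k f)) ^+ 2.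
    by rewrite big_nat_recr//= lerDr sumr_ge0// => i _; rewrite sqr_ge0.
  split; first by rewrite subr_ge0; apply: le_trans rE (innov_le _ _ HJ).
  apply: gram_bounded_le (gram_bounded_past_proj p.+1 IH1 HJ).
  by rewrite lerD2l lerN2.
have cr : cvgn (series (fun i => r i ^+ 2)).
  apply: nondecreasing_is_cvgn.
    by apply/nondecreasing_series => i _ _; rewrite sqr_ge0.
  by exists C => _ [k _ <-]; rewrite -subr_ge0; case: (H k).
have r20 := cvg_series_cvg_0 cr.
apply/cvgrPdist_le => e e0.
have /cvgrPdist_le /(_ (e ^+ 2) (exprn_gt0 2 e0)) := r20.
have E (x : R) : `|0 - x| = `|x| by rewrite sub0r normrN.
apply: filterS => k; rewrite !E normrX.
by rewrite ler_pXn2r ?nnegrE ?(ltW e0)//.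
Qed.

Lemma mirror_alternate_sup_bound n k C f i : 0 <= C -> gram_bounded C f -> `|mirror n (alternate n k f) i| <= sup_bound C.
Proof. by move=> C0 fC; apply: gram_bounded_sup_bound; apply: gram_bounded_mirror; exact: alternate_gram_bounded. Qed.

(** * Continuity and linearity of the iteration *)

Lemma innov_lim (F : nat -> int -> R) g B k : (forall N i, `|F N i| <= B) ->
  (forall i, F ^~ i @ \oo --> g i) -> (fun N => innov k (F N)) @ \oo --> innov k g.
Proof.
move=> FB Fg; apply: cvgN.
apply: (@wsum_lim _ _ cva (fun N p => F N (k - p%:Z)) _ B) => [N p|p];
  [exact: FB | exact: Fg].
Qed.

Lemma past_proj_lim (F : nat -> int -> R) g B : (forall N i, `|F N i| <= B) ->
  (forall i, F ^~ i @ \oo --> g i) ->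
  forall i, (fun N => past_proj (F N) i) @ \oo --> past_proj g i.
Proof.
move=> FB Fg [m|m]; last exact: Fg.
rewrite /past_proj; apply: cvgB; first exact: Fg.
apply: cvg_sumr => k; apply: cvgM; first exact: cvg_cst.
exact: innov_lim FB Fg.
Qed.

(** The reflection permutes indices, and the projection at one index uses finitely many innovations,
    each continuous under bounded pointwise convergence. *)
Lemma alternate_lim n (F : nat -> int -> R) g C k : 0 <= C ->
  (forall N, gram_bounded C (F N)) -> (forall i, F ^~ i @ \oo --> g i) ->
  forall i, (fun N => alternate n k (F N) i) @ \oo --> alternate n k g i.
Proof.
move=> C0 FC Fg; elim: k => [//|k IH] i.
apply: (@past_proj_lim (fun N => mirror n (alternate n k (F N))) _ (sup_bound C)) => [N j|j].
  by exact: mirror_alternate_sup_bound.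
exact: IH.
Qed.

Definition lin_fun (r : seq nat) (mu : nat -> R) (G : nat -> int -> R) (i : int) : R :=
  \sum_(x <- r) mu x * G x i.

Lemma innov_lin_fun r mu G B k : (forall x i, `|G x i| <= B) ->
  innov k (lin_fun r mu G) = \sum_(x <- r) mu x * innov k (G x).
Proof.
move=> GB; rewrite /innov (wsum_sum cva r mu (fun x p => GB x (k - p%:Z))) -sumrN.
by apply: eq_bigr => x _; rewrite mulrN.
Qed.

Lemma past_proj_lin_fun r mu G B : (forall x i, `|G x i| <= B) ->
  past_proj (lin_fun r mu G) = lin_fun r mu (fun x => past_proj (G x)).
Proof.
move=> GB; apply/funext => -[m|m]//; rewrite /lin_fun /past_proj.
under [RHS]eq_bigr do rewrite mulrBr.
rewrite sumrB; congr (_ - _).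
under eq_bigr do rewrite (innov_lin_fun _ _ _ GB) mulr_sumr.
rewrite exchange_big; apply: eq_bigr => x _; rewrite mulr_sumr.
by apply: eq_bigr => k _; rewrite mulrCA.
Qed.

Lemma alternate_lin_fun n k r mu G C : 0 <= C -> (forall x, gram_bounded C (G x)) ->
  alternate n k (lin_fun r mu G) = lin_fun r mu (fun x => alternate n k (G x)).
Proof.
move=> C0 GC; elim: k => [//|k IH]; rewrite /alternate /= -/(alternate _ _ _) IH /alternate_step.
rewrite -(@past_proj_lin_fun _ _ (fun x => mirror n (alternate n k (G x))) (sup_bound C))// => x i.
by exact: mirror_alternate_sup_bound.
Qed.

(** The increment that step [k.+1] adds to the AR coefficient of index [j - 1], read as a functional
    of the starting vector [f]; for [X_(-n-1-m)] it turns out to be [b_(k+1)^m(n,j)]. *)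
Definition tail_innov n k j f : R := tail_sum j (fun p => innov p%:Z (mirror n (alternate n k f))).

Lemma tail_innov_bound n k C f p : 0 <= C -> gram_bounded C f ->
  `|innov p (mirror n (alternate n k f))| <= sup_bound C * l1 a.
Proof.
by move=> C0 fC; apply: innov_bound => i; exact: mirror_alternate_sup_bound.
Qed.

Lemma tail_innov_lin_fun n k j r mu G C : 0 <= C -> (forall x, gram_bounded C (G x)) ->
  tail_innov n k j (lin_fun r mu G) = \sum_(x <- r) mu x * tail_innov n k j (G x).
Proof.
move=> C0 GC; rewrite /tail_innov (alternate_lin_fun _ _ _ _ C0)//.
rewrite -(@wsum_sum _ _ (cvgn_normed_shift (k := j) cva) _ r mu
  (fun x p => innov p%:Z (mirror n (alternate n k (G x)))) (sup_bound C * l1 a)); last first.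
  by move=> x p; exact: tail_innov_bound.
congr tail_sum; apply/funext => p.
rewrite (_ : mirror n _ = lin_fun r mu (fun x => mirror n (alternate n k (G x))))//.
by rewrite (@innov_lin_fun _ _ _ (sup_bound C))// => x i; exact: mirror_alternate_sup_bound.
Qed.

Lemma tail_innov_lim n k j (F : nat -> int -> R) g C : 0 <= C ->
  (forall N, gram_bounded C (F N)) -> (forall i, F ^~ i @ \oo --> g i) ->
  (fun N => tail_innov n k j (F N)) @ \oo --> tail_innov n k j g.
Proof.
move=> C0 FC Fg.
apply: (@wsum_lim _ _ (cvgn_normed_shift (k := j) cva)
  (fun N p => innov p%:Z (mirror n (alternate n k (F N)))) _ (sup_bound C * l1 a)) => [N p|p].
  exact: tail_innov_bound.
apply: (@innov_lim _ _ (sup_bound C)) => [N i|i]; first by exact: mirror_alternate_sup_bound.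
exact: alternate_lim FC Fg _.
Qed.

(* The functional of [X_(-j)]. *)
Definition gam_shift (j : nat) (i : int) : R := gam (i + j%:Z).

Lemma gam_shift_gram_fun j : gam_shift j = gram_fun [:: (1, - j%:Z)].
Proof. by apply/funext => i; rewrite /gram_fun big_seq1 mul1r opprK. Qed.

Lemma gram_bounded_gam_shift j : gram_bounded (gam 0) (gam_shift j).
Proof.
have := gram_bounded_gram_fun [:: (1, - j%:Z)].
by rewrite gram1 subrr !mul1r -gam_shift_gram_fun.
Qed.

Lemma innov_gam_shift k j : innov k (gam_shift j) = cext (- (k + j%:Z)).
Proof. by rewrite gam_shift_gram_fun innov_gram_fun /innov_coord big_seq1 mul1r opprD addrC. Qed.

Lemma innov_gam_shift_pos (k j : nat) : (0 < j)%N -> innov k%:Z (gam_shift j) = 0.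
Proof. by move=> j0; rewrite innov_gam_shift cext_neg//; lia. Qed.

Lemma mirror_gam_shift n j : (0 < j <= n)%N -> mirror n (gam_shift j) = gam_shift (n.+1 - j).
Proof.
move=> jn; apply/funext => i; rewrite /mirror /gam_shift -gam_even; congr gam; lia.
Qed.

Lemma past_proj_gam_shift j : (0 < j)%N -> past_proj (gam_shift j) = gam_shift j.
Proof.
move=> j0; apply/funext => -[m|m]//; rewrite /past_proj big1 ?subr0// => k _.
by rewrite innov_gam_shift_pos ?mulr0.
Qed.

(** The window [X_(-1), ..., X_(-n)] lies in the past and is reversed by the reflection, so the
    iteration only exchanges [j] and [n + 1 - j]. *)
Lemma alternate_gam_shift n k j : (0 < j <= n)%N -> exists2 j', (0 < j' <= n)%N & alternate n k (gam_shift j) = gam_shift j'.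
Proof.
move=> jn; elim: k => [|k [j' jn' IH]]; first by exists j.
exists (n.+1 - j')%N; first by lia.
rewrite /alternate /= -/(alternate _ _ _) IH /alternate_step mirror_gam_shift// past_proj_gam_shift//; lia.
Qed.

(** Vectors of the window acquire no future components under reflection; this removes the terms
    [q <= n] from the expansion of a projected vector. *)
Lemma tail_innov_gam_shift n k j i : (0 < i <= n)%N -> tail_innov n k j (gam_shift i) = 0.
Proof.
move=> /(alternate_gam_shift k)[i' ii' E]; rewrite /tail_innov E mirror_gam_shift//.
rewrite (_ : (fun p => _) = fun=> 0) ?tail_sum0//; apply/funext => p.
by rewrite innov_gam_shift_pos// subn_gt0 ltnS; case/andP: ii'.
Qed.

(** * The coefficients [b_k^m] as increments of the iteration *)

(** The iteration starts at [X_(-n-1-m)] because its reflection is [X_m], whose components along the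
    innovations are MA coefficients. *)
Lemma innov_J_start n m (k : int) : innov k (mirror n (gam_shift (n.+1 + m))) = cext (m%:Z - k).
Proof.
rewrite -[RHS]opprK -YW; congr (- wsum _ _); apply/funext => p.
by rewrite /mirror /gam_shift; congr gam; lia.
Qed.

Lemma bcoef_rev m j : bcoef c a m j = \sum_(k < m.+1) c (m - k)%N * a (j + k)%N.
Proof.
rewrite /bcoef (reindex_inj rev_ord_inj); apply: eq_bigr => k _ /=.
have := ltn_ord k; rewrite subSS => km; congr (c _ * a _); lia.
Qed.

(** The prediction formula for the infinite past. When each innovation in [X_m - sum_k c_(m-k) e_k]
    is replaced by its AR series, the terms at times [0, ..., m] cancel by [ca], and only the lags
    that reach negative times remain. *)
Lemma proj_start n m i :
  (fun N => \sum_(0 <= q < N) bcoef c a m q.+1 * gam_shift q.+1 i) @ \oo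
  --> alternate_step n (gam_shift (n.+1 + m)) i.
Proof.
pose h (r : nat) := gam (i - r%:Z).
(* [- cext (i - k)] is a full AR series by [YW], and [conv a h k] is its part with lags at most [k];
   the difference keeps the lags that reach before time 0. *)
have E1 : alternate_step n (gam_shift (n.+1 + m)) i =
    \sum_(k < m.+1) c (m - k)%N * (- cext (i - k%:Z) - conv a h k).
  under eq_bigr do rewrite mulrBr mulrN.
  rewrite sumrB sumrN.
  have -> : \sum_(k < m.+1) c (m - k)%N * conv a h k = - gam (m%:Z - i).
    transitivity (conv (conv a h) c m); first by apply: eq_bigr => k _; rewrite mulrC.
    rewrite convC convA {1}/conv big_ord_recl /= ca eqxx mulN1r subn0 /h.
    rewrite big1 ?addr0; last by move=> k _; rewrite ca /= oppr0 mul0r.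
    by rewrite -gam_even opprB.
  rewrite opprK addrC.
  pose K := (maxn m `|i|%N).+1.
  have iK : i < K%:Z by rewrite /K; lia.
  rewrite /alternate_step (past_projE _ iK); congr (_ - _); first by rewrite /mirror /gam_shift; congr gam; lia.
  under eq_bigr do rewrite innov_J_start.
  rewrite (@big_cat_nat _ _ _ m.+1 0 K)//=; last by rewrite /K; lia.
  rewrite [X in _ + X]big_nat_cond [X in _ + X]big1 ?addr0; last first.
    by move=> k /andP[/andP[mk _] _]; rewrite [cext (m%:Z - _)]cext_neg ?mulr0//; lia.
  rewrite big_mkord; apply: eq_bigr => k _; rewrite mulrC; congr (_ * _).
  by rewrite subzn// -ltnS.
rewrite E1.
have -> : (fun N => \sum_(0 <= q < N) bcoef c a m q.+1 * gam_shift q.+1 i) =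
  (fun N => \sum_(k < m.+1) c (m - k)%N *
     series (fun q => a (k.+1 + q)%N * gam ((k.+1 + q)%N%:Z + (i - k%:Z))) N).
  apply/funext => N; rewrite /series /=.
  under [RHS]eq_bigr do rewrite mulr_sumr.
  rewrite exchange_big; apply: eq_bigr => q _; rewrite bcoef_rev mulr_suml.
  apply: eq_bigr => k _; rewrite -mulrA; congr (_ * (a _ * gam _)); lia.
apply: cvg_sumr => k; apply: cvgM; first exact: cvg_cst.
have gB p : `|gam (p%:Z + (i - k%:Z))| <= gam 0 by exact: gam_bound.
have := wsum_split cva k.+1 gB; rewrite YW => ->.
have -> : \sum_(p < k.+1) a p * gam (p%:Z + (i - k%:Z)) = conv a h k.
  apply: eq_bigr => p _; congr (_ * gam _); have := ltn_ord p; lia.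
rewrite (addrC (conv a h k)) addrK.
exact: (wsum_cvgn (cvgn_normed_shift (k := k.+1) cva) (fun p => gB (k.+1 + p)%N)).
Qed.

(** The bound does not depend on [N], so the partial sums of the predictor have uniformly bounded
    norm, as [tail_innov_lim] requires. *)
Lemma bcoef_l1 m N : \sum_(0 <= q < N) `|bcoef c a m q.+1| <=
  (\sum_(k < m.+1) `|c (m - k)%N|) * l1 a.
Proof.
apply: (@le_trans _ _ (\sum_(0 <= q < N) \sum_(k < m.+1) `|c (m - k)%N| * `|a (q.+1 + k)%N|)).
  apply: ler_sum => q _; rewrite bcoef_rev.
  by apply: le_trans (ler_norm_sum _ _ _) _; apply: ler_sum => k _; rewrite normrM.
rewrite exchange_big mulr_suml; apply: ler_sum => k _.
rewrite -mulr_sumr ler_wpM2l//.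
apply: (@le_trans _ _ (series (fun p => `|a p|) (k.+1 + N))); last exact: nseries_le_l1.
rewrite /series /= (@big_cat_nat _ _ _ k.+1 0 (k.+1 + N))//= ?leq_addr//.
rewrite [X in _ <= _ + X](_ : _ = \sum_(0 <= q < N) `|a (q.+1 + k)%N|).
  by rewrite lerDr sumr_ge0.
have -> : \sum_(k.+1 <= q < k.+1 + N) `|a q| = \sum_(0 + k.+1 <= q < k.+1 + N) `|a q| by rewrite add0n.
by rewrite big_addn addKn; apply: eq_bigr => q _; rewrite addnS.
Qed.

(** Induction on [k] with [m] free: the first step of the iteration is split off and expanded by
    [proj_start]. For [k = 0] causality makes the tail a finite sum. *)
Lemma bsucc_tail_innov n k m j : bsucc c a n k m j = tail_innov n k j (gam_shift (n.+1 + m)).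
Proof.
elim: k m => [|k IH] m.
  rewrite /= /tail_innov /alternate /=.
  under [X in tail_sum _ X]eq_fun do rewrite innov_J_start.
  rewrite bcoef_rev /tail_sum.
  have czB p : `|cext (m%:Z - p%:Z)| <= gam 0 * l1 a by exact: cext_bound.
  have cvj := cvgn_normed_shift (k := j) cva.
  rewrite -/(wsum (fun p => a (j + p)%N) (fun p => cext (m%:Z - p%:Z))).
  rewrite (wsum_split cvj m.+1 czB) [X in _ + X](_ : _ = 0) ?addr0.
    by apply: eq_bigr => p _; rewrite mulrC; congr (_ * _); rewrite subzn// -ltnS.
  by apply: lim_series0 => p; rewrite cext_neg ?mulr0//; lia.
rewrite /= /tail_innov.
have -> : alternate n k.+1 (gam_shift (n.+1 + m)) = alternate n k (alternate_step n (gam_shift (n.+1 + m))).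
  by rewrite /alternate iterSr.
rewrite -/(tail_innov n k j (alternate_step n (gam_shift (n.+1 + m)))).
apply: (cvg_lim (@Rhausdorff R)).
(* Of [n + N] terms exactly [N] remain once the window has dropped out, in step with the partial
   sums of the recursion. *)
pose F N := lin_fun (index_iota 0 (n + N)) (fun q => bcoef c a m q.+1) (fun q => gam_shift q.+1).
have -> : series (fun m1 => bcoef c a m (n + 1 + m1)%N * bsucc c a n k m1 j) =
    (fun N => tail_innov n k j (F N)).
  apply/funext => N; rewrite /F (tail_innov_lin_fun _ _ _ _ _ gam0_ge0); last by move=> x; exact: gram_bounded_gam_shift.
  rewrite (@big_cat_nat _ _ _ n 0 (n + N))//= ?leq_addr//.
  rewrite [X in _ = X + _]big_nat_cond [X in _ = X + _]big1 ?add0r; last first.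
    by move=> q /andP[/andP[_ qn] _]; rewrite tail_innov_gam_shift ?mulr0.
  have -> : \sum_(n <= q < n + N) bcoef c a m q.+1 * tail_innov n k j (gam_shift q.+1) =
     \sum_(0 + n <= q < n + N) bcoef c a m q.+1 * tail_innov n k j (gam_shift q.+1) by rewrite add0n.
  rewrite big_addn addKn /series /=; apply: eq_bigr => q _.
  by rewrite IH; congr (bcoef _ _ _ _ * tail_innov _ _ _ (gam_shift _)); lia.
set L := (\sum_(k < m.+1) `|c (m - k)%N|) * l1 a.
apply: (@tail_innov_lim _ _ _ F _ (L ^+ 2 * gam 0)).
- by rewrite mulr_ge0 ?sqr_ge0 ?gam0_ge0.
- move=> N; pose t := [seq (bcoef c a m q.+1, - q.+1%:Z) | q <- index_iota 0 (n + N)].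
  have -> : F N = gram_fun t.
    by apply/funext => i; rewrite /gram_fun big_map; apply: eq_bigr => q _; rewrite opprK.
  apply: gram_bounded_le (gram_bounded_gram_fun t); apply: le_trans (gram_le t) _.
  rewrite ler_wpM2r ?gam0_ge0// ler_pXn2r ?nnegrE ?sumr_ge0//.
    by rewrite big_map bcoef_l1.
  by rewrite mulr_ge0 ?sumr_ge0 ?l1_ge0.
move=> i; have := @proj_start n m i; rewrite -(cvg_shiftn n).
by rewrite /F; under [in X in _ -> X]eq_fun do rewrite addnC.
Qed.

(** * Convergence to the normal equations *)

Hypothesis c2 : (fun N => \sum_(k < N) c k ^+ 2) @ \oo --> gam 0.

(** A truncated MA expansion with its error: the bound is tested on
    [X_(-1-r) - sum_(k < N) c_k e_(-1-r-k)], whose squared norm is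
    [gam 0 - sum_(k < N) c_k ^+ 2]. *)
Lemma neg_approx C f (r N : nat) : gram_bounded C f ->
  (f (Negz r) - \sum_(0 <= q < r + N) cext (q%:Z - r%:Z) * innov (Negz q) f) ^+ 2
  <= C * (gam 0 - \sum_(k < N) c k ^+ 2).
Proof.
move=> fC; have Ninj : injective Negz by move=> x y [].
have := @gram_bounded_ext C f [:: (1, Negz r)] (r + N) (fun q => - cext (q%:Z - r%:Z)) Negz Ninj fC.
rewrite /eval big_seq1 gram1 subrr !mul1r.
under eq_bigr do rewrite mulNr; rewrite sumrN => /le_trans; apply.
rewrite [X in _ + 2 * X](_ : _ = - \sum_(k < N) c k ^+ 2); last first.
  rewrite /innov_coord; under eq_bigr do rewrite big_seq1 mul1r mulNr /=.
  rewrite sumrN (@big_cat_nat _ _ _ r 0 (r + N))//= ?leq_addr//.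
  rewrite [X in - (X + _)]big_nat_cond [X in - (X + _)]big1 ?add0r; last first.
    by move=> q /andP[/andP[_ qr] _]; rewrite cext_neg ?mul0r//; lia.
  have -> : forall F : nat -> R, \sum_(r <= q < r + N) F q = \sum_(0 + r <= q < r + N) F q.
    by move=> F; rewrite add0n.
  rewrite big_addn addKn big_mkord; congr (- _); apply: eq_bigr => k _.
  rewrite (_ : (k + r)%N%:Z - r%:Z = k%:Z); last by lia.
  by rewrite (_ : Negz r - Negz _ = k%:Z)//; lia.
rewrite [X in _ + X](_ : _ = \sum_(k < N) c k ^+ 2); last first.
  rewrite (@big_cat_nat _ _ _ r 0 (r + N))//= ?leq_addr//.
  rewrite [X in X + _]big_nat_cond [X in X + _]big1 ?add0r; last first.
    by move=> q /andP[/andP[_ qr] _]; rewrite cext_neg ?oppr0 ?expr0n//; lia.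
  have -> : forall F : nat -> R, \sum_(r <= q < r + N) F q = \sum_(0 + r <= q < r + N) F q.
    by move=> F; rewrite add0n.
  rewrite big_addn addKn big_mkord; apply: eq_bigr => k _.
  by rewrite sqrrN (_ : (k + r)%N%:Z - r%:Z = k%:Z)//; lia.
by rewrite (_ : _ + _ + _ = gam 0 - \sum_(k < N) c k ^+ 2)//; ring.
Qed.

Section Iterates.
Variables n m : nat.
Hypothesis n_gt0 : (0 < n)%N.

Let iterate k : int -> R := alternate n k (gam_shift (n.+1 + m)).

Let iterate_gram_bounded k : gram_bounded (gam 0) (iterate k).
Proof. by apply: alternate_gram_bounded; [exact: gam0_ge0 | exact: gram_bounded_gam_shift]. Qed.

Let iterate_sup_bound k i : `|iterate k i| <= sup_bound (gam 0).
Proof. exact: gram_bounded_sup_bound. Qed.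

Let iterate_pos k (p : nat) : innov p%:Z (iterate k) = 0.
Proof.
case: k => [|k]; first by rewrite /iterate innov_gam_shift_pos.
rewrite /iterate /alternate /= /alternate_step (@innov_past_proj_pos _ (sup_bound (gam 0)))// => i.
exact: (iterate_sup_bound k).
Qed.

Let ar_part0 (s : nat) : (s < n)%N -> ar_part s (iterate 0) = 0.
Proof.
move=> sn; rewrite /ar_part /conv big1 ?oppr0// => j _.
by rewrite innov_gam_shift cext_neg ?mulr0//; lia.
Qed.

Let ar_partS k (s : nat) : ar_part s (iterate k.+1) = (if (s < n)%N then ar_part (n - s.+1) (iterate k) else 0)
    + tail_innov n k s.+1 (gam_shift (n.+1 + m)).
Proof. exact: (ar_part_alternate_step n s (iterate_sup_bound k) (iterate_pos k)). Qed.

(** Every step reverses the first [n] AR coefficients and adds one increment; the reversed argument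
    of [gcoef] at even [k] follows this. *)
Lemma gsumE k (s : nat) : (s < n)%N ->
  gsum c a n m s.+1 k = if odd k then ar_part s (iterate k) else ar_part (n - s.+1) (iterate k).
Proof.
move=> sn; elim: k => [|k IH].
  by rewrite /gsum big_geq//= ar_part0//; lia.
rewrite /gsum big_nat_recr//= -/(gsum c a n m s.+1 k) IH /gcoef /biter /=.
rewrite !bsucc_tail_innov !ar_partS sn; case: (odd k) => /=.
  rewrite (_ : (_ < _)%N); last by lia.
  by congr (ar_part _ _ + tail_innov _ _ _ _); lia.
by [].
Qed.

(** Beyond the window a coefficient consists of the latest increment alone, a tail sum of components
    that tend to zero. *)
Let ar_part_to0 (s : nat) : (n <= s)%N -> (fun k => ar_part s (iterate k)) @ \oo --> 0.
Proof.
move=> ns; rewrite -(cvg_shiftS (fun k => ar_part s (iterate k))).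
under eq_fun do rewrite /= ar_partS ltnNge ns add0r.
have cv := cvgn_normed_shift (k := s.+1) cva.
have := @wsum_lim _ _ cv (fun k p => innov p%:Z (mirror n (iterate k))) (fun=> 0)
  (sup_bound (gam 0) * l1 a).
rewrite (wsum0 cv); apply.
  by move=> k p; apply: tail_innov_bound; [exact: gam0_ge0 | exact: gram_bounded_gam_shift].
by move=> p; apply: innov_to0; [exact: gam0_ge0 | exact: gram_bounded_gam_shift].
Qed.

(** The projection does not touch negative indices and the reflection preserves the window, so there
    the iterate is known exactly: it is the right-hand side of the normal equations or its
    reversal. *)
Let iterate_neg k r : (r < n)%N -> iterate k (Negz r) =
  gam (if odd k then (m + r.+1)%N%:Z else (m + (n - r))%N%:Z).
Proof.
elim: k r => [|k IH] r rn; first by rewrite /iterate /alternate /= /gam_shift; congr gam; lia.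
rewrite (_ : iterate k.+1 (Negz r) = iterate k (- n%:Z - 1 - Negz r))//.
rewrite (_ : - n%:Z - 1 - Negz r = Negz (n - r.+1)); last by lia.
rewrite IH /=; last by lia.
by case: (odd k) => /=; congr (gam (Posz _)); lia.
Qed.

Let ar_part_bound k (s : nat) : `|ar_part s (iterate k)| <= l1 a * (sup_bound (gam 0) * l1 a).
Proof.
have B0 : 0 <= sup_bound (gam 0) by apply: le_trans (iterate_sup_bound 0 0).
rewrite normrN; apply: le_trans (ler_norm_sum _ _ _) _.
apply: (@le_trans _ _ ((\sum_(j < s.+1) `|a j|) * (sup_bound (gam 0) * l1 a))).
  rewrite mulr_suml; apply: ler_sum => j _; rewrite normrM ler_wpM2l//.
  exact: innov_bound.
rewrite ler_wpM2r ?mulr_ge0 ?l1_ge0//.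
by have := nseries_le_l1 cva s.+1; rewrite /series /= big_mkord.
Qed.

(** What is left of the iterate after its AR terms in the window are removed. Its vanishing on the
    window is the system of normal equations. *)
Let residual k (i : int) : R := iterate k i - \sum_(0 <= s < n) ar_part s (iterate k) * gam_shift s.+1 i.
Let ar_vec k := [seq (ar_part q (iterate k), - q.+1%:Z) | q <- index_iota 0 n].
Let M : R := l1 a * (sup_bound (gam 0) * l1 a) *+ n.

Let residualE k : residual k = fun i => iterate k i - gram_fun (ar_vec k) i.
Proof.
apply/funext => i; rewrite /residual /gram_fun big_map.
by under [in RHS]eq_bigr do rewrite opprK.
Qed.

(** Uniform in [k]: [(x - y) ^+ 2 <= 2 * x ^+ 2 + 2 * y ^+ 2], where [M] bounds the absolute sum of
    the coefficients in the window. *)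
Let residual_gram_bounded k : gram_bounded (2 * gam 0 + 2 * (M ^+ 2 * gam 0)) (residual k).
Proof.
move=> t; rewrite residualE.
have -> : eval (fun i => iterate k i - gram_fun (ar_vec k) i) t = eval (iterate k) t - eval (gram_fun (ar_vec k)) t.
  by rewrite /eval -sumrB; apply: eq_bigr => x _; rewrite mulrBr.
have H1 := iterate_gram_bounded k t.
have /(_ t) H2 : gram_bounded (M ^+ 2 * gam 0) (gram_fun (ar_vec k)).
  apply: gram_bounded_le (gram_bounded_gram_fun (ar_vec k)); apply: le_trans (gram_le _) _.
  rewrite ler_wpM2r ?gam0_ge0// ler_pXn2r ?nnegrE ?sumr_ge0//.
    rewrite big_map; apply: (@le_trans _ _ (\sum_(0 <= s < n) l1 a * (sup_bound (gam 0) * l1 a))).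
      by apply: ler_sum => s _; exact: ar_part_bound.
    by rewrite sumr_const_nat subn0.
  by rewrite mulrn_wge0//; apply: le_trans (ar_part_bound 0 0).
move: (eval _ _) (eval (gram_fun _) t) (gram t t) H1 H2 => x y g H1 H2.
have := sqr_ge0 (x + y); rewrite sqrrD => H3; rewrite sqrrB; nra.
Qed.

(** Convolving with [c] recovers the innovation components from the AR coefficients. The window
    terms cancel, which leaves finitely many terms with [s >= n], each tending to zero. *)
Let innov_residual q : (fun k => innov (Negz q) (residual k)) @ \oo --> 0.
Proof.
have E k : innov (Negz q) (residual k) = \sum_(n <= s < maxn n q.+1) ar_part s (iterate k) * cext (q%:Z - s%:Z).
  have -> : innov (Negz q) (residual k) = innov (Negz q) (iterate k) - \sum_(0 <= s < n) ar_part s (iterate k) * cext (q%:Z - s%:Z).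
    rewrite residualE (innov_sub _ (iterate_sup_bound k) (gram_fun_bound (ar_vec k))) innov_gram_fun.
    rewrite /innov_coord big_map; congr (_ - _); apply: eq_bigr => s _.
    by rewrite /=; congr (_ * cext _); lia.
  have -> : innov (Negz q) (iterate k) = \sum_(0 <= s < maxn n q.+1) ar_part s (iterate k) * cext (q%:Z - s%:Z).
    rewrite (@big_cat_nat _ _ _ q.+1 0 (maxn n q.+1))//= ?leq_maxr//.
    rewrite [X in _ = _ + X]big_nat_cond [X in _ = _ + X]big1 ?addr0; last first.
      by move=> s /andP[/andP[qs _] _]; rewrite cext_neg ?mulr0//; lia.
    transitivity (- conv c (conv a (fun q => innov (Negz q) (iterate k))) q).
      rewrite convA /conv [X in - X]big_ord_recl /= [X in X * _]ca eqxx mulN1r subn0.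
      rewrite big1 ?addr0 ?opprK// => j _.
      by rewrite [X in X * _]ca /= oppr0 mul0r.
    rewrite convC /conv -sumrN big_mkord; apply: eq_bigr => s _; rewrite mulNr; congr (- (_ * _)).
    by rewrite subzn// -ltnS.
  rewrite (@big_cat_nat _ _ _ n 0 (maxn n q.+1))//= ?leq_maxl//.
  by rewrite [X in X - _]addrC addrK.
under eq_fun do rewrite E.
have Z : \sum_(n <= s < maxn n q.+1) 0 * cext (q%:Z - s%:Z) = 0.
  by rewrite big1// => s _; rewrite mul0r.
have H : (fun k => \sum_(n <= s < maxn n q.+1) ar_part s (iterate k) * cext (q%:Z - s%:Z)) @ \oo
    --> \sum_(n <= s < maxn n q.+1) 0 * cext (q%:Z - s%:Z).
  apply: cvg_sum_seq => s; rewrite mem_index_iota => /andP[ns _].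
  by apply: cvgM; [exact: ar_part_to0 | exact: cvg_cst].
by rewrite Z in H.
Qed.

(** [N] is chosen independently of [k], thanks to the uniform bound on the residuals; the remaining
    finite sum of innovation components then tends to zero. *)
Let residual_to0 r : (fun k => residual k (Negz r)) @ \oo --> 0.
Proof.
set C := 2 * gam 0 + 2 * (M ^+ 2 * gam 0).
apply/cvgrPdist_le => e e0; have e20 : 0 < e / 2 by rewrite divr_gt0.
have tl : (fun N => C * (gam 0 - \sum_(k < N) c k ^+ 2)) @ \oo --> C * (gam 0 - gam 0).
  by apply: cvgM; [exact: cvg_cst | apply: cvgB; [exact: cvg_cst | exact: c2]].
have /cvgrPdist_le /(_ _ (exprn_gt0 2 e20)) [N _ /(_ N (leqnn N))] := tl.
rewrite subrr mulr0 sub0r normrN => /(le_trans (ler_norm _)) tN.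
have H : (fun k => \sum_(0 <= q < r + N) cext (q%:Z - r%:Z) * innov (Negz q) (residual k)) @ \oo
    --> \sum_(0 <= q < r + N) cext (q%:Z - r%:Z) * 0.
  by apply: cvg_sumr => q; apply: cvgM; [exact: cvg_cst | exact: innov_residual].
have Z : \sum_(0 <= q < r + N) cext (q%:Z - r%:Z) * 0 = 0.
  by rewrite big1// => q _; rewrite mulr0.
rewrite Z in H.
have D0 (x : R) : `|0 - x| = `|x| by rewrite sub0r normrN.
have /cvgrPdist_le /(_ _ e20) := H.
apply: filterS => k; rewrite !D0 => Hk.
have := le_trans (neg_approx r N (residual_gram_bounded k)) tN.
rewrite -[X in X <= _]real_normK ?num_real// ler_pXn2r ?nnegrE ?(ltW e20)// => H2.
rewrite -(subrK (\sum_(0 <= q < r + N) cext (q%:Z - r%:Z) * innov (Negz q) (residual k)) (residual k _)).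
apply: le_trans (ler_normD _ _) _.
by rewrite [e]splitr lerD.
Qed.

Let y k (s : nat) := gsum c a n m s.+1 k.

Lemma normal_lim r : (r < n)%N ->
  (fun k => \sum_(0 <= s < n) y k s * gam (s%:Z - r%:Z)) @ \oo --> gam (m + r.+1)%N%:Z.
Proof.
move=> rn; apply/cvgrPdist_le => e e0.
have rn' : (n - r.+1 < n)%N by lia.
have /cvgrPdist_le /(_ _ e0) H1' := residual_to0 r.
have /cvgrPdist_le /(_ _ e0) H2' := residual_to0 (n - r.+1).
near=> k.
have H1 : `|0 - residual k (Negz r)| <= e by near: k; exact: H1'.
have H2 : `|0 - residual k (Negz (n - r.+1))| <= e by near: k; exact: H2'.
(* For even [k] the coefficients and the iterate are both reversed, and evenness of [gam] turns the
   equation at [r] into the residual at the mirrored index [n - r.+1]. *)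
have -> : gam (m + r.+1)%N%:Z - \sum_(0 <= s < n) y k s * gam (s%:Z - r%:Z) =
    residual k (Negz (if odd k then r else n - r.+1)%N).
  rewrite /residual iterate_neg; last by case: ifP.
  have [ok|ok] := boolP (odd k); congr (_ - _).
  - rewrite !big_mkord; apply: eq_bigr => s _.
    by rewrite /y gsumE// ok; congr (_ * gam _); lia.
  - by congr gam; lia.
  - rewrite !big_mkord (reindex_inj rev_ord_inj); apply: eq_bigr => s _ /=.
    have sn := ltn_ord s.
    rewrite /y gsumE ?(negbTE ok); last by lia.
    rewrite /gam_shift -[in LHS]gam_even; congr (ar_part _ _ * gam _); lia.
by move: H1 H2; rewrite !sub0r !normrN; case: (odd k).
Unshelve. all: by end_near. Qed.

(** * The Toeplitz system *)

Let G : 'M[R]_n := \matrix_(s < n, r < n) gam ((s : nat)%:Z - (r : nat)%:Z).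

(** A left kernel vector gives a combination [t] of norm zero; its functional vanishes by
    Cauchy-Schwarz and so has no innovation components. These are the values of [conv c w] on the
    window, and convolving with [a] gives [w = 0]. *)
Lemma toeplitz_unit : G \in unitmx.
Proof.
rewrite -row_free_unit -kermx_eq0; apply/eqP/row_matrixP => i; rewrite row0.
set v := row i _.
have vG : v *m G = 0 by apply/sub_kermxP; exact: row_sub.
have vGE (r : 'I_n) : \sum_(s < n) v 0 s * gam ((s : nat)%:Z - (r : nat)%:Z) = 0.
  have /rowP/(_ r) := vG; rewrite !mxE => vGr; rewrite -[RHS]vGr.
  by apply: eq_bigr => s _; rewrite !mxE.
pose t := [seq (v 0 s, Negz s) | s : 'I_n].
have tt0 : gram t t = 0.
  rewrite gramE /eval big_image /= big1// => r _; rewrite /gram_fun big_image /=.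
  rewrite (_ : \sum_(_ | _) _ = 0) ?mulr0// -[RHS](vGE r); apply: eq_bigr => s _.
  by congr (_ * gam _); lia.
have ct0 j : gram_fun t j = 0.
  have := gram_bounded_gram_fun t [:: (1, j)]; rewrite tt0 mul0r /eval big_seq1 mul1r => h.
  by apply/eqP; rewrite -sqrf_eq0 eq_le h sqr_ge0.
(* The row vector extended by zero to all of [nat], so that it can be convolved. *)
pose w (s : nat) : R := oapp (v 0) 0 (insub s : option 'I_n).
have cw (q : nat) : (q < n)%N -> conv c w q = 0.
  move=> qn; have : innov (Negz q) (gram_fun t) = 0.
    rewrite /innov; under eq_fun do rewrite ct0.
    by rewrite wsum0 ?oppr0.
  rewrite innov_gram_fun /innov_coord big_image /= => <-.
  rewrite convC /conv.
  rewrite -(big_mkord xpredT (fun j => w j * c (q - j)%N)).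
  transitivity (\sum_(0 <= j < n) w j * cext (q%:Z - j%:Z)).
    rewrite [RHS](@big_cat_nat _ _ _ q.+1)//= [X in _ + X]big_nat_cond [X in _ + X]big1 ?addr0.
      rewrite !big_mkord; apply: eq_bigr => j _; rewrite subzn//.
      by rewrite -ltnS.
    by move=> j /andP[/andP[qj _] _]; rewrite cext_neg ?mulr0//; lia.
  rewrite big_mkord; apply: eq_bigr => j _; rewrite /w valK /=; congr (_ * cext _); lia.
apply/rowP => q; rewrite [RHS]mxE.
have -> : v 0 q = w q by rewrite /w valK.
have <- : - conv a (conv c w) q = w q.
  rewrite convA [X in - X](_ : _ = conv (conv c a) w q); last first.
    by apply: eq_bigr => j _; rewrite convC.
  rewrite /conv [X in - X]big_ord_recl /= [X in X * _]ca eqxx mulN1r subn0.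
  rewrite big1 ?addr0 ?opprK// => j _.
  by rewrite [X in X * _]ca /= oppr0 mul0r.
rewrite /conv big1 ?oppr0// => j _.
by rewrite -/(conv c w (q - j)) cw ?mulr0//; apply: leq_ltn_trans (leq_subr _ _) (ltn_ord q).
Qed.

Let b : 'rV[R]_n := \row_r gam (m + (r : nat).+1)%N%:Z.

Lemma gsum_lim (s : 'I_n) : (fun k => y k s) @ \oo --> (b *m invmx G) 0 s.
Proof.
have E k : y k s = \sum_(r < n) (\sum_(0 <= s < n) y k s * gam (s%:Z - (r : nat)%:Z)) * invmx G r s.
  pose Y : 'rV[R]_n := \row_s y k s.
  have : (Y *m G *m invmx G) 0 s = y k s by rewrite mulmxK ?toeplitz_unit// mxE.
  move=> <-; rewrite mxE; apply: eq_bigr => r _; congr (_ * _); rewrite mxE big_mkord.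
  by apply: eq_bigr => j _; rewrite !mxE.
under eq_fun do rewrite E.
rewrite mxE; apply: cvg_sumr => r; apply: cvgM; last exact: cvg_cst.
by rewrite mxE; apply: normal_lim.
Qed.

(** One direction identifies every predictor with the limits, the other shows that the limits do
    solve the normal equations. *)
Lemma normal_uniq (phi : nat -> R) :
  (forall r : nat, (r < n)%N ->
    \sum_(0 <= s < n) phi s * gam (s%:Z - r%:Z) = gam (m + r.+1)%N%:Z) <->
  (forall s : 'I_n, phi s = limn (y^~ s)).
Proof.
pose Y : 'rV[R]_n := \row_s phi s.
have YG (r : 'I_n) : (Y *m G) 0 r = \sum_(0 <= s < n) phi s * gam (s%:Z - (r : nat)%:Z).
  by rewrite mxE big_mkord; apply: eq_bigr => j _; rewrite !mxE.
have L (s : 'I_n) : limn (y^~ s) = (b *m invmx G) 0 s.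
  exact: (cvg_lim (@Rhausdorff R) (@gsum_lim s)).
split=> [H s|H r rn].
  rewrite L; have <- : Y *m G = b.
    by apply/rowP => r; rewrite YG H// mxE.
  by rewrite mulmxK ?toeplitz_unit// mxE.
have YE : Y = b *m invmx G by apply/rowP => s; rewrite mxE H L.
have := YG (Ordinal rn); rewrite /= => <-.
by rewrite YE mulmxKV ?toeplitz_unit// mxE.
Qed.

End Iterates.

End Functionals.

(** * Dominated convergence for real integrals *)

Section BoundedMultipliers.
Context {d : measure_display} {T : measurableType d} {R : realType}.
Variables (mu : {measure set T -> \bar R}) (D : set T).
Hypothesis mD : measurable D.
Implicit Types (f g : T -> R) (B : R).
Local Notation integ f := (mu.-integrable D (EFin \o f)).

Lemma integrable_measurable f : integ f -> measurable_fun D f.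
Proof. by move=> /integrableP[+ _]; move=> /measurable_EFinP. Qed.

Lemma integrable_mulr f g B : integ f -> measurable_fun D g ->
  (forall x, D x -> `|g x| <= B) -> integ (fun x => f x * g x).
Proof.
move=> fi mg gB.
have Bi : integ (fun x => B * f x).
  have := integrableZl mD B fi; apply: eq_integrable => // x _.
apply: (le_integrable mD _ _ Bi).
  by apply/measurable_EFinP; apply: measurable_funM => //; exact: integrable_measurable.
move=> x Dx /=; rewrite lee_fin !normrM mulrC ler_wpM2r//.
exact: le_trans (gB x Dx) (ler_norm _).
Qed.

Lemma measurable_fun_limr (F : nat -> T -> R) g :
  (forall N, measurable_fun D (F N)) ->
  (forall x, D x -> F ^~ x @ \oo --> g x) -> measurable_fun D g.
Proof. by move=> mF Fg; apply: measurable_fun_cvg Fg. Qed.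

Lemma Rintegral_dominated f (F : nat -> T -> R) g B : integ f ->
  (forall N, measurable_fun D (F N)) ->
  (forall N x, D x -> `|F N x| <= B) ->
  (forall x, D x -> F ^~ x @ \oo --> g x) ->
  (fun N => \int[mu]_(x in D) (f x * F N x)) @ \oo --> \int[mu]_(x in D) (f x * g x).
Proof.
move=> fi mF FB Fg.
have mg := measurable_fun_limr mF Fg.
have gB x : D x -> `|g x| <= B.
  move=> Dx; rewrite -(cvg_lim (@Rhausdorff R) (cvg_norm (Fg x Dx))).
  apply: limr_le; last by near=> N; exact: FB.
  by apply/cvg_ex; eexists; apply: cvg_norm; exact: Fg.
have gi := integrable_mulr fi mg gB.
have mf := integrable_measurable fi.
rewrite /Rintegral.
apply: fine_cvg; rewrite fineK; last exact: integrable_fin_num.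
apply: (@dominated_cvg _ _ _ mu D mD _ _ (fun x => (B * `|f x|)%:E)) => //.
- by move=> N; apply/measurable_EFinP; exact: measurable_funM.
- move=> x Dx; apply/fine_cvgP; split; first by near=> N.
  by apply: cvgM; [exact: cvg_cst | exact: Fg].
- have := integrableZl mD B (integrable_norm fi); apply: eq_integrable => // x _.
- by move=> N x Dx; rewrite /= lee_fin normrM mulrC ler_wpM2r// FB.
Unshelve. all: by end_near. Qed.

Lemma Rintegral_sum (I : Type) (r : seq I) (F : I -> T -> R) :
  (forall i, integ (F i)) ->
  \int[mu]_(x in D) (\sum_(i <- r) F i x) = \sum_(i <- r) \int[mu]_(x in D) F i x.
Proof.
move=> Fi; elim: r => [|i r IH].
  rewrite big_nil; under eq_Rintegral do rewrite big_nil.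
  by rewrite Rintegral_cst// mul0r.
rewrite big_cons -IH; under eq_Rintegral do rewrite big_cons.
rewrite RintegralD//; have := @integrable_sum _ _ _ mu D mD _ r xpredT (fun i => EFin \o F i) (fun i _ => Fi i).
by apply: eq_integrable => // x _ /=; rewrite sumEFin.
Qed.

Lemma Rintegral_series f (g : nat -> T -> R) (M : nat -> R) G : integ f ->
  (forall k, measurable_fun D (g k)) ->
  (forall k x, D x -> `|g k x| <= M k) -> cvgn (series M) ->
  (forall x, D x -> series (fun k => g k x) @ \oo --> G x) ->
  series (fun k => \int[mu]_(x in D) (f x * g k x)) @ \oo -->
  \int[mu]_(x in D) (f x * G x).
Proof.
move=> fi mg gM cM gG.
(* Nonnegativity of [M] is read off at a point of [D], so the empty domain is treated apart. *)
have [D0|/set0P[x0 Dx0]] := eqVneq D set0.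
  rewrite D0 Rintegral_set0; under eq_fun do rewrite Rintegral_set0.
  by rewrite /series /=; under eq_fun do rewrite big1//; exact: cvg_cst.
have M0 k : 0 <= M k by exact: le_trans (gM k x0 Dx0).
have -> : series (fun k => \int[mu]_(x in D) (f x * g k x)) =
    (fun N => \int[mu]_(x in D) (f x * series (fun k => g k x) N)).
  apply/funext => N; rewrite /series /= -Rintegral_sum.
    by apply: eq_Rintegral => x _; rewrite mulr_sumr.
  by move=> k; apply: (integrable_mulr fi (mg k) (gM k)).
apply: (@Rintegral_dominated _ (fun N x => series (fun k => g k x) N) _ (limn (series M))) => //.
- move=> N; rewrite /series /=; exact: measurable_sum.
- move=> N x Dx; apply: (@le_trans _ _ (series M N)).
    by apply: le_trans (ler_norm_sum _ _ _) _; apply: ler_sum => k _; exact: gM.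
  apply: nondecreasing_cvgn_le => //.
  by apply/nondecreasing_series => k _ _; exact: M0.
Qed.

End BoundedMultipliers.

(** * Trigonometric integrals *)

Section Trigonometric.
Context {R : realType}.
Local Notation mu := (@lebesgue_measure R).
Local Notation I := ([set` `[- pi, pi]] : set (measurableTypeR R)).
Local Notation integ f := (mu.-integrable I (EFin \o f)).
Implicit Types (f g : R -> R) (r t x B : R).

Lemma Npi_lt_pi : - pi < pi :> R.
Proof. by rewrite gtrN// pi_gt0. Qed.

Lemma measurable_I : measurable I.
Proof. exact: measurable_itv. Qed.

Lemma mu_I : mu I = (2 * pi)%:E.
Proof.
rewrite lebesgue_measure_itv /= lte_fin Npi_lt_pi -EFinD opprK.
by congr EFin; ring.
Qed.

Lemma mu_I_lty : (mu I < +oo)%E.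
Proof. by rewrite mu_I ltry. Qed.

Lemma Rintegral_I_cst (k : R) : \int[mu]_(x in I) k = 2 * pi * k.
Proof.
rewrite Rintegral_cst; last exact: measurable_itv.
by rewrite mulrC; congr (_ * _); exact: (congr1 fine mu_I).
Qed.

Lemma integrable_I_bounded f B : measurable_fun I f ->
  (forall x, I x -> `|f x| <= B) -> integ f.
Proof.
move=> mf fB; apply: measurable_bounded_integrable => //.
  exact: mu_I_lty.
exists B; split; rewrite ?num_real// => y By x Ix.
by apply: le_trans (fB x Ix) (ltW By).
Qed.

Lemma integrable_I_cst (k : R) : integ (fun=> k).
Proof. by apply: (@integrable_I_bounded _ `|k|). Qed.

Lemma integrable_I_continuous f : continuous f -> integ f.
Proof.
move=> cf; apply: continuous_compact_integrable; first exact: segment_compact.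
exact: continuous_subspaceT.
Qed.

Lemma Rintegral_FTC f g : continuous f -> (forall x, is_derive x 1 g (f x)) ->
  \int[mu]_(x in I) f x = g pi - g (- pi).
Proof.
move=> cf dg.
have cg x : {for x, continuous g}.
  by apply/differentiable_continuous/derivable1_diffP; exact: ex_derive.
rewrite /Rintegral (@continuous_FTC2 _ _ g) ?Npi_lt_pi//.
- exact: continuous_subspaceT.
- split; first by move=> x _; exact: ex_derive.
    by apply: cvg_at_right_filter; exact: cg.
  by apply: cvg_at_left_filter; exact: cg.
- by move=> x _; rewrite derive1E; apply: derive_val.
Qed.

Lemma continuous_cosM (m : R) : continuous (fun x => cos (m * x)).
Proof.
by move=> x; apply: continuous_comp; [exact: mulrl_continuous | exact: continuous_cos].
Qed.

Lemma continuous_sinM (m : R) : continuous (fun x => sin (m * x)).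
Proof.
by move=> x; apply: continuous_comp; [exact: mulrl_continuous | exact: continuous_sin].
Qed.

Lemma sin_zpi (z : int) : sin (z%:~R * pi) = 0 :> R.
Proof.
have H (n : nat) : sin (n%:R * pi) = 0 :> R.
  elim: n => [|n IH]; first by rewrite mul0r sin0.
  by rewrite -natr1 mulrDl mul1r sinDpi IH oppr0.
case: z => n; first by rewrite -pmulrn H.
by rewrite NegzE mulrNz -pmulrn mulNr sinN H oppr0.
Qed.

Lemma Rintegral_cosz (z : int) :
  \int[mu]_(x in I) cos (z%:~R * x) = 2 * pi * (z == 0)%:R.
Proof.
have [->|z0] := eqVneq z 0.
  rewrite (_ : (fun x : R => _) = fun=> 1) ?Rintegral_I_cst//.
  by apply/funext => x; rewrite mul0r cos0.
have zR : z%:~R != 0 :> R by rewrite intr_eq0.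
have dF x : is_derive x 1 (fun x => sin (z%:~R * x) / z%:~R) (cos (z%:~R * x)).
  by apply: is_derive_eq; rewrite /GRing.scale /=; field.
rewrite (Rintegral_FTC (@continuous_cosM z%:~R) dF).
by rewrite mulrN sinN sin_zpi oppr0 mul0r subr0 mulr0.
Qed.

Lemma Rintegral_sinz (z : int) : \int[mu]_(x in I) sin (z%:~R * x) = 0.
Proof.
have [->|z0] := eqVneq z 0.
  rewrite (_ : (fun x : R => _) = fun=> 0) ?Rintegral_I_cst ?mulr0//.
  by apply/funext => x; rewrite mul0r sin0.
have zR : z%:~R != 0 :> R by rewrite intr_eq0.
have dF x : is_derive x 1 (fun x => - (cos (z%:~R * x) / z%:~R)) (sin (z%:~R * x)).
  by apply: is_derive_eq; rewrite /GRing.scale /=; field.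
rewrite (Rintegral_FTC (@continuous_sinM z%:~R) dF).
by rewrite mulrN cosN subrr.
Qed.

Definition cos_coef f (k : nat) : R := \int[mu]_(x in I) (f x * cos (k%:R * x)).
Definition sin_coef f (k : nat) : R := \int[mu]_(x in I) (f x * sin (k%:R * x)).

Lemma cos_coef_cos (n k : nat) : cos_coef (fun x => cos (n%:R * x)) k =
  pi * ((n%:Z - k%:Z == 0)%:R + (n%:Z + k%:Z == 0)%:R).
Proof.
rewrite /cos_coef (_ : (fun x : R => _) = fun x => 2^-1 * cos ((n%:Z - k%:Z)%:~R * x)
   + 2^-1 * cos ((n%:Z + k%:Z)%:~R * x)); last first.
  by apply/funext => x; rewrite !intrD !mulrNz -!pmulrn mulrBl mulrDl cosB cosD; field.
have ci z := integrable_I_continuous (@continuous_cosM z%:~R).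
have ci2 z : integ (fun x => 2^-1 * cos (z%:~R * x)).
  apply: (integrable_mulr measurable_I (integrable_I_cst _)
    (integrable_measurable (ci z)) (B := 1)) => x _; exact: cos_max.
rewrite RintegralD; [|exact: measurable_I|exact: ci2|exact: ci2].
rewrite !RintegralZl; [|exact: measurable_I|exact: ci|exact: measurable_I|exact: ci].
by rewrite !Rintegral_cosz; field.
Qed.

Lemma sin_coef_cos (n k : nat) : sin_coef (fun x => cos (n%:R * x)) k = 0.
Proof.
rewrite /sin_coef (_ : (fun x : R => _) = fun x => 2^-1 * sin ((n%:Z + k%:Z)%:~R * x)
   - 2^-1 * sin ((n%:Z - k%:Z)%:~R * x)); last first.
  by apply/funext => x; rewrite !intrD !mulrNz -!pmulrn mulrBl mulrDl sinB sinD; field.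
have ci z := integrable_I_continuous (@continuous_sinM z%:~R).
have ci2 z : integ (fun x => 2^-1 * sin (z%:~R * x)).
  apply: (integrable_mulr measurable_I (integrable_I_cst _)
    (integrable_measurable (ci z)) (B := 1)) => x _; exact: sin_max.
rewrite RintegralB; [|exact: measurable_I|exact: ci2|exact: ci2].
rewrite !RintegralZl; [|exact: measurable_I|exact: ci|exact: measurable_I|exact: ci].
by rewrite !Rintegral_sinz !mulr0 subrr.
Qed.

End Trigonometric.

(** * The Poisson integral *)

Lemma cvg_series_single (R : realType) (u : nat -> R) n :
  (forall k, k != n -> u k = 0) -> series u @ \oo --> u n.
Proof.
move=> u0; apply: cvg_near_cst; near=> N.
have nN : (n < N)%N by near: N; exists n.+1.
rewrite /series /= big_mkord (bigD1 (Ordinal nN))//= big1 ?addr0// => k kn.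
by apply: u0; apply: contra kn => /eqP kn; apply/eqP/val_inj.
Unshelve. all: by end_near. Qed.

Lemma is_cvg_geometricM (R : realType) (B r : R) : 0 <= r < 1 ->
  cvgn (series (fun k => B * r ^+ k)).
Proof.
by move=> /andP[r0 r1]; apply: is_cvg_geometric_series; rewrite ger0_norm.
Qed.

Section Poisson.
Context {R : realType}.
Local Notation mu := (@lebesgue_measure R).
Local Notation I := ([set` `[- pi, pi]] : set (measurableTypeR R)).
Local Notation integ f := (mu.-integrable I (EFin \o f)).
Implicit Types (f g : R -> R) (r t x B : R).

(** The frequencies [k] and [-k] of the two-sided series are folded together, so every frequency but
    zero counts twice. *)
Definition poisson_weight (k : nat) : R := 1 + (0 < k)%N%:R.
Definition poisson_kernel r t : R := (1 - r ^+ 2) / (1 - 2 * r * cos t + r ^+ 2).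

Lemma poisson_weight_ge0 k : 0 <= poisson_weight k.
Proof. by rewrite addr_ge0. Qed.

Lemma poisson_weight_le2 k : poisson_weight k <= 2.
Proof. by rewrite /poisson_weight; case: (0 < k)%N => /=; lra. Qed.

Lemma poisson_kernel_den r t : 0 <= r < 1 -> (1 - r) ^+ 2 <= 1 - 2 * r * cos t + r ^+ 2.
Proof. by move=> /andP[r0 r1]; have := cos_le1 t; nra. Qed.

Lemma poisson_kernel_den_gt0 r t : 0 <= r < 1 -> 0 < 1 - 2 * r * cos t + r ^+ 2.
Proof.
by move=> r01; apply: lt_le_trans (poisson_kernel_den t r01); rewrite exprn_gt0// subr_gt0; case/andP: r01.
Qed.

Lemma poisson_kernel_ge0 r t : 0 <= r < 1 -> 0 <= poisson_kernel r t.
Proof.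
move=> r01; rewrite divr_ge0 ?(ltW (poisson_kernel_den_gt0 t r01))// subr_ge0.
by case/andP: r01 => r0 r1; rewrite exprn_ile1// ltW.
Qed.

Lemma poisson_kernel_le r t : 0 <= r < 1 -> `|poisson_kernel r t| <= (1 - r ^+ 2) / (1 - r) ^+ 2.
Proof.
move=> r01; rewrite ger0_norm ?poisson_kernel_ge0// /poisson_kernel.
have [r0 r1] := andP r01.
have h : 0 < (1 - r) ^+ 2 by rewrite exprn_gt0// subr_gt0.
apply: ler_wpM2l; first by rewrite subr_ge0 exprn_ile1// ltW.
by rewrite lef_pV2 ?posrE// ?poisson_kernel_den// poisson_kernel_den_gt0.
Qed.

Lemma poisson_kernel_series r t : 0 <= r < 1 ->
  series (fun k => poisson_weight k * r ^+ k * cos (k%:R * t)) @ \oo --> poisson_kernel r t.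
Proof.
move=> r01; have [r0 r1] := andP r01.
have dn0 : 1 - 2 * r * cos t + r ^+ 2 != 0 by rewrite gt_eqF// poisson_kernel_den_gt0.
(* Multiplied by the denominator, the partial sum telescopes up to these two boundary terms, which
   are of order [r ^+ N.+1]. *)
pose e N := - (2 * r ^+ N.+1 * cos (N.+1%:R * t)) + 2 * r ^+ N.+2 * cos (N%:R * t).
have E N : series (fun k => poisson_weight k * r ^+ k * cos (k%:R * t)) N.+1 =
    (1 - r ^+ 2 + e N) / (1 - 2 * r * cos t + r ^+ 2).
  apply: (canRL (mulfK dn0)); elim: N => [|N IH].
    by rewrite /series /= big_nat1 /e /poisson_weight /= mul0r cos0 !mul1r; ring.
  have E1 : cos (N.+2%:R * t) = cos (N.+1%:R * t) * cos t - sin (N.+1%:R * t) * sin t.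
    by rewrite -cosD -[N.+2%:R]natr1; congr cos; ring.
  have E2 : cos (N%:R * t) = cos (N.+1%:R * t) * cos t + sin (N.+1%:R * t) * sin t.
    by rewrite -cosB -natr1; congr cos; ring.
  rewrite seriesS mulrDl IH /e /poisson_weight E1 E2 /=.
  move: (cos (N.+1%:R * t)) (sin (N.+1%:R * t)) => C S; rewrite !exprS; ring.
rewrite -cvg_shiftS; under eq_fun do rewrite /= E.
have h : (fun N => r ^+ N) @ \oo --> 0 by apply: cvg_expr; rewrite ger0_norm.
have h1 (u : nat -> R) m : (forall N, `|u N| <= 1) -> (fun N => 2 * r ^+ (N + m)%N * u N) @ \oo --> 0.
  move=> u1; apply/norm_cvg0P.
  apply: (@squeeze_cvgr _ _ _ _ (fun=> 0) (fun N => 2 * r ^+ (N + m)%N)).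
  - near=> N; rewrite normr_ge0 /= normrM ger0_norm ?mulr_ge0 ?exprn_ge0//.
    by rewrite ler_piMr ?mulr_ge0 ?exprn_ge0.
  - exact: cvg_cst.
  - rewrite -[X in _ --> X](mulr0 2); apply: cvgM; first exact: cvg_cst.
    by rewrite (cvg_shiftn m (fun N => r ^+ N)).
have he : e @ \oo --> 0.
  have -> : 0 = - 0 + 0 :> R by rewrite oppr0 addr0.
  apply: cvgD.
    apply: cvgN; have := h1 (fun N => cos (N.+1%:R * t)) 1%N (fun N => cos_max _).
    by under eq_fun do rewrite addn1.
  have := h1 (fun N => cos (N%:R * t)) 2%N (fun N => cos_max _).
  by under eq_fun do rewrite addn2.
have -> : poisson_kernel r t = (1 - r ^+ 2 + 0) / (1 - 2 * r * cos t + r ^+ 2) by rewrite addr0.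
apply: cvgM; last exact: cvg_cst.
by apply: cvgD he; exact: cvg_cst.
Unshelve. all: by end_near. Qed.

Definition poisson r f (th : R) : R := (2 * pi)^-1 * \int[mu]_(x in I) (f x * poisson_kernel r (x - th)).

Lemma pi2_gt0 : 0 < 2 * pi :> R.
Proof. by rewrite mulr_gt0// pi_gt0. Qed.

Lemma pi2_neq0 : 2 * pi != 0 :> R.
Proof. by rewrite gt_eqF// pi2_gt0. Qed.

Lemma pi_neq0 : pi != 0 :> R.
Proof. by rewrite gt_eqF// pi_gt0. Qed.

Lemma continuous_poisson_kernel r th : 0 <= r < 1 -> continuous (fun x => poisson_kernel r (x - th)).
Proof.
move=> r01 x; apply: cvgM; first exact: cvg_cst.
apply: cvgV; first by rewrite gt_eqF// poisson_kernel_den_gt0.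
apply: cvgD; last exact: cvg_cst.
apply: cvgB; first exact: cvg_cst.
apply: cvgM; first exact: cvg_cst.
apply: continuous_comp; last exact: continuous_cos.
by apply: cvgB; [exact: cvg_id | exact: cvg_cst].
Qed.

Lemma measurable_I_continuous f : continuous f -> measurable_fun I f.
Proof. by move=> cf; apply: integrable_measurable (integrable_I_continuous cf). Qed.

Lemma integrable_poisson_kernel r f th : 0 <= r < 1 -> integ f ->
  integ (fun x => f x * poisson_kernel r (x - th)).
Proof.
move=> r01 fi; apply: (integrable_mulr (@measurable_I R) fi (measurable_I_continuous (@continuous_poisson_kernel r th r01))) => x _.
exact: poisson_kernel_le.
Qed.

Lemma integrable_lin f (k l : R) : integ f -> integ (fun x => k + l * f x).
Proof.
move=> fi; have h1 := integrable_I_cst k.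
have h2 := integrableZl (@measurable_I R) l fi.
by have := integrableD (@measurable_I R) h1 h2; apply: eq_integrable => // x _.
Qed.

Lemma poisson_lin r f (k l th : R) : 0 <= r < 1 -> integ f ->
  poisson r (fun x => k + l * f x) th = k * poisson r (fun=> 1) th + l * poisson r f th.
Proof.
move=> r01 fi; rewrite /poisson.
have h1 := integrable_poisson_kernel th r01 (integrable_I_cst 1).
have h2 := integrable_poisson_kernel th r01 fi.
rewrite (_ : (fun x : R => _) = fun x => k * (1 * poisson_kernel r (x - th)) + l * (f x * poisson_kernel r (x - th))); last first.
  by apply/funext => x; ring.
rewrite RintegralD.
- rewrite (RintegralZl _ (@measurable_I R) h1).
  rewrite (RintegralZl _ (@measurable_I R) h2).
  by ring.
- exact: measurable_I.
- by have := integrableZl (@measurable_I R) k h1; apply: eq_integrable => // x _.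
- by have := integrableZl (@measurable_I R) l h2; apply: eq_integrable => // x _.
Qed.

Lemma poisson_le r f g th : 0 <= r < 1 -> integ f -> integ g ->
  (forall x, I x -> f x <= g x) -> poisson r f th <= poisson r g th.
Proof.
move=> r01 fi gi fg; rewrite /poisson ler_pM2l ?invr_gt0 ?pi2_gt0//.
apply: le_Rintegral; first exact: measurable_I.
- exact: integrable_poisson_kernel.
- exact: integrable_poisson_kernel.
by move=> x Ix; rewrite ler_wpM2r ?poisson_kernel_ge0 ?fg.
Qed.

Definition norm1 f : R := \int[mu]_(x in I) `|f x|.

Lemma Rintegral_mul_le f g B : integ f -> measurable_fun I g ->
  (forall x, I x -> `|g x| <= B) ->
  `|\int[mu]_(x in I) (f x * g x)| <= B * norm1 f.
Proof.
move=> fi mg gB; have h := integrable_mulr (@measurable_I R) fi mg gB.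
have hn := integrable_norm fi.
apply: le_trans (le_normr_Rintegral (@measurable_I R) h) _.
rewrite /norm1 -RintegralZl; [|exact: measurable_I|exact: hn].
apply: le_Rintegral; first exact: measurable_I.
- exact: integrable_norm h.
- by have := integrableZl (@measurable_I R) B hn; apply: eq_integrable => // x _.
by move=> x Ix; rewrite normrM mulrC ler_wpM2r// gB.
Qed.

Lemma cos_coef_le f k : integ f -> `|cos_coef f k| <= norm1 f.
Proof.
move=> fi; rewrite -[X in _ <= X]mul1r; apply: Rintegral_mul_le => //.
  exact: measurable_I_continuous (@continuous_cosM _ k%:R).
by move=> x _; exact: cos_max.
Qed.

Lemma sin_coef_le f k : integ f -> `|sin_coef f k| <= norm1 f.
Proof.
move=> fi; rewrite -[X in _ <= X]mul1r; apply: Rintegral_mul_le => //.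
  exact: measurable_I_continuous (@continuous_sinM _ k%:R).
by move=> x _; exact: sin_max.
Qed.

Lemma poisson_bound r f th : 0 <= r < 1 -> integ f ->
  `|poisson r f th| <= (2 * pi)^-1 * ((1 - r ^+ 2) / (1 - r) ^+ 2 * norm1 f).
Proof.
move=> r01 fi; rewrite /poisson normrM ger0_norm ?invr_ge0 ?(ltW pi2_gt0)//.
rewrite ler_pM2l ?invr_gt0 ?pi2_gt0//; apply: Rintegral_mul_le => //.
  exact: measurable_I_continuous (@continuous_poisson_kernel r th r01).
by move=> x _; exact: poisson_kernel_le.
Qed.

Definition poisson_term r f th (k : nat) : R :=
  (2 * pi)^-1 * (poisson_weight k * r ^+ k * (cos_coef f k * cos (k%:R * th) + sin_coef f k * sin (k%:R * th))).

Lemma poisson_series r f th : 0 <= r < 1 -> integ f ->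
  series (poisson_term r f th) @ \oo --> poisson r f th.
Proof.
move=> r01 fi; have [r0 r1] := andP r01.
have cc (k : nat) : continuous (fun x => poisson_weight k * r ^+ k * cos (k%:R * (x - th))).
  move=> x; apply: cvgM; first exact: cvg_cst.
  apply: continuous_comp; last exact: continuous_cos.
  by apply: cvgM; [exact: cvg_cst|apply: cvgB; [exact: cvg_id | exact: cvg_cst]].
have := @Rintegral_series _ _ _ mu I (@measurable_I R) f
  (fun k x => poisson_weight k * r ^+ k * cos (k%:R * (x - th))) (fun k => 2 * r ^+ k)
  (fun x => poisson_kernel r (x - th)) fi (fun k => measurable_I_continuous (cc k)) _
  (is_cvg_geometricM (B := 2) r01) (fun x _ => poisson_kernel_series r01).
set s1 := series _ => h.
have -> : series (poisson_term r f th) = (fun N => (2 * pi)^-1 * s1 N).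
  apply/funext => N; rewrite /s1 /series /= mulr_sumr; apply: eq_bigr => k _.
  rewrite /poisson_term; congr (_ * _).
  have ci := integrable_mulr (@measurable_I R) fi (measurable_I_continuous (@continuous_cosM _ k%:R)) (fun x _ => cos_max (k%:R * x)).
  have si := integrable_mulr (@measurable_I R) fi (measurable_I_continuous (@continuous_sinM _ k%:R)) (fun x _ => sin_max (k%:R * x)).
  rewrite (_ : (fun x : R => f x * _) = fun x =>
     (poisson_weight k * r ^+ k * cos (k%:R * th)) * (f x * cos (k%:R * x)) +
     (poisson_weight k * r ^+ k * sin (k%:R * th)) * (f x * sin (k%:R * x))); last first.
    by apply/funext => x; rewrite mulrBr cosB; ring.
  rewrite RintegralD.
  - rewrite (RintegralZl _ (@measurable_I R) ci).
    rewrite (RintegralZl _ (@measurable_I R) si).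
    by rewrite /cos_coef /sin_coef; ring.
  - exact: measurable_I.
  - by have := integrableZl (@measurable_I R) (poisson_weight k * r ^+ k * cos (k%:R * th)) ci; apply: eq_integrable => // x _.
  - by have := integrableZl (@measurable_I R) (poisson_weight k * r ^+ k * sin (k%:R * th)) si; apply: eq_integrable => // x _.
apply: cvgM; first exact: cvg_cst.
apply: h => k x _; rewrite normrM ger0_norm ?mulr_ge0 ?poisson_weight_ge0 ?exprn_ge0//.
apply: le_trans (ler_piMr _ (cos_max _)) _; first by rewrite mulr_ge0 ?poisson_weight_ge0 ?exprn_ge0.
by rewrite ler_wpM2r ?exprn_ge0 ?poisson_weight_le2.
Qed.

Lemma continuous_poisson_term r f k : continuous (fun th => poisson_term r f th k).
Proof.
move=> x; apply: cvgM; first exact: cvg_cst.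
apply: cvgM; first exact: cvg_cst.
by apply: cvgD; apply: cvgM; (try exact: cvg_cst); [exact: continuous_cosM | exact: continuous_sinM].
Qed.

Lemma measurable_poisson r f : 0 <= r < 1 -> integ f -> measurable_fun I (poisson r f).
Proof.
move=> r01 fi; apply: (@measurable_fun_limr _ _ _ I (fun N th => series (poisson_term r f th) N)).
  by move=> N; rewrite /series /=; apply: measurable_sum => k; exact: measurable_I_continuous (@continuous_poisson_term r f k).
by move=> th _; exact: poisson_series.
Qed.

Lemma integrable_poisson r f : 0 <= r < 1 -> integ f -> integ (poisson r f).
Proof.
move=> r01 fi; apply: integrable_I_bounded (measurable_poisson r01 fi) _ => x _.
exact: poisson_bound.
Qed.

(* The series is symmetric in [f] and [g], which gives self-adjointness of the
   Poisson integral without Fubini's theorem. *)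
Lemma poisson_pairing r f g : 0 <= r < 1 -> integ f -> integ g ->
  series (fun k => (2 * pi)^-1 * (poisson_weight k * r ^+ k * (cos_coef f k * cos_coef g k + sin_coef f k * sin_coef g k))) @ \oo
  --> \int[mu]_(x in I) (g x * poisson r f x).
Proof.
move=> r01 fi gi; have [r0 r1] := andP r01.
have := @Rintegral_series _ _ _ mu I (@measurable_I R) g (fun k x => poisson_term r f x k)
  (fun k => (2 * pi)^-1 * (4 * norm1 f) * r ^+ k) (poisson r f) gi
  (fun k => measurable_I_continuous (@continuous_poisson_term r f k)) _
  (is_cvg_geometricM r01) (fun x _ => poisson_series r01 fi).
set s1 := series _ => h.
rewrite (_ : series _ = s1); last first.
  apply/funext => N; rewrite /s1 /series /=; apply: eq_bigr => k _.
  have ci := integrable_mulr (@measurable_I R) gi (measurable_I_continuous (@continuous_cosM _ k%:R)) (fun x _ => cos_max (k%:R * x)).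
  have si := integrable_mulr (@measurable_I R) gi (measurable_I_continuous (@continuous_sinM _ k%:R)) (fun x _ => sin_max (k%:R * x)).
  set A := (2 * pi)^-1 * (poisson_weight k * r ^+ k).
  rewrite (_ : (fun x : R => g x * _) = fun x =>
     (A * cos_coef f k) * (g x * cos (k%:R * x)) + (A * sin_coef f k) * (g x * sin (k%:R * x))); last first.
    by apply/funext => x; rewrite /poisson_term /A; ring.
  rewrite RintegralD.
  - rewrite (RintegralZl _ (@measurable_I R) ci).
    rewrite (RintegralZl _ (@measurable_I R) si).
    by rewrite -/(cos_coef g k) -/(sin_coef g k) /A; ring.
  - exact: measurable_I.
  - by have := integrableZl (@measurable_I R) (A * cos_coef f k) ci; apply: eq_integrable => // x _.
  - by have := integrableZl (@measurable_I R) (A * sin_coef f k) si; apply: eq_integrable => // x _.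
apply: h => k x _.
rewrite /poisson_term normrM ger0_norm ?invr_ge0 ?(ltW pi2_gt0)// -[X in _ <= X]mulrA.
rewrite ler_pM2l ?invr_gt0 ?pi2_gt0// normrM ger0_norm ?mulr_ge0 ?poisson_weight_ge0 ?exprn_ge0//.
rewrite (_ : 4 * norm1 f * r ^+ k = 2 * r ^+ k * (norm1 f + norm1 f)); last by ring.
apply: ler_pM; rewrite ?mulr_ge0 ?poisson_weight_ge0 ?exprn_ge0//.
  by rewrite ler_wpM2r ?exprn_ge0 ?poisson_weight_le2.
apply: le_trans (ler_normD _ _) _; apply: lerD; rewrite normrM -[X in _ <= X]mulr1.
  by apply: ler_pM => //; [exact: cos_coef_le | exact: cos_max].
by apply: ler_pM => //; [exact: sin_coef_le | exact: sin_max].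
Qed.

Lemma poisson_sym r f g : 0 <= r < 1 -> integ f -> integ g ->
  \int[mu]_(x in I) (g x * poisson r f x) = \int[mu]_(x in I) (f x * poisson r g x).
Proof.
move=> r01 fi gi; apply: (cvg_unique (@Rhausdorff R) (poisson_pairing r01 fi gi)).
have := poisson_pairing r01 gi fi.
rewrite (_ : (fun k => _) = (fun k => (2 * pi)^-1 * (poisson_weight k * r ^+ k * (cos_coef f k * cos_coef g k + sin_coef f k * sin_coef g k))))//.
by apply/funext => k; ring.
Qed.

(** Orthogonality leaves the single term [k = n] of the pairing; at [n = 0] the weight 1 makes up
    for the doubled integral of the constant. *)
Lemma poisson_cos_coef r f n : 0 <= r < 1 -> integ f ->
  \int[mu]_(x in I) (cos (n%:R * x) * poisson r f x) = r ^+ n * cos_coef f n.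
Proof.
move=> r01 fi.
have gi := integrable_I_continuous (@continuous_cosM R n%:R).
apply: (cvg_unique (@Rhausdorff R) (poisson_pairing r01 fi gi)).
pose u k := (2 * pi)^-1 * (poisson_weight k * r ^+ k * (cos_coef f k * cos_coef (fun x => cos (n%:R * x)) k
  + sin_coef f k * sin_coef (fun x => cos (n%:R * x)) k)).
rewrite -/u.
have -> : r ^+ n * cos_coef f n = u n.
  rewrite /u cos_coef_cos sin_coef_cos subrr eqxx /poisson_weight mulr0 addr0.
  have -> : (n%:Z + n%:Z == 0) = (n == 0)%N by lia.
  by have := pi_neq0; move: (@pi R) => p p0; case: (n) => [|n1] /=; field.
apply: cvg_series_single => k kn; rewrite /u cos_coef_cos sin_coef_cos.
rewrite (_ : (n%:Z - k%:Z == 0) = false); last by rewrite subr_eq0 eqz_nat eq_sym (negbTE kn).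
rewrite (_ : (n%:Z + k%:Z == 0) = false); last by lia.
by rewrite add0r !mulr0 addr0 !mulr0.
Qed.

Lemma poisson_one r th : 0 <= r < 1 -> poisson r (fun=> 1) th = 1.
Proof.
move=> r01; have gi := integrable_I_cst (1 : R).
apply: (cvg_unique (@Rhausdorff R) (poisson_series r01 gi)).
have E : (fun=> 1) = (fun x : R => cos (0%:R * x)).
  by apply/funext => x; rewrite mul0r cos0.
have E1 : poisson_term r (fun=> 1) th 0 = 1.
  rewrite /poisson_term E cos_coef_cos sin_coef_cos !mul0r cos0 /poisson_weight /=.
  by have := pi_neq0; move: (@pi R) => p p0; field.
have h : series (poisson_term r (fun=> 1) th) @ \oo --> poisson_term r (fun=> 1) th 0.
  apply: cvg_series_single => k k0; rewrite /poisson_term E cos_coef_cos sin_coef_cos.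
  rewrite (_ : (0%:Z - k%:Z == 0) = false); last by lia.
  rewrite (_ : (0%:Z + k%:Z == 0) = false); last by lia.
  by rewrite add0r !mulr0 !mul0r addr0 !mulr0.
by move: h; rewrite E1.
Qed.

Lemma poisson_cosB r th : 0 < r < 1 -> poisson r (fun x => cos (x - th)) th = r.
Proof.
move=> /andP[r0 r1]; have r01 : 0 <= r < 1 by rewrite ltW.
have P1 := poisson_one th r01.
have gi := integrable_poisson_kernel th r01 (integrable_I_cst 1).
(* Clearing the denominator of the kernel [K] gives [2 r cos(t) K = (1 + r^2) K - (1 - r^2)];
   solving for the cosine divides by [r]. *)
have : poisson r (fun x => cos (x - th)) th = (2 * r)^-1 * ((1 + r ^+ 2) * poisson r (fun=> 1) th - (1 - r ^+ 2)).
  rewrite /poisson (_ : (fun x : R => cos _ * _) = fun x => (2 * r)^-1 * (1 + r ^+ 2) * (1 * poisson_kernel r (x - th)) - (2 * r)^-1 * (1 - r ^+ 2)); last first.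
    apply/funext => x; rewrite /poisson_kernel; field.
    by rewrite gt_eqF// ?gt_eqF// poisson_kernel_den_gt0.
  rewrite RintegralB.
  - rewrite (RintegralZl _ (@measurable_I R) gi).
    by rewrite Rintegral_I_cst; have := pi_neq0; move: (@pi R) => p p0; field; rewrite p0 gt_eqF.
  - exact: measurable_I.
  - by have := integrableZl (@measurable_I R) ((2 * r)^-1 * (1 + r ^+ 2)) gi; apply: eq_integrable => // x _.
  - exact: integrable_I_cst.
by rewrite P1 => ->; field; rewrite gt_eqF.
Qed.

End Poisson.

(** * Boundary behaviour of the Poisson integral *)

Section PoissonLimit.
Context {R : realType}.
Local Notation mu := (@lebesgue_measure R).
Local Notation I := ([set` `[- pi, pi]] : set (measurableTypeR R)).
Local Notation integ f := (mu.-integrable I (EFin \o f)).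
Implicit Types (f g u v : R -> R) (r t x B : R).

(** The offset two makes the first radius [1/2], so that all radii are positive, as [poisson_cosB]
    requires. *)
Definition radius (N : nat) : R := 1 - N.+2%:R^-1.

Lemma radius_gt0 N : 0 < radius N.
Proof. by rewrite subr_gt0 invf_lt1 ?ltr1n// ltr0n. Qed.

Lemma radius_lt1 N : radius N < 1.
Proof. by rewrite gtrBl invr_gt0 ltr0n. Qed.

Lemma radius01 N : 0 < radius N < 1.
Proof. by rewrite radius_gt0 radius_lt1. Qed.

Lemma radius_ge0_lt1 N : 0 <= radius N < 1.
Proof. by rewrite (ltW (radius_gt0 N)) radius_lt1. Qed.

Lemma radius_cvg : radius @ \oo --> (1 : R).
Proof.
rewrite -[X in _ --> X]subr0; apply: cvgB; first exact: cvg_cst.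
have := @cvg_harmonic R; rewrite -cvg_shiftS; exact.
Qed.

Lemma poisson_cst r (k th : R) : 0 <= r < 1 -> poisson r (fun=> k) th = k.
Proof.
move=> r01; rewrite (_ : (fun=> k) = (fun x : R => k + 0 * 1)).
  by rewrite (poisson_lin k 0 th r01 (integrable_I_cst 1)) poisson_one// mulr1 mul0r addr0.
by apply/funext => x; rewrite mul0r addr0.
Qed.

Lemma poisson_sup r f B th : 0 <= r < 1 -> integ f ->
  (forall x, I x -> `|f x| <= B) -> `|poisson r f th| <= B.
Proof.
move=> r01 fi fB; rewrite ler_norml; apply/andP; split.
  rewrite -(poisson_cst (- B) th r01); apply: poisson_le => //; first exact: integrable_I_cst.
  by move=> x /fB; rewrite ler_norml => /andP[].
rewrite -(poisson_cst B th r01); apply: poisson_le => //; first exact: integrable_I_cst.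
by move=> x /fB; rewrite ler_norml => /andP[].
Qed.

Lemma cos_lt1 x : 0 < x < 2 * pi -> cos x < 1.
Proof.
move=> /andP[x0 x2].
have [xp|px] := leP x pi.
  by rewrite -cos0 ltr_cos// in_itv /= ?lexx ?pi_ge0// (ltW x0).
have -> : cos x = cos (2 * pi - x).
  by rewrite -[RHS]cosN opprB -[RHS](@cosD2pi R) mulr_natl subrK.
have h1 : 2 * pi - x \in `[0, pi] by rewrite in_itv /=; apply/andP; split; lra.
have h0 : 0 \in `[0, (pi : R)] by rewrite in_itv /= lexx pi_ge0.
by rewrite -[X in _ < X]cos0 ltr_cos//; lra.
Qed.

Lemma cos_sep (d b : R) : 0 < d -> b < 2 * pi ->
  exists2 m, 0 < m & forall y, d <= y <= b -> m <= 1 - cos y.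
Proof.
move=> d0 b2; have [bd|db] := ltP b d.
  exists 1 => // y /andP[dy yb]; exfalso; have := le_lt_trans (le_trans dy yb) bd.
  by rewrite ltxx.
have cc : {within `[d, b], continuous (fun y : R => - (1 - cos y))}.
  apply: continuous_subspaceT => y; apply: cvgN.
  by apply: cvgB; [exact: cvg_cst | exact: continuous_cos].
have [c cdb H] := EVT_max db cc.
exists (1 - cos c).
  rewrite subr_gt0 cos_lt1//; move: cdb; rewrite in_itv /= => /andP[dc cb].
  by rewrite (lt_le_trans d0 dc) (le_lt_trans cb b2).
by move=> y yb; have := H y; rewrite in_itv /= yb lerN2; apply.
Qed.

Lemma continuous_I_bounded v : continuous v -> exists B, forall x, I x -> `|v x| <= B.
Proof.
move=> cv; have cw : {within `[- pi, pi], continuous v} by exact: continuous_subspaceT.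
have /compact_bounded[M [_ mrt]] := continuous_compact cw (@segment_compact _ (- pi) pi).
exists (`|M| + 1) => x Ix; apply: mrt; last by exists x.
by rewrite ltr_pwDr// ler_norm.
Qed.

(* Reduces the convergence of Poisson integrals of continuous functions to that of
   the constants and of the cosine. *)
Lemma korovkin v th e : continuous v -> - pi < th < pi -> 0 < e ->
  exists2 M, 0 <= M & forall x, I x -> `|v x - v th| <= e + M * (1 - cos (x - th)).
Proof.
move=> cv /andP[th1 th2] e0; have [B vB] := continuous_I_bounded cv.
have thI : I th by rewrite /= in_itv /= !ltW.
have B0 : 0 <= B by exact: le_trans (vB th thI).
have /cvgrPdist_le /(_ e e0) /nbhs_ballP[d d0 Hd] := cv th.
(* As [th] is an interior point, [x - th] stays strictly between [- 2 * pi] and [2 * pi], where the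
   cosine is 1 only at 0. *)
have b2 : pi + `|th| < 2 * pi.
  by rewrite mulr_natl mulr2n ltrD2l ltr_norml th1 th2.
have [m m0 Hm] := cos_sep d0 b2.
have c1 x : 0 <= 1 - cos x by rewrite subr_ge0 cos_le1.
exists (2 * B / m); first by rewrite divr_ge0 ?mulr_ge0// ltW.
move=> x Ix; have [xd|dx] := ltP `|x - th| d.
  apply: (@le_trans _ _ e).
    by rewrite distrC; apply: Hd; rewrite /ball /= distrC.
  by rewrite lerDl mulr_ge0 ?divr_ge0 ?mulr_ge0// ltW.
apply: (@le_trans _ _ (2 * B)).
  by apply: le_trans (ler_normB _ _) _; rewrite mulr_natl mulr2n lerD ?vB.
apply: (@le_trans _ _ (2 * B / m * (1 - cos (x - th)))); last by rewrite lerDr ltW.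
rewrite -[X in X <= _](divfK (lt0r_neq0 m0)) ler_wpM2l ?divr_ge0 ?mulr_ge0// ?(ltW m0)//.
rewrite -cos_norm; apply: Hm; rewrite dx /=.
apply: le_trans (ler_normB _ _) _; rewrite lerD2r ler_norml.
by move: Ix; rewrite /= in_itv.
Qed.

Lemma poisson_cvg v th : continuous v -> - pi < th < pi ->
  (fun N => poisson (radius N) v th) @ \oo --> v th.
Proof.
move=> cv th1; apply/cvgrPdist_le => e e0.
have e2 : 0 < e / 2 by rewrite divr_gt0.
have [M M0 HM] := korovkin cv th1 e2.
have vi := integrable_I_continuous cv.
(* At [th] the Poisson integral of [e / 2 + M * (1 - cos (x - th))] is [e / 2 + M * (1 - r)];
   positivity of the kernel transports the bound of [korovkin]. *)
have H r : 0 < r < 1 -> `|v th - poisson r v th| <= e / 2 + M * (1 - r).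
  move=> r01; have r01' : 0 <= r < 1 by case/andP: r01 => r0 ->; rewrite ltW.
  have ci : integ (fun x => cos (x - th)).
    apply: integrable_I_continuous => x.
    apply: continuous_comp; last exact: continuous_cos.
    by apply: cvgB; [exact: cvg_id | exact: cvg_cst].
  rewrite ler_distlC; apply/andP; split.
    have := @poisson_le _ r (fun x => (v th - e / 2 - M) + M * cos (x - th)) v th r01' (integrable_lin _ _ ci) vi.
    rewrite (poisson_lin _ _ _ r01' ci) poisson_one// poisson_cosB// mulr1 => h.
    apply: le_trans (h _); first by lra.
    by move=> x /HM; rewrite ler_distl => /andP[+ _]; lra.
  have := @poisson_le _ r v (fun x => (v th + e / 2 + M) + - M * cos (x - th)) th r01' vi (integrable_lin _ _ ci).
  rewrite (poisson_lin _ _ _ r01' ci) poisson_one// poisson_cosB// mulr1 => h.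
  apply: le_trans (h _) _; last by lra.
  by move=> x /HM; rewrite ler_distl => /andP[_ +]; lra.
have tl : (fun N => M * (1 - radius N)) @ \oo --> M * (1 - 1).
  by apply: cvgM; [exact: cvg_cst | apply: cvgB; [exact: cvg_cst | exact: radius_cvg]].
have /cvgrPdist_le /(_ _ e2) := tl.
apply: filterS => N; rewrite subrr mulr0 sub0r normrN => /(le_trans (ler_norm _)) hN.
by apply: le_trans (H _ (radius01 N)) _; rewrite [leRHS]splitr lerD2l.
Qed.

(** The endpoints form a null set; they are left out because [poisson_cvg] speaks of interior
    points. *)
Lemma Rintegral_oo f : integ f ->
  \int[mu]_(x in [set` `]- pi, pi[] : set (measurableTypeR R)) f x = \int[mu]_(x in I) f x.
Proof.
move=> fi.
have sub1 : [set` `]- pi, pi[ ] `<=` I by exact: subset_itv_oo_cc.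
have sub2 : [set` `[- pi, pi[ ] `<=` I by exact: subset_itv_co_cc.
rewrite Rintegral_itv_obnd_cbnd; last first.
  by apply: (integrableS (@measurable_I R) _ sub1 fi); exact: measurable_itv.
by rewrite Rintegral_itv_bndo_bndc//; apply: (integrableS (@measurable_I R) _ sub2 fi); exact: measurable_itv.
Qed.

Lemma poisson_weak_continuous g v B : measurable_fun I g -> (forall x, I x -> `|g x| <= B) ->
  continuous v ->
  (fun N => \int[mu]_(x in I) (g x * poisson (radius N) v x)) @ \oo --> \int[mu]_(x in I) (g x * v x).
Proof.
move=> mg gB cv; have gi := integrable_I_bounded mg gB.
have vi := integrable_I_continuous cv; have [Bv vB] := continuous_I_bounded cv.
have Pi N := integrable_poisson (radius_ge0_lt1 N) vi.
have PB N x : `|poisson (radius N) v x| <= Bv by apply: poisson_sup (radius_ge0_lt1 N) vi vB.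
have gv : integ (fun x => g x * v x).
  by have := integrable_mulr (@measurable_I R) gi (integrable_measurable vi) vB.
have gP N : integ (fun x => g x * poisson (radius N) v x).
  by have := integrable_mulr (@measurable_I R) gi (integrable_measurable (Pi N)) (fun x _ => PB N x).
rewrite -(Rintegral_oo gv); under eq_fun do rewrite -(Rintegral_oo (gP _)).
have sub1 : [set` `]- pi, pi[ ] `<=` I by exact: subset_itv_oo_cc.
apply: (@Rintegral_dominated _ _ _ mu _ _ g (fun N x => poisson (radius N) v x) v Bv).
- exact: measurable_itv.
- by apply: (integrableS (@measurable_I R) _ sub1 gi); exact: measurable_itv.
- by move=> N; apply: measurable_funS sub1 (integrable_measurable (Pi N)); exact: measurable_itv.
- by move=> N x _; exact: PB.
- by move=> x; rewrite /= in_itv /= => xx; exact: poisson_cvg.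
Qed.

Lemma dist_le3 (x x' y y' e : R) : `|x' - y'| <= e / 3 -> `|x - y| <= e / 3 ->
  `|y - y'| <= e / 3 -> `|x - x'| <= e.
Proof.
move=> h1 h2 h3; rewrite (_ : x - x' = (x - y) + (y - y') - (x' - y')); last by ring.
apply: le_trans (ler_normB _ _) _; apply: (@le_trans _ _ (e / 3 + e / 3 + e / 3)).
  by apply: lerD => //; apply: le_trans (ler_normD _ _) _; exact: lerD.
by rewrite le_eqVlt; apply/orP; left; apply/eqP; field.
Qed.

(** By self-adjointness the error of replacing [u] by a continuous [v] is moved onto [g], whose
    Poisson integrals keep the bound [B]; it is at most [B] times the L1 distance, uniformly in the
    radius. *)
Lemma poisson_weak g u B : measurable_fun I g -> (forall x, I x -> `|g x| <= B) ->
  integ u ->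
  (fun N => \int[mu]_(x in I) (g x * poisson (radius N) u x)) @ \oo --> \int[mu]_(x in I) (g x * u x).
Proof.
move=> mg gB ui; have gi := integrable_I_bounded mg gB.
have I0 : I 0 by rewrite /= in_itv /= oppr_le0 pi_ge0.
have B0 : 0 <= B by exact: le_trans (gB 0 I0).
apply/cvgrPdist_le => e e0.
(* [B + 1] instead of [B] covers the case [B = 0]. *)
pose k := e / (3 * (B + 1)).
have B1 : 0 < B + 1 by rewrite ltr_pwDr.
have k0 : 0 < k by rewrite divr_gt0// mulr_gt0.
have Bk : B * k <= e / 3.
  have -> : B * k = e / 3 * (B / (B + 1)) by rewrite /k; field; rewrite gt_eqF.
  by rewrite ler_piMr ?divr_ge0 ?(ltW e0)// ler_pdivrMr ?mul1r ?lerDl.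
have [v_ [cv_ vi_ vu]] := approximation_continuous_integrable (@measurable_I R) (@mu_I_lty R) ui.
have [n0 hn0] : exists n, norm1 (fun x => u x - v_ n x) < k.
  have /fine_cvgP[_ /cvgrPdist_lt /(_ k k0) [n _ /(_ n (leqnn n))]] := vu.
  rewrite sub0r normrN => hn; exists n; apply: le_lt_trans hn.
  by rewrite /norm1 /Rintegral; exact: ler_norm.
have {vu} {cv_}cv := cv_ n0; have {vi_}vi := vi_ n0; move: (v_ n0) hn0 cv vi => v uv cv vi.
have wi : integ (fun x => u x - v x).
  by have := integrableB (@measurable_I R) ui vi; apply: eq_integrable => // x _.
have e3 : 0 < e / 3 by rewrite divr_gt0.
have /cvgrPdist_le /(_ _ e3) := poisson_weak_continuous mg gB cv.
apply: filterS => N HN.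
have r01 := radius_ge0_lt1 N.
have mP := measurable_poisson r01 gi.
have PB x : `|poisson (radius N) g x| <= B by apply: poisson_sup r01 gi gB.
have W1 := Rintegral_mul_le wi mP (fun x _ => PB x).
have W2 := Rintegral_mul_le wi mg gB.
have uP := integrable_mulr (@measurable_I R) ui mP (fun x _ => PB x).
have vP := integrable_mulr (@measurable_I R) vi mP (fun x _ => PB x).
have ug := integrable_mulr (@measurable_I R) ui mg gB.
have vg := integrable_mulr (@measurable_I R) vi mg gB.
have S1 : \int[mu]_(x in I) ((u x - v x) * poisson (radius N) g x) =
    \int[mu]_(x in I) (g x * poisson (radius N) u x) - \int[mu]_(x in I) (g x * poisson (radius N) v x).
  rewrite (poisson_sym r01 ui gi) (poisson_sym r01 vi gi) -(RintegralB (@measurable_I R) uP vP).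
  by apply: eq_Rintegral => x _; rewrite mulrBl.
have S2 : \int[mu]_(x in I) ((u x - v x) * g x) =
    \int[mu]_(x in I) (g x * u x) - \int[mu]_(x in I) (g x * v x).
  have C f : \int[mu]_(x in I) (g x * f x) = \int[mu]_(x in I) (f x * g x).
    by apply: eq_Rintegral => x _; rewrite mulrC.
  rewrite !C -(RintegralB (@measurable_I R) ug vg).
  by apply: eq_Rintegral => x _; rewrite mulrBl.
rewrite S1 in W1; rewrite S2 in W2.
have Bu : B * norm1 (fun x => u x - v x) <= e / 3.
  by apply: le_trans Bk; rewrite ler_wpM2l// ltW.
have {}W1 := le_trans W1 Bu; have {}W2 := le_trans W2 Bu.
exact: dist_le3 W1 W2 HN.
Qed.


(** * The mean of the exponential of a Poisson integral *)

Section ExpMean.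
Variable u : R -> R.
Hypotheses (ui : integ u) (ei : integ (fun x => expR (u x))).

Let mP r : 0 <= r < 1 -> measurable_fun I (fun x => expR (poisson r u x)).
Proof. by move=> r01; apply: measurableT_comp => //; exact: measurable_poisson. Qed.

Lemma integrable_exp_poisson r : 0 <= r < 1 -> integ (fun x => expR (poisson r u x)).
Proof.
move=> r01.
apply: (@integrable_I_bounded _ _ (expR ((2 * pi)^-1 * ((1 - r ^+ 2) / (1 - r) ^+ 2 * norm1 u))) (mP r01)) => x _.
by rewrite ger0_norm ?expR_ge0// ler_expR (le_trans (ler_norm _) (poisson_bound x r01 ui)).
Qed.

Lemma expR_tangent (y t : R) : expR t * (1 + y - t) <= expR y.
Proof.
have -> : expR y = expR t * expR (y - t) by rewrite -expRD addrC subrK.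
by rewrite ler_pM2l ?expR_gt0// -addrA expR_ge1Dx.
Qed.

(** The tangent of the exponential at [y] is integrated against a positive kernel of mean one. *)
Lemma jensen_poisson r th : 0 <= r < 1 ->
  expR (poisson r u th) <= poisson r (fun x => expR (u x)) th.
Proof.
move=> r01; set y := poisson r u th.
have := @poisson_le _ r (fun x => expR y * (1 - y) + expR y * u x) (fun x => expR (u x)) th
  r01 (integrable_lin _ _ ui) ei.
rewrite (poisson_lin _ _ _ r01 ui) poisson_one// mulr1 -/y => h.
apply: le_trans (h _); first by rewrite -mulrDr subrK mulr1.
by move=> x _; rewrite -mulrDr; have := expR_tangent (u x) y; rewrite -addrA [u x - y]addrC addrA.
Qed.

Lemma Rintegral_poisson_exp r : 0 <= r < 1 ->
  \int[mu]_(x in I) poisson r (fun x => expR (u x)) x = \int[mu]_(x in I) expR (u x).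
Proof.
move=> r01; have := poisson_cos_coef 0 r01 ei; rewrite expr0 mul1r /cos_coef.
have E (h : R -> R) : (fun x => cos (0%:R * x) * h x) = h.
  by apply/funext => x; rewrite mul0r cos0 mul1r.
rewrite E => ->; congr (Rintegral _ _ _).
by apply/funext => x; rewrite mul0r cos0 mulr1.
Qed.

(* The tangent bound [expR v >= expR t * (1 + v - t)] at [t = tr N x], [v = P_r u x]
   is affine in [P_r u] with bounded coefficients, so weak convergence applies; then
   [N] tends to infinity. *)
Let tr (N : nat) x : R := Num.max (- N%:R) (Num.min N%:R (u x)).

Let mtr N : measurable_fun I (tr N).
Proof.
apply: measurable_maxr; first exact: measurable_cst.
apply: measurable_minr; first exact: measurable_cst.
exact: integrable_measurable ui.
Qed.

Let tr_le N x : `|tr N x| <= N%:R.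
Proof.
rewrite /tr ler_norml le_max lexx /= ge_max ge_min lexx /= andbT.
by rewrite (le_trans _ (ler0n R N))// oppr_le0.
Qed.

(** Where [u >= - N], the truncation is at most [u] and the expression is a nonnegative tangent
    value below [exp(u)]; where [u < - N], the exponential factor is at most 1 and the affine one at
    most [1 + |u|]. *)
Let tr_bound N x : `|expR (tr N x) * (1 + u x - tr N x)| <= expR (u x) + (1 + `|u x|).
Proof.
have e0 := expR_gt0 (u x); have n0 := normr_ge0 (u x).
have N0 : 0 <= N%:R :> R := ler0n R N.
have [uN|Nu] := leP (- N%:R) (u x).
  have tu : tr N x <= u x by rewrite /tr ge_max uN ge_min lexx orbT.
  rewrite ger0_norm; last by rewrite mulr_ge0 ?expR_ge0// -addrA addr_ge0// subr_ge0.
  by apply: le_trans (expR_tangent _ _) _; rewrite lerDl addr_ge0.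
have -> : tr N x = - N%:R.
  rewrite /tr; apply/max_idPl; rewrite ge_min; apply/orP; right; exact: ltW.
rewrite normrM ger0_norm ?expR_ge0//.
have h1 : expR (- N%:R) <= 1 :> R by rewrite -expR0 ler_expR oppr_le0.
have u0 : u x <= 0 by apply: le_trans (ltW Nu) _; rewrite oppr_le0.
have h2 : `|1 + u x - - N%:R| <= 1 + `|u x|.
  rewrite opprK (ler0_norm u0) ler_norml; apply/andP; split; lra.
apply: le_trans (_ : 1 * (1 + `|u x|) <= _); last by rewrite mul1r lerDr ltW.
by apply: ler_pM => //; exact: expR_ge0.
Qed.

Let tr_int : (fun N => \int[mu]_(x in I) (expR (tr N x) * (1 + u x - tr N x))) @ \oo
  --> \int[mu]_(x in I) expR (u x).
Proof.
pose f x := expR (u x) + (1 + `|u x|).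
have f0 x : 0 < f x by rewrite addr_gt0 ?expR_gt0// ltr_pwDl.
have fi : integ f.
  have h1 := integrableD (@measurable_I R) (integrable_I_cst 1) (integrable_norm ui).
  by have := integrableD (@measurable_I R) ei h1; apply: eq_integrable => // x _.
have mu_ := integrable_measurable ui.
have mf := integrable_measurable fi.
have mfV : measurable_fun I (fun x => (f x)^-1).
  rewrite (_ : (fun x => _) = fun x => expR (- ln (f x))).
    apply: measurableT_comp => //; apply: measurableT_comp => //.
    by apply: measurableT_comp => //; exact: measurable_ln.
  by apply/funext => x; rewrite expRN lnK// posrE.
(* [Rintegral_dominated] takes an integrable weight and uniformly bounded factors, so the dominating
   function [f] is pulled out as the weight. *)
have C (h : R -> R) : \int[mu]_(x in I) h x = \int[mu]_(x in I) (f x * (h x / f x)).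
  by apply: eq_Rintegral => x _; rewrite mulrC divfK// gt_eqF.
rewrite C; under eq_fun do rewrite C.
apply: (@Rintegral_dominated _ _ _ mu I (@measurable_I R) f
  (fun N x => expR (tr N x) * (1 + u x - tr N x) / f x) (fun x => expR (u x) / f x) 1 fi).
- move=> N; apply: measurable_funM => //; apply: measurable_funM.
    by apply: measurableT_comp => //; exact: mtr.
  by apply: measurable_funB; [apply: measurable_funD|exact: mtr].
- move=> N x _; rewrite normrM normfV (gtr0_norm (f0 x)) ler_pdivrMr// mul1r.
  exact: tr_bound.
- move=> x _; apply: cvgM; last exact: cvg_cst.
  apply: cvg_near_cst; near=> N.
  have -> : tr N x = u x.
    have uN : `|u x| <= N%:R by near: N; exact: nbhs_infty_ger.
    move: uN; rewrite ler_norml => /andP[uN1 uN2].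
    by rewrite /tr (min_idPr uN2) (max_idPr uN1).
  by rewrite addrK mulr1.
Unshelve. all: by end_near. Qed.

Lemma exp_poisson_mean : (fun N => \int[mu]_(x in I) expR (poisson (radius N) u x)) @ \oo
  --> \int[mu]_(x in I) expR (u x).
Proof.
set L := \int[mu]_(x in I) expR (u x).
(* Jensen and preservation of the mean give this inequality at every radius; only the opposite one
   needs the limit. *)
have up N : \int[mu]_(x in I) expR (poisson (radius N) u x) <= L.
  rewrite /L -(Rintegral_poisson_exp (radius_ge0_lt1 N)); apply: le_Rintegral.
  - exact: measurable_I.
  - exact: integrable_exp_poisson (radius_ge0_lt1 N).
  - exact: integrable_poisson (radius_ge0_lt1 N) ei.
  - by move=> x _; exact: jensen_poisson (radius_ge0_lt1 N).
apply/cvgrPdist_le => e e0; have e2 : 0 < e / 2 by rewrite divr_gt0.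
have /cvgrPdist_le /(_ _ e2) [M _ /(_ M (leqnn M)) hM] := tr_int.
pose g x := expR (tr M x).
have mg : measurable_fun I g by apply: measurableT_comp => //; exact: mtr.
have gB x : I x -> `|g x| <= expR M%:R.
  by move=> _; rewrite ger0_norm ?expR_ge0// ler_expR (le_trans (ler_norm _) (tr_le M x)).
have gi := integrable_I_bounded mg gB.
have tB x : I x -> `|1 - tr M x| <= 1 + M%:R.
  by move=> _; apply: le_trans (ler_normB _ _) _; rewrite normr1 lerD2l.
have mt : measurable_fun I (fun x => 1 - tr M x).
  by apply: measurable_funB; [exact: measurable_cst | exact: mtr].
have gt := integrable_mulr (@measurable_I R) gi mt tB.
have gu : integ (fun x => g x * u x).
  by have := integrable_mulr (@measurable_I R) ui mg gB; apply: eq_integrable => // x _ /=; rewrite mulrC.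
have gP N : integ (fun x => g x * poisson (radius N) u x).
  have := integrable_mulr (@measurable_I R) (integrable_poisson (radius_ge0_lt1 N) ui) mg gB.
  by apply: eq_integrable => // x _ /=; rewrite mulrC.
have := poisson_weak mg gB ui => /cvgrPdist_le /(_ _ e2).
apply: filterS => N hN.
have lo : \int[mu]_(x in I) (g x * (1 - tr M x)) + \int[mu]_(x in I) (g x * poisson (radius N) u x)
    <= \int[mu]_(x in I) expR (poisson (radius N) u x).
  rewrite -(RintegralD (@measurable_I R) gt (gP N)); apply: le_Rintegral.
  - exact: measurable_I.
  - by have := integrableD (@measurable_I R) gt (gP N); apply: eq_integrable => // x _.
  - exact: integrable_exp_poisson (radius_ge0_lt1 N).
  - by move=> x _; rewrite -mulrDr addrAC; exact: expR_tangent.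
have E : \int[mu]_(x in I) (expR (tr M x) * (1 + u x - tr M x)) =
    \int[mu]_(x in I) (g x * (1 - tr M x)) + \int[mu]_(x in I) (g x * u x).
  rewrite -(RintegralD (@measurable_I R) gt gu); apply: eq_Rintegral => x _.
  by rewrite -mulrDr addrAC.
rewrite E in hM; move: (up N) lo hM hN.
rewrite -/L.
move: (\int[mu]_(x in I) expR (poisson (radius N) u x)) (\int[mu]_(x in I) (g x * (1 - tr M x)))
  (\int[mu]_(x in I) (g x * poisson (radius N) u x)) (\int[mu]_(x in I) (g x * u x)) (L).
clear => a b c d l upN lo; rewrite !ler_norml => /andP[h1 h2] /andP[h3 h4].
by apply/andP; split; lra.
Qed.

End ExpMean.

End PoissonLimit.

(** * Covariances of an outer spectral factor *)

Lemma series_norm_le (R : realType) (v M : nat -> R) (l : R) :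
  (forall k, `|v k| <= M k) -> cvgn (series M) -> series v @ \oo --> l ->
  `|l| <= limn (series M).
Proof.
move=> vM cM vl; rewrite -(cvg_lim (@Rhausdorff R) (cvg_norm vl)).
apply: limr_le; first by apply/cvg_ex; eexists; apply: cvg_norm; exact: vl.
near=> N; apply: (@le_trans _ _ (series M N)).
  by apply: le_trans (ler_norm_sum _ _ _) _; apply: ler_sum => k _.
apply: nondecreasing_cvgn_le => //.
by apply/nondecreasing_series => k _ _; apply: le_trans (vM k).
Unshelve. all: by end_near. Qed.

Section SpectralFactor.
Context {R : realType}.
Local Notation mu := (@lebesgue_measure R).
Local Notation I := ([set` `[- pi, pi]] : set (measurableTypeR R)).
Local Notation integ f := (mu.-integrable I (EFin \o f)).
Implicit Types (f g : R -> R) (r t th : R).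

Variables (u : R -> R) (c a : nat -> R).
Hypotheses (ui : integ u) (ei : integ (fun x => expR (u x))).
(** [Hc] and [Hs] are the real and imaginary parts of [h] on the circle of radius [r], and [Ac] and
    [As] those of [-1/h]. *)
Variables (Hc Hs Ac As : R -> R -> R).
Hypothesis cHc : forall r th, 0 <= r < 1 ->
  series (fun k => c k * r ^+ k * cos (k%:R * th)) @ \oo --> Hc r th.
Hypothesis cHs : forall r th, 0 <= r < 1 ->
  series (fun k => c k * r ^+ k * sin (k%:R * th)) @ \oo --> Hs r th.
Hypothesis cAc : forall r th, 0 <= r < 1 ->
  series (fun k => a k * r ^+ k * cos (k%:R * th)) @ \oo --> Ac r th.
Hypothesis cAs : forall r th, 0 <= r < 1 ->
  series (fun k => a k * r ^+ k * sin (k%:R * th)) @ \oo --> As r th.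
Hypothesis HA_re : forall r th, 0 <= r < 1 ->
  Hc r th * Ac r th - Hs r th * As r th = -1.
Hypothesis HA_im : forall r th, 0 <= r < 1 ->
  Hc r th * As r th + Hs r th * Ac r th = 0.
Hypothesis H_norm : forall r th, 0 <= r < 1 ->
  Hc r th ^+ 2 + Hs r th ^+ 2 = 2 * pi * expR (poisson r u th).
Hypothesis cva : cvgn [normed series a].

(** The covariances of the density [exp(u)]; those of [poisson_cov r] belong to the density
    [|h|^2 / (2 pi)] on the circle of radius [r]. *)
Definition exp_cov (z : int) : R := \int[mu]_(x in I) (cos (z%:~R * x) * expR (u x)).
Definition poisson_cov r (z : int) : R :=
  \int[mu]_(x in I) (cos (z%:~R * x) * expR (poisson r u x)).

Let mcosz (z : int) : measurable_fun I (fun x => cos (z%:~R * x)).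
Proof. exact: measurable_I_continuous (@continuous_cosM _ z%:~R). Qed.

Let cosi f (z : int) : integ f -> integ (fun x => cos (z%:~R * x) * f x).
Proof.
move=> fi; have := integrable_mulr (@measurable_I R) fi (mcosz z) (fun x _ => cos_max (z%:~R * x)).
by apply: eq_integrable => // x _ /=; rewrite mulrC.
Qed.

Lemma cos_absz (z : int) x : cos (z%:~R * x) = cos (`|z|%N%:R * x) :> R.
Proof.
case: z => n; first by rewrite -pmulrn.
by rewrite NegzE mulrNz mulNr cosN -pmulrn.
Qed.

Lemma poisson_cov_diff r (z : int) : 0 <= r < 1 ->
  `|r ^+ `|z|%N * exp_cov z - poisson_cov r z| <= exp_cov 0 - poisson_cov r 0.
Proof.
move=> r01; pose V := poisson r (fun x => expR (u x)).
have Vi : integ V by exact: integrable_poisson.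
have Ei : integ (fun x => expR (poisson r u x)) by exact: integrable_exp_poisson.
have E0 f : \int[mu]_(x in I) (cos (0%:~R * x) * f x) = \int[mu]_(x in I) f x.
  by apply: eq_Rintegral => x _; rewrite mul0r cos0 mul1r.
have -> : r ^+ `|z|%N * exp_cov z = \int[mu]_(x in I) (cos (z%:~R * x) * V x).
  have E f : \int[mu]_(x in I) (cos (z%:~R * x) * f x) = \int[mu]_(x in I) (cos (`|z|%N%:R * x) * f x).
    by apply: eq_Rintegral => x _; rewrite cos_absz.
  rewrite /exp_cov !E (poisson_cos_coef _ r01 ei) /cos_coef; congr (_ * _).
  by apply: eq_Rintegral => x _; rewrite mulrC.
rewrite /poisson_cov /exp_cov !E0 -(Rintegral_poisson_exp ei r01) -/V.
rewrite -(RintegralB (@measurable_I R) (cosi z Vi) (cosi z Ei)).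
rewrite -(RintegralB (@measurable_I R) Vi Ei).
have Wi : integ (fun x => V x - expR (poisson r u x)).
  by have := integrableB (@measurable_I R) Vi Ei; apply: eq_integrable => // x _.
have := Rintegral_mul_le Wi (mcosz z) (fun x _ => cos_max (z%:~R * x)).
rewrite mul1r /norm1.
rewrite (_ : \int[mu]_(x in I) (_ * cos _) =
  \int[mu]_(x in I) (cos (z%:~R * x) * V x - cos (z%:~R * x) * expR (poisson r u x))); last first.
  by apply: eq_Rintegral => x _; rewrite mulrC mulrBr.
rewrite (_ : \int[mu]_(x in I) `|_| = \int[mu]_(x in I) (V x - expR (poisson r u x)))//.
apply: eq_Rintegral => x _; rewrite ger0_norm// subr_ge0.
exact: (jensen_poisson ui ei).
Qed.

Lemma poisson_cov0_cvg : (fun N => poisson_cov (radius N) 0) @ \oo --> exp_cov 0.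
Proof.
have E0 f : \int[mu]_(x in I) (cos (0%:~R * x) * f x) = \int[mu]_(x in I) f x.
  by apply: eq_Rintegral => x _; rewrite mul0r cos0 mul1r.
rewrite /exp_cov E0; under eq_fun do rewrite /poisson_cov E0.
exact: exp_poisson_mean.
Qed.

Lemma radius_expn_cvg k : (fun N => radius N ^+ k) @ \oo --> (1 : R).
Proof.
elim: k => [|k IH]; first exact: cvg_cst.
rewrite -[X in _ --> X]mulr1; under eq_fun do rewrite exprS.
by apply: cvgM; [exact: radius_cvg | exact: IH].
Qed.

Lemma poisson_cov_cvg (z : int) : (fun N => poisson_cov (radius N) z) @ \oo --> exp_cov z.
Proof.
have h1 : (fun N => exp_cov 0 - poisson_cov (radius N) 0) @ \oo --> (0 : R).
  by rewrite -[X in _ --> X](subrr (exp_cov 0)); apply: cvgB; [exact: cvg_cst | exact: poisson_cov0_cvg].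
have h2 : (fun N => radius N ^+ `|z|%N * exp_cov z) @ \oo --> exp_cov z.
  by rewrite -[X in _ --> X]mul1r; apply: cvgM; [exact: radius_expn_cvg | exact: cvg_cst].
have h3 : (fun N => radius N ^+ `|z|%N * exp_cov z - poisson_cov (radius N) z) @ \oo --> (0 : R).
  apply/norm_cvg0P; apply: (@squeeze_cvgr _ _ _ _ (fun=> 0) (fun N => exp_cov 0 - poisson_cov (radius N) 0)) => //.
    by near=> N; rewrite normr_ge0 /= poisson_cov_diff// radius_ge0_lt1.
  exact: cvg_cst.
have -> : (fun N => poisson_cov (radius N) z) = (fun N => radius N ^+ `|z|%N * exp_cov z - (radius N ^+ `|z|%N * exp_cov z - poisson_cov (radius N) z)).
  by apply/funext => N; rewrite subKr.
by rewrite -[X in _ --> X]subr0; apply: cvgB.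
Unshelve. all: by end_near. Qed.

Lemma poisson_cov_le r (z : int) : 0 <= r < 1 -> `|poisson_cov r z| <= exp_cov 0.
Proof.
move=> r01; have Ei := integrable_exp_poisson ui r01.
have H w : `|poisson_cov r w| <= poisson_cov r 0.
  have := Rintegral_mul_le Ei (mcosz w) (fun x _ => cos_max (w%:~R * x)).
  rewrite mul1r /norm1 (_ : \int[mu]_(x in I) (_ * cos _) = poisson_cov r w); last first.
    by apply: eq_Rintegral => x _; rewrite mulrC.
  rewrite (_ : \int[mu]_(x in I) `|_| = poisson_cov r 0)//.
  by apply: eq_Rintegral => x _; rewrite mul0r cos0 mul1r ger0_norm ?expR_ge0.
apply: le_trans (H z) _; rewrite -subr_ge0.
by apply: le_trans (poisson_cov_diff 0 r01).
Qed.

Lemma Hs0 r : 0 <= r < 1 -> Hs r 0 = 0.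
Proof.
move=> r01; apply/esym/(cvg_unique (@Rhausdorff R) _ (cHs (th := 0) r01)).
rewrite [X in X @ _](_ : _ = fun=> 0); first exact: cvg_cst.
by apply/funext => N; rewrite /series /= big1// => k _; rewrite mulr0 sin0 mulr0.
Qed.

Lemma cHc0 r : 0 <= r < 1 -> series (fun k => c k * r ^+ k) @ \oo --> Hc r 0.
Proof.
move=> r01; have := cHc (th := 0) r01.
by under eq_fun do rewrite mulr0 cos0 mulr1.
Qed.

Lemma cAc0 r : 0 <= r < 1 -> series (fun k => a k * r ^+ k) @ \oo --> Ac r 0.
Proof.
move=> r01; have := cAc (th := 0) r01.
by under eq_fun do rewrite mulr0 cos0 mulr1.
Qed.

Lemma c_abs r : 0 <= r < 1 -> cvgn (series (fun k => `|c k * r ^+ k|)).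
Proof.
(* The power series converges at [s], strictly between [r] and 1, hence absolutely at [r]. *)
move=> /andP[r0 r1]; pose s := (r + 1) / 2.
have rs : r < s by rewrite /s; lra.
have s01 : 0 <= s < 1 by rewrite /s; apply/andP; split; lra.
have s0 : 0 <= s by case/andP: s01.
have cs : cvgn (pseries c s) by apply/cvg_ex; exists (Hc s 0); exact: cHc0.
have rs' : `|r| < `|s| by rewrite (ger0_norm r0) (ger0_norm s0).
rewrite (_ : (fun k => `|c k * r ^+ k|) = (fun k => `|c k| * r ^+ k)).
  exact: (is_cvg_pseries_inside_norm cs rs').
by apply/funext => k; rewrite normrM (ger0_norm (exprn_ge0 k r0)).
Qed.

Lemma mul_cos_sin (z : int) (k : nat) x : cos (z%:~R * x) * cos (k%:R * x) + sin (z%:~R * x) * sin (k%:R * x)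
  = cos ((z - k%:Z)%:~R * x) :> R.
Proof. by rewrite intrD mulrNz -pmulrn mulrBl cosB. Qed.

(** The integrand is the real part of [exp(-izx) h]. Termwise integration keeps the coefficient of
    index [z], and a power series has none for negative [z]. *)
Lemma H_fourier r (z : int) : 0 <= r < 1 ->
  \int[mu]_(x in I) (cos (z%:~R * x) * Hc r x + sin (z%:~R * x) * Hs r x) =
  2 * pi * (cext c z * r ^+ `|z|%N).
Proof.
move=> r01; have [r0 r1] := andP r01.
pose s1 := series (fun k => \int[mu]_(x in I) (1 * (c k * r ^+ k * cos ((z - k%:Z)%:~R * x)))).
have h : s1 @ \oo --> \int[mu]_(x in I) (1 * (cos (z%:~R * x) * Hc r x + sin (z%:~R * x) * Hs r x)).
  apply: (@Rintegral_series _ _ _ mu I (@measurable_I R) (fun=> 1)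
    (fun k x => c k * r ^+ k * cos ((z - k%:Z)%:~R * x)) (fun k => `|c k * r ^+ k|)
    (fun x => cos (z%:~R * x) * Hc r x + sin (z%:~R * x) * Hs r x) (integrable_I_cst 1)).
  - by move=> k; apply: measurable_funM; [exact: measurable_cst | exact: mcosz].
  - by move=> k x _; rewrite normrM ler_piMr// cos_max.
  - exact: c_abs.
  - move=> x _.
    rewrite (_ : series _ = fun N => cos (z%:~R * x) * series (fun k => c k * r ^+ k * cos (k%:R * x)) N
        + sin (z%:~R * x) * series (fun k => c k * r ^+ k * sin (k%:R * x)) N).
      by apply: cvgD; apply: cvgM; (try exact: cvg_cst); [exact: cHc | exact: cHs].
    apply/funext => N; rewrite /series /= !mulr_sumr -big_split /=.
    by apply: eq_bigr => k _; rewrite -mul_cos_sin; ring.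
transitivity (\int[mu]_(x in I) (1 * (cos (z%:~R * x) * Hc r x + sin (z%:~R * x) * Hs r x))).
  by apply: eq_Rintegral => x _; rewrite mul1r.
apply: (cvg_unique (@Rhausdorff R) h).
have -> : s1 = series (fun k => 2 * pi * (c k * r ^+ k * (z - k%:Z == 0)%:R)).
  congr series; apply/funext => k.
  have ci := integrable_I_continuous (@continuous_cosM R (z - k%:Z)%:~R).
  transitivity (\int[mu]_(x in I) (c k * r ^+ k * cos ((z - k%:Z)%:~R * x))).
    by apply: eq_Rintegral => x _; rewrite mul1r.
  by rewrite (RintegralZl _ (@measurable_I R) ci) Rintegral_cosz; ring.
case: z {h s1} => n.
  rewrite (_ : 2 * pi * _ = (fun k => 2 * pi * (c k * r ^+ k * (n%:Z - k%:Z == 0)%:R)) n); last first.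
    by rewrite subrr eqxx mulr1.
  apply: cvg_series_single => k kn.
  by rewrite (_ : (_ == 0) = false) ?mulr0//; lia.
rewrite /= mul0r mulr0 [X in X @ _](_ : _ = fun=> 0); first exact: cvg_cst.
apply/funext => N; rewrite /series /= big1// => k _.
by rewrite (_ : (_ == 0) = false) ?mulr0//; lia.
Qed.

Let S r := limn (series (fun k => `|c k * r ^+ k|)).

Let Hc_bound r x : 0 <= r < 1 -> `|Hc r x| <= S r.
Proof.
move=> r01; apply: series_norm_le (c_abs r01) (cHc (th := x) r01) => k.
by rewrite normrM ler_piMr// cos_max.
Qed.

Let Hs_bound r x : 0 <= r < 1 -> `|Hs r x| <= S r.
Proof.
move=> r01; apply: series_norm_le (c_abs r01) (cHs (th := x) r01) => k.
by rewrite normrM ler_piMr// sin_max.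
Qed.

Let Hc_meas r : 0 <= r < 1 -> measurable_fun I (Hc r).
Proof.
move=> r01; apply: (@measurable_fun_limr _ _ _ I
  (fun N th => series (fun k => c k * r ^+ k * cos (k%:R * th)) N)) => [N|x _]; last exact: cHc.
rewrite /series /=; apply: measurable_sum => k; apply: measurable_funM => //.
exact: measurable_I_continuous (@continuous_cosM _ k%:R).
Qed.

Let Hs_meas r : 0 <= r < 1 -> measurable_fun I (Hs r).
Proof.
move=> r01; apply: (@measurable_fun_limr _ _ _ I
  (fun N th => series (fun k => c k * r ^+ k * sin (k%:R * th)) N)) => [N|x _]; last exact: cHs.
rewrite /series /=; apply: measurable_sum => k; apply: measurable_funM => //.
exact: measurable_I_continuous (@continuous_sinM _ k%:R).
Qed.

(** Of the two factors in [|h|^2] only one is expanded; the other is integrated by [H_fourier], so a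
    single dominated series suffices. *)
Lemma parseval r : 0 <= r < 1 -> series (fun k => c k ^+ 2 * r ^+ k.*2) @ \oo --> poisson_cov r 0.
Proof.
move=> r01; pose g k x := cos (k%:R * x) * Hc r x + sin (k%:R * x) * Hs r x.
have mg k : measurable_fun I (g k).
  apply: measurable_funD; apply: measurable_funM.
  - exact: measurable_I_continuous (@continuous_cosM _ k%:R).
  - exact: Hc_meas.
  - exact: measurable_I_continuous (@continuous_sinM _ k%:R).
  - exact: Hs_meas.
have gB k x : `|g k x| <= S r + S r.
  apply: le_trans (ler_normD _ _) _; apply: lerD; rewrite normrM -[X in _ <= X]mul1r.
    by apply: ler_pM => //; [exact: cos_max | exact: Hc_bound].
  by apply: ler_pM => //; [exact: sin_max | exact: Hs_bound].
have gi k : integ (g k) by apply: (integrable_I_bounded (mg k)) => x _; exact: gB.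
have h : series (fun k => \int[mu]_(x in I) (1 * (c k * r ^+ k * g k x))) @ \oo -->
    \int[mu]_(x in I) (1 * (2 * pi * expR (poisson r u x))).
  apply: (@Rintegral_series _ _ _ mu I (@measurable_I R) (fun=> 1)
    (fun k x => c k * r ^+ k * g k x) (fun k => (S r + S r) * `|c k * r ^+ k|)
    (fun x => 2 * pi * expR (poisson r u x)) (integrable_I_cst 1)).
  - by move=> k; apply: measurable_funM.
  - by move=> k x _; rewrite normrM mulrC ler_wpM2r.
  - have -> : (fun k => (S r + S r) * `|c k * r ^+ k|) = (S r + S r) *: (fun k => `|c k * r ^+ k|) by [].
    by apply: is_cvg_seriesZ; exact: c_abs.
  - move=> x _; rewrite -H_norm//.
    rewrite (_ : series _ = fun N => series (fun k => c k * r ^+ k * cos (k%:R * x)) N * Hc r x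
        + series (fun k => c k * r ^+ k * sin (k%:R * x)) N * Hs r x).
      by rewrite !expr2; apply: cvgD; apply: cvgM; (try exact: cvg_cst); [exact: cHc | exact: cHs].
    apply/funext => N; rewrite /series /= !mulr_suml -big_split /=.
    by apply: eq_bigr => k _; rewrite /g; ring.
have Ei := integrable_exp_poisson ui r01.
have E1 : \int[mu]_(x in I) (1 * (2 * pi * expR (poisson r u x))) = 2 * pi * poisson_cov r 0.
  rewrite /poisson_cov (_ : \int[mu]_(x in I) (cos _ * _) = \int[mu]_(x in I) expR (poisson r u x)); last first.
    by apply: eq_Rintegral => x _; rewrite mul0r cos0 mul1r.
  by rewrite -(RintegralZl _ (@measurable_I R) Ei); apply: eq_Rintegral => x _; rewrite mul1r.
have E2 k : \int[mu]_(x in I) (1 * (c k * r ^+ k * g k x)) = 2 * pi * (c k ^+ 2 * r ^+ k.*2).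
  transitivity (\int[mu]_(x in I) (c k * r ^+ k * g k x)).
    by apply: eq_Rintegral => x _; rewrite mul1r.
  rewrite (RintegralZl _ (@measurable_I R) (gi k)) (H_fourier k%:Z r01) /=.
  by rewrite -addnn exprD; ring.
rewrite E1 in h.
have {}h : (fun N => (2 * pi)^-1 * series (fun k => \int[mu]_(x in I) (1 * (c k * r ^+ k * g k x))) N) @ \oo
    --> (2 * pi)^-1 * (2 * pi * poisson_cov r 0) by apply: cvgM; [exact: cvg_cst | exact: h].
move: h; rewrite mulKf ?pi2_neq0//.
rewrite [X in X @ _ --> _ -> _](_ : _ = series (fun k => c k ^+ 2 * r ^+ k.*2))//.
apply/funext => N; rewrite /series /= mulr_sumr; apply: eq_bigr => k _.
by rewrite E2 mulKf ?pi2_neq0.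
Qed.

Lemma yule_walker_r r (i : int) : 0 <= r < 1 ->
  wsum a (fun p => r ^+ p * poisson_cov r (p%:Z + i)) = - (cext c i * r ^+ `|i|%N).
Proof.
move=> r01; have [r0 r1] := andP r01.
have Ei := integrable_exp_poisson ui r01.
have fi : integ (fun x => 2 * pi * expR (poisson r u x)).
  by have := integrableZl (@measurable_I R) (2 * pi) Ei; apply: eq_integrable => // x _.
have h : series (fun p => \int[mu]_(x in I) (2 * pi * expR (poisson r u x) * (a p * r ^+ p * cos ((p%:Z + i)%:~R * x)))) @ \oo
    --> \int[mu]_(x in I) (2 * pi * expR (poisson r u x) * (cos (i%:~R * x) * Ac r x - sin (i%:~R * x) * As r x)).
  apply: (@Rintegral_series _ _ _ mu I (@measurable_I R) (fun x => 2 * pi * expR (poisson r u x))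
    (fun p x => a p * r ^+ p * cos ((p%:Z + i)%:~R * x)) (fun p => `|a p|)
    (fun x => cos (i%:~R * x) * Ac r x - sin (i%:~R * x) * As r x) fi).
  - by move=> p; apply: measurable_funM; [exact: measurable_cst | exact: mcosz].
  - move=> p x _; rewrite -mulrA normrM ler_piMr// normrM -[X in _ <= X]mulr1.
    apply: ler_pM => //; last exact: cos_max.
    by rewrite normrX (ger0_norm r0) exprn_ile1// ltW.
  - exact: cva.
  - move=> x _.
    rewrite (_ : series _ = fun N => cos (i%:~R * x) * series (fun k => a k * r ^+ k * cos (k%:R * x)) N
        - sin (i%:~R * x) * series (fun k => a k * r ^+ k * sin (k%:R * x)) N).
      by apply: cvgB; apply: cvgM; (try exact: cvg_cst); [exact: cAc | exact: cAs].
    apply/funext => N; rewrite /series /= !mulr_sumr -sumrB.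
    by apply: eq_bigr => p _; rewrite intrD -pmulrn mulrDl cosD; ring.
have E1 : \int[mu]_(x in I) (2 * pi * expR (poisson r u x) * (cos (i%:~R * x) * Ac r x - sin (i%:~R * x) * As r x))
    = - (2 * pi * (cext c i * r ^+ `|i|%N)).
  have Hi : integ (fun x => cos (i%:~R * x) * Hc r x + sin (i%:~R * x) * Hs r x).
    have msin : measurable_fun I (fun x => sin (i%:~R * x)).
      exact: measurable_I_continuous (@continuous_sinM _ i%:~R).
    apply: (@integrable_I_bounded _ _ (S r + S r)).
      apply: measurable_funD; [apply: measurable_funM; [exact: mcosz|exact: Hc_meas]|apply: measurable_funM; [exact: msin|exact: Hs_meas]].
    move=> x _; apply: le_trans (ler_normD _ _) _; apply: lerD; rewrite normrM -[X in _ <= X]mul1r.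
      by apply: ler_pM => //; [exact: cos_max | exact: Hc_bound].
    by apply: ler_pM => //; [exact: sin_max | exact: Hs_bound].
  rewrite -(H_fourier i r01) -[RHS]mulN1r -(RintegralZl _ (@measurable_I R) Hi).
  apply: eq_Rintegral => x _; rewrite -H_norm//.
  (* [A1] and [A2] are the real and imaginary parts of [- |h|^2 / h = - conj(h)]. *)
  have A1 : (Hc r x ^+ 2 + Hs r x ^+ 2) * Ac r x = - Hc r x.
    transitivity (Hc r x * (Hc r x * Ac r x - Hs r x * As r x) + Hs r x * (Hc r x * As r x + Hs r x * Ac r x)); first by ring.
    by rewrite HA_re// HA_im//; ring.
  have A2 : (Hc r x ^+ 2 + Hs r x ^+ 2) * As r x = Hs r x.
    transitivity (- Hs r x * (Hc r x * Ac r x - Hs r x * As r x) + Hc r x * (Hc r x * As r x + Hs r x * Ac r x)); first by ring.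
    by rewrite HA_re// HA_im//; ring.
  transitivity (cos (i%:~R * x) * ((Hc r x ^+ 2 + Hs r x ^+ 2) * Ac r x)
    - sin (i%:~R * x) * ((Hc r x ^+ 2 + Hs r x ^+ 2) * As r x)); first by ring.
  by rewrite A1 A2; ring.
have E2 p : \int[mu]_(x in I) (2 * pi * expR (poisson r u x) * (a p * r ^+ p * cos ((p%:Z + i)%:~R * x)))
    = a p * (2 * pi * (r ^+ p * poisson_cov r (p%:Z + i))).
  transitivity (\int[mu]_(x in I) (a p * (2 * pi * r ^+ p) * (cos ((p%:Z + i)%:~R * x) * expR (poisson r u x)))).
    by apply: eq_Rintegral => x _; ring.
  by rewrite (RintegralZl _ (@measurable_I R) (cosi _ Ei)) /poisson_cov; ring.
rewrite E1 in h.
have B p : `|r ^+ p * poisson_cov r (p%:Z + i)| <= exp_cov 0.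
  rewrite normrM -[X in _ <= X]mul1r; apply: ler_pM => //; last exact: poisson_cov_le.
  by rewrite normrX (ger0_norm r0) exprn_ile1// ltW.
have : wsum a (fun p => 2 * pi * (r ^+ p * poisson_cov r (p%:Z + i))) = - (2 * pi * (cext c i * r ^+ `|i|%N)).
  apply: (cvg_lim (@Rhausdorff R)); move: h.
  by rewrite (_ : (fun p => \int[mu]_(x in I) _) = fun p => a p * (2 * pi * (r ^+ p * poisson_cov r (p%:Z + i))))//; apply/funext.
rewrite (wsumZ cva _ B) -mulrN => /(mulfI (@pi2_neq0 R)).
exact.
Qed.

Lemma yule_walker (i : int) : wsum a (fun p => exp_cov (p%:Z + i)) = - cext c i.
Proof.
have h1 : (fun N => wsum a (fun p => radius N ^+ p * poisson_cov (radius N) (p%:Z + i))) @ \oo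
    --> wsum a (fun p => exp_cov (p%:Z + i)).
  apply: (@wsum_lim _ _ cva _ _ (exp_cov 0)) => [N p|p].
    have r01 := @radius_ge0_lt1 R N; have [r0 r1] := andP r01.
    rewrite normrM -[X in _ <= X]mul1r; apply: ler_pM => //; last exact: poisson_cov_le.
    by rewrite normrX (ger0_norm r0) exprn_ile1// ltW.
  by rewrite -[X in _ --> X]mul1r; apply: cvgM; [exact: radius_expn_cvg | exact: poisson_cov_cvg].
have h2 : (fun N => wsum a (fun p => radius N ^+ p * poisson_cov (radius N) (p%:Z + i))) @ \oo
    --> - cext c i * 1.
  under eq_fun do rewrite (yule_walker_r _ (radius_ge0_lt1 _)) -mulNr.
  by apply: cvgM; [exact: cvg_cst | exact: radius_expn_cvg].
rewrite mulr1 in h2; exact: (cvg_unique (@Rhausdorff R) h1 h2).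
Qed.

Lemma sum_sq_le N : \sum_(k < N) c k ^+ 2 <= exp_cov 0.
Proof.
have h1 : (fun M => \sum_(k < N) c k ^+ 2 * (radius M : R) ^+ k.*2) @ \oo --> \sum_(k < N) c k ^+ 2 * 1.
  by apply: cvg_sumr => k; apply: cvgM; [exact: cvg_cst | exact: radius_expn_cvg].
under eq_bigr do rewrite -[c _ ^+ 2]mulr1.
apply: (ler_cvg_to h1 poisson_cov0_cvg); near=> M.
have r01 := @radius_ge0_lt1 R M.
have H := parseval r01; rewrite -(cvg_lim (@Rhausdorff R) H).
have := @nondecreasing_cvgn_le _ (series (fun k => c k ^+ 2 * (radius M : R) ^+ k.*2)) _ _ N.
rewrite /series /= big_mkord; apply.
- by apply/nondecreasing_series => k _ _; rewrite mulr_ge0 ?sqr_ge0 ?exprn_ge0// ltW// radius_gt0.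
- by apply/cvg_ex; exists (poisson_cov (radius M) 0).
Unshelve. all: by end_near. Qed.

(** An Abelian limit with nonnegative terms: the partial sums are bounded through [parseval] along
    the radii, and conversely [r ^+ k.*2 <= 1] bounds each [parseval] sum by the full series. *)
Lemma sum_sq_cvg : (fun N => \sum_(k < N) c k ^+ 2) @ \oo --> exp_cov 0.
Proof.
have nd : nondecreasing_seq (series (fun k => c k ^+ 2)).
  by apply/nondecreasing_series => k _ _; rewrite sqr_ge0.
have cs : cvgn (series (fun k => c k ^+ 2)).
  apply: nondecreasing_is_cvgn => //; exists (exp_cov 0) => _ [N _ <-].
  by rewrite /series /= big_mkord sum_sq_le.
have -> : (fun N => \sum_(k < N) c k ^+ 2) = series (fun k => c k ^+ 2).
  by apply/funext => N; rewrite /series /= big_mkord.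
suff <- : limn (series (fun k => c k ^+ 2)) = exp_cov 0 by exact: cs.
apply/eqP; rewrite eq_le; apply/andP; split.
  apply: limr_le => //; near=> N; by rewrite /series /= big_mkord sum_sq_le.
rewrite -(cvg_lim (@Rhausdorff R) poisson_cov0_cvg); apply: limr_le.
  by apply/cvg_ex; exists (exp_cov 0); exact: poisson_cov0_cvg.
near=> M; have r01 := @radius_ge0_lt1 R M; have [r0 r1] := andP r01.
have H := parseval r01; rewrite -(cvg_lim (@Rhausdorff R) H).
apply: lim_series_le => //; first by apply/cvg_ex; exists (poisson_cov (radius M) 0).
by move=> k; rewrite ler_piMr ?sqr_ge0// exprn_ile1// ltW.
Unshelve. all: by end_near. Qed.

End SpectralFactor.

(** * Identities between power series *)

(** Once the lower coefficients vanish, dividing by [r ^+ n] bounds [d n] by the geometric tail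
    [K * (2 * r)], which is arbitrarily small. *)
Lemma power_series_eq0 (R : realType) (d : nat -> R) K :
  (forall s, `|d s| <= K) ->
  (forall r, 0 < r < 1 -> series (fun s => d s * r ^+ s) @ \oo --> (0 : R)) ->
  forall n, d n = 0.
Proof.
move=> dK d0 n; elim/ltn_ind: n => n IH.
have K0 : 0 <= K by exact: le_trans (dK 0%N).
have H r : 0 < r <= 1 / 2 -> `|d n| <= K * (2 * r).
  move=> /andP[r0 r2]; have r1 : 0 < r < 1 by rewrite r0 /=; lra.
  have S2 M : \sum_(s < M) r ^+ s <= 2.
    have E : (1 - r) * \sum_(s < M) r ^+ s = 1 - r ^+ M.
      elim: M => [|M IHM]; first by rewrite big_ord0 mulr0 expr0 subrr.
      by rewrite big_ord_recr /= mulrDr IHM exprS; ring.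
    have rM : 0 <= r ^+ M by rewrite exprn_ge0// ltW.
    have SM : 0 <= \sum_(s < M) r ^+ s by rewrite sumr_ge0// => i _; rewrite exprn_ge0// ltW.
    by nra.
  have hs : (fun M => series (fun s => d s * r ^+ s) (M + n.+1)%N) @ \oo --> (0 : R).
    by rewrite (cvg_shiftn n.+1 (series (fun s => d s * r ^+ s))); exact: d0.
  have hn : (fun M => `|d n * r ^+ n - series (fun s => d s * r ^+ s) (M + n.+1)%N|) @ \oo
      --> `|d n * r ^+ n - 0|.
    by apply: cvg_norm; apply: cvgB; [exact: cvg_cst | exact: hs].
  have rn : 0 < r ^+ n by rewrite exprn_gt0.
  rewrite -(ler_pM2r rn) -{1}(ger0_norm (ltW rn)) -normrM -[X in `|X|]subr0.
  rewrite -(cvg_lim (@Rhausdorff R) hn); apply: limr_le; first by apply/cvg_ex; eexists; exact: hn.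
  near=> M.
  rewrite /series /= addnC (big_cat_nat (n := n.+1)) ?leq_addr//= big_nat_recr//=.
  rewrite big_nat big1 => [|s /andP[_ sn]]; last by rewrite IH ?mul0r.
  rewrite add0r opprD addrA subrr add0r normrN -{1}[n.+1]add0n big_addn addKn big_mkord.
  apply: le_trans (ler_norm_sum _ _ _) _.
  apply: (@le_trans _ _ (\sum_(s < M) K * r * r ^+ n * r ^+ s)).
    apply: ler_sum => s _; rewrite normrM.
    rewrite (_ : K * r * r ^+ n * r ^+ s = K * `|r ^+ (s + n.+1)|) ?ler_wpM2r//.
    by rewrite ger0_norm ?exprn_ge0 ?(ltW r0)// exprD exprS; ring.
  rewrite -mulr_sumr (_ : K * (2 * r) * r ^+ n = K * r * r ^+ n * 2); last by ring.
  by rewrite ler_wpM2l// ?mulr_ge0// ltW.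
apply/eqP; rewrite -normr_eq0; apply/eqP/le_anti; rewrite normr_ge0 andbT.
apply/ler_addgt0Pr => e e0; rewrite add0r.
pose r := Num.min (1 / 2) (e / (2 * (K + 1))).
have K1 : 0 < 2 * (K + 1) by lra.
have r0 : 0 < r <= 1 / 2 by rewrite /r ge_min lexx andbT lt_min !divr_gt0.
apply: le_trans (H r r0) _.
have : r <= e / (2 * (K + 1)) by rewrite /r ge_min lexx orbT.
rewrite ler_pdivlMr// => h; case/andP: r0 => r0 _.
by nra.
Unshelve. all: by end_near. Qed.

(** Mertens' theorem for the Cauchy product at every [0 < r < 1], followed by comparison of
    coefficients, for which the bound [C] on [c] is used. *)
Lemma conv_reciprocal (R : realType) (c a : nat -> R) (H A : R -> R) (C : R) :
  cvgn [normed series a] -> (forall k, `|c k| <= C) ->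
  (forall r, 0 < r < 1 -> series (fun k => c k * r ^+ k) @ \oo --> H r) ->
  (forall r, 0 < r < 1 -> series (fun k => a k * r ^+ k) @ \oo --> A r) ->
  (forall r, 0 < r < 1 -> cvgn (series (fun k => `|c k * r ^+ k|))) ->
  (forall r, 0 < r < 1 -> H r * A r = -1) ->
  forall n, conv c a n = - (n == 0%N)%:R.
Proof.
move=> cva cC cH cA cabs HA n; rewrite convC.
have C0 : 0 <= C by exact: le_trans (cC 0%N).
suff : conv a c n + (n == 0%N)%:R = 0 by move/eqP; rewrite addr_eq0 => /eqP.
apply: (@power_series_eq0 _ (fun n => conv a c n + (n == 0%N)%:R) (C * l1 a + 1)) => [s|r r01].
  apply: le_trans (ler_normD _ _) _; apply: lerD; last by rewrite normr_nat lern1 leq_b1.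
  apply: le_trans (ler_norm_sum _ _ _) _.
  apply: (@le_trans _ _ (C * series (fun p => `|a p|) s.+1)).
    by rewrite /series /= big_mkord mulr_sumr ler_sum// => i _; rewrite normrM mulrC ler_wpM2r.
  by rewrite ler_wpM2l// nseries_le_l1.
have [r0 r1] := andP r01.
pose CN := series (fun k => c k * r ^+ k).
(* The partial sum of the Cauchy product is a sum weighted by [a] of partial sums of the series of
   [c], which [wsum_lim] takes to the limit. *)
have E N : series (fun s => conv a c s * r ^+ s) N = \sum_(p < N) a p * (r ^+ p * CN (N - p)%N).
  elim: N => [|N IHN]; first by rewrite /series /= big_geq// big_ord0.
  rewrite seriesSr IHN [RHS]big_ord_recr /= subSn// subnn.
  rewrite [in RHS](eq_bigr (fun p : 'I_N => a p * (r ^+ p * CN (N - p)%N) + a p * c (N - p)%N * r ^+ N)).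
    rewrite [in RHS]big_split /= -addrA; congr (_ + _).
    rewrite /conv big_ord_recr /= subnn mulrDl mulr_suml; congr (_ + _).
    by rewrite /CN /series /= big_nat1 expr0; ring.
  move=> p _; rewrite subSn ?(ltnW (ltn_ord p))// /CN seriesSr.
  have -> : r ^+ N = r ^+ p * r ^+ (N - p) by rewrite -exprD subnKC ?(ltnW (ltn_ord p)).
  by ring.
pose S := limn (series (fun k => `|c k * r ^+ k|)).
have CS N : `|CN N| <= S.
  apply: le_trans (ler_norm_sum _ _ _) _.
  apply: (nondecreasing_cvgn_le _ (cabs _ r01) N).
  by apply/nondecreasing_series => k _ _; exact: normr_ge0.
have S0 : 0 <= S by exact: le_trans (CS 0%N).
have B N p : `|r ^+ p * CN (N - p)%N| <= S.
  rewrite normrM -[S]mul1r; apply: ler_pM => //.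
  by rewrite normrX ger0_norm ?(ltW r0)// exprn_ile1// ltW.
have h1 : (fun N => wsum a (fun p => (p < N)%:R * (r ^+ p * CN (N - p)%N))) @ \oo
    --> wsum a (fun p => r ^+ p * H r).
  apply: (@wsum_lim _ _ cva _ _ S) => [N p|p].
    by case: (p < N)%N; rewrite ?mul1r ?mul0r ?normr0.
  have hp : (fun N => r ^+ p * CN N) @ \oo --> r ^+ p * H r.
    by apply: cvgM; [exact: cvg_cst | exact: cH].
  rewrite -(cvg_shiftn p.+1); rewrite -(cvg_shiftn 1) in hp; apply: cvg_trans hp.
  apply: near_eq_cvg; near=> N.
  rewrite /= (addnS N p) ltnS leq_addl mul1r (_ : ((N + p).+1 - p = N + 1)%N)//; lia.
have W : wsum a (fun p => r ^+ p * H r) = -1.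
  apply: (cvg_lim (@Rhausdorff R)); rewrite -(HA _ r01).
  rewrite (_ : series _ = fun N => H r * series (fun k => a k * r ^+ k) N).
    by apply: cvgM; [exact: cvg_cst | exact: cA].
  by apply/funext => N; rewrite /series /= mulr_sumr; apply: eq_bigr => k _; ring.
rewrite W in h1.
have h2 : series (fun s => conv a c s * r ^+ s) @ \oo --> (-1 : R).
  apply: cvg_trans h1; apply: near_eq_cvg; near=> N.
  by rewrite E (@wsum_finite _ _ cva (fun p => r ^+ p * CN (N - p)%N) S)// big_mkord.
have h3 : series (fun s => (s == 0%N)%:R * r ^+ s) @ \oo --> (1 : R).
  rewrite -(cvg_shiftn 1) (_ : (fun N => _ (N + 1)%N) = fun=> 1); first exact: cvg_cst.
  apply/funext => N.
  by rewrite addn1 /series /= big_nat_recl// big1 ?addr0 ?mul1r ?expr0// => i _; rewrite mul0r.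
have h4 : (fun N => series (fun s => conv a c s * r ^+ s) N +
    series (fun s => (s == 0%N)%:R * r ^+ s) N) @ \oo --> -1 + (1 : R) by exact: cvgD h2 h3.
rewrite addNr in h4.
rewrite (_ : series _ = fun N => series (fun s => conv a c s * r ^+ s) N + series (fun s => (s == 0%N)%:R * r ^+ s) N)//.
by apply/funext => N; rewrite /series /= -big_split /=; apply: eq_bigr => k _; rewrite mulrDl.
Unshelve. all: by end_near. Qed.

(** * The outer function *)

Section Complex.
Local Open Scope complex_scope.
Context {R : realType}.
Implicit Types (x y z w : R[i]) (r t th : R).
Local Notation Re := (@complex.Re R).
Local Notation Im := (@complex.Im R).

Lemma complexP x y : Re x = Re y -> Im x = Im y -> x = y.
Proof. by case: x y => [p q] [p' q'] /= -> ->. Qed.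

Lemma complex_ReM x y : Re (x * y) = Re x * Re y - Im x * Im y.
Proof. by case: x y => [p q] [p' q']. Qed.

Lemma complex_ImM x y : Im (x * y) = Re x * Im y + Im x * Re y.
Proof. by case: x y => [p q] [p' q']. Qed.

Lemma complex_ReD x y : Re (x + y) = Re x + Re y.
Proof. by case: x y => [p q] [p' q']. Qed.

Lemma complex_ImD x y : Im (x + y) = Im x + Im y.
Proof. by case: x y => [p q] [p' q']. Qed.

Lemma Re_sum (v : nat -> R[i]) n : Re (series v n) = series (fun k => Re (v k)) n.
Proof.
elim: n => [|n IH]; first by rewrite /series /= !big_geq.
by rewrite !seriesSr complex_ReD IH.
Qed.

Lemma Im_sum (v : nat -> R[i]) n : Im (series v n) = series (fun k => Im (v k)) n.
Proof.
elim: n => [|n IH]; first by rewrite /series /= !big_geq.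
by rewrite !seriesSr complex_ImD IH.
Qed.

Lemma Re_le_norm x : `|Re x|%:C <= `|x|.
Proof. exact: normc_ge_Re. Qed.

Lemma Im_le_norm x : `|Im x|%:C <= `|x|.
Proof.
case: x => p q /=; have := normc_ge_Re (q -i* p).
by rewrite !normc_def /= sqrrN addrC.
Qed.

Lemma cvg_Re (v : nat -> R[i]^o) (l : R[i]^o) :
  v @ \oo --> l -> (fun n => Re (v n)) @ \oo --> Re l.
Proof.
move=> /cvgrPdist_lt vl; apply/cvgrPdist_lt => e e0.
have e0' : 0 < e%:C by rewrite ltcR.
have := vl _ e0'; apply: filterS => n /=; rewrite -ltcR; apply: le_lt_trans.
by have := Re_le_norm (l - v n); rewrite (complex_ReD l (- v n)); case: (v n).
Qed.

Lemma cvg_Im (v : nat -> R[i]^o) (l : R[i]^o) :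
  v @ \oo --> l -> (fun n => Im (v n)) @ \oo --> Im l.
Proof.
move=> /cvgrPdist_lt vl; apply/cvgrPdist_lt => e e0.
have e0' : 0 < e%:C by rewrite ltcR.
have := vl _ e0'; apply: filterS => n /=; rewrite -ltcR; apply: le_lt_trans.
by have := Im_le_norm (l - v n); rewrite (complex_ImD l (- v n)); case: (v n).
Qed.

Lemma cisE t : cis t = cos t +i* sin t.
Proof. by rewrite /cis /cexp /= expR0 !mul1r. Qed.

Definition polar r t : R[i] := (r * cos t) +i* (r * sin t).

Lemma polarX r t n : polar r t ^+ n = polar (r ^+ n) (n%:R * t).
Proof.
elim: n => [|n IH].
  by rewrite /polar !expr0 mul0r cos0 sin0 mulr1 mulr0.
rewrite exprS IH; apply: complexP; rewrite ?complex_ReM ?complex_ImM /= exprS.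
  by rewrite -natr1 mulrDl mul1r cosD; ring.
by rewrite -natr1 mulrDl mul1r sinD; ring.
Qed.

Lemma norm_polar r t : 0 <= r -> `|polar r t| = r%:C.
Proof.
move=> r0; rewrite normc_def /= (_ : _ + _ = r ^+ 2) ?sqrtr_sqr ?ger0_norm//.
transitivity (r ^+ 2 * (cos t ^+ 2 + sin t ^+ 2)); first by ring.
by rewrite cos2Dsin2 mulr1.
Qed.

Lemma Re_herglotz r (x : R) th : 0 <= r < 1 ->
  Re ((cis x + polar r th) / (cis x - polar r th)) = poisson_kernel r (x - th).
Proof.
move=> /andP[r0 r1]; rewrite cisE /polar /poisson_kernel cosB.
have h1 := cos2Dsin2 x; have h2 := cos2Dsin2 th.
have D : 0 < 1 - 2 * r * (cos x * cos th + sin x * sin th) + r ^+ 2.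
  have := cos_max (x - th); rewrite cosB => /ler_normlP[_ h].
  by nra.
move: (cos x) (sin x) (cos th) (sin th) h1 h2 D => p q p' q' h1 h2 D.
have E : (p - r * p') ^+ 2 + (q - r * q') ^+ 2 = 1 - 2 * r * (p * p' + q * q') + r ^+ 2.
  transitivity ((p ^+ 2 + q ^+ 2) - 2 * r * (p * p' + q * q') + r ^+ 2 * (p' ^+ 2 + q' ^+ 2)); first by ring.
  by rewrite h1 h2; ring.
rewrite /= E; move: D; set D := (X in 0 < X) => D0.
transitivity (((p ^+ 2 + q ^+ 2) - r ^+ 2 * (p' ^+ 2 + q' ^+ 2)) / D); first by ring.
by rewrite h1 h2 mulr1.
Qed.

Lemma cexp_norm w : Re (cexp w) ^+ 2 + Im (cexp w) ^+ 2 = expR (2 * Re w).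
Proof.
rewrite /cexp /=; transitivity (expR (Re w) ^+ 2 * (cos (Im w) ^+ 2 + sin (Im w) ^+ 2)); first by ring.
by rewrite cos2Dsin2 mulr1 expr2 -expRD mulrDl mul1r.
Qed.

End Complex.

Section SpectralLink.
Local Open Scope complex_scope.
Context {R : realType}.
Local Notation Re := (@complex.Re R).
Local Notation Im := (@complex.Im R).
Local Notation mu := (@lebesgue_measure R).
Local Notation I := ([set` `[- pi, pi]] : set (measurableTypeR R)).
Local Notation integ f := (mu.-integrable I (EFin \o f)).
Variables (Delta : R -> R) (c a : nat -> R).
Implicit Types (z : R[i]) (r t th : R).
Local Notation u := (fun x => ln (Delta x)).

Lemma Re_cintegral (f : R -> R[i]) : Re (cintegral f) = \int[mu]_(x in I) Re (f x).
Proof. by []. Qed.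

Lemma outer_fun_neq0 z : outer_fun Delta z != 0.
Proof.
apply/eqP => h0.
have : Re (outer_fun Delta z) ^+ 2 + Im (outer_fun Delta z) ^+ 2 = 0.
  by rewrite h0 /= expr0n addr0.
rewrite /outer_fun complex_ReM complex_ImM.
set w := (X in cexp X) => h.
have : Num.sqrt (2 * pi) ^+ 2 * (Re (cexp w) ^+ 2 + Im (cexp w) ^+ 2) = 0 :> R.
  by rewrite -[RHS]h /=; ring.
rewrite cexp_norm sqr_sqrtr ?ltW ?pi2_gt0// => /eqP.
by rewrite mulf_eq0 !gt_eqF ?expR_gt0 ?pi2_gt0.
Qed.

Lemma outer_fun_norm r th : 0 <= r < 1 ->
  Re (outer_fun Delta (polar r th)) ^+ 2 + Im (outer_fun Delta (polar r th)) ^+ 2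
  = 2 * pi * expR (poisson r u th).
Proof.
move=> r01; rewrite /outer_fun.
set w := (X in cexp X).
rewrite complex_ReM complex_ImM; set e := cexp w.
transitivity (Num.sqrt (2 * pi) ^+ 2 * (Re e ^+ 2 + Im e ^+ 2)); first by rewrite /=; ring.
rewrite sqr_sqrtr ?ltW ?pi2_gt0// cexp_norm; congr (_ * expR _).
(* The squared modulus doubles the exponent, so [1 / (4 pi)] becomes the [1 / (2 pi)] of the Poisson
   integral. *)
rewrite /w complex_ReM /poisson [Im _%:C]/= mul0r subr0 [Re _%:C]/= mulrA; congr (_ * _).
  have := @pi_neq0 R; move: (@pi R) => p p0; by field.
rewrite Re_cintegral; apply: eq_Rintegral => x _.
by rewrite complex_ReM Re_herglotz//= mulr0 subr0 mulrC.
Qed.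

Lemma disc_expansion_polar f (v : nat -> R) r th : disc_expansion f v -> 0 <= r < 1 ->
  series (fun k => v k * r ^+ k * cos (k%:R * th)) @ \oo --> Re (f (polar r th)) /\
  series (fun k => v k * r ^+ k * sin (k%:R * th)) @ \oo --> Im (f (polar r th)).
Proof.
move=> fv /andP[r0 r1].
have := fv (polar r th); rewrite norm_polar// ltcR => /(_ r1) h.
split.
  have := cvg_Re h; rewrite (_ : (fun n => Re _) = series (fun k => v k * r ^+ k * cos (k%:R * th)))//.
  apply/funext => n; rewrite Re_sum; congr (series _ n); apply/funext => k.
  by rewrite complex_ReM polarX /= mul0r subr0 mulrA.
have := cvg_Im h; rewrite (_ : (fun n => Im _) = series (fun k => v k * r ^+ k * sin (k%:R * th)))//.
apply/funext => n; rewrite Im_sum; congr (series _ n); apply/funext => k.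
by rewrite complex_ImM polarX /= mul0r addr0 mulrA.
Qed.

Hypothesis Di : integ Delta.
Hypothesis Dpos : positive_log_integrable Delta.
Hypothesis MAc : MA_coef Delta c.
Hypothesis ARa : AR_coef Delta a.
Hypothesis cva : cvgn [normed series a].

Let H r th := outer_fun Delta (polar r th).
Let A r th := - (H r th)^-1.

Let HA r th : H r th * A r th = -1.
Proof. by rewrite /A mulrN divff// outer_fun_neq0. Qed.

Let ui : integ u.
Proof. by case: Dpos. Qed.

(** Positivity of [Delta] is given almost everywhere; at nonpositive values [ln] takes its default
    value 0 and the two sides differ. *)
Lemma ae_expR_ln : ae_eq mu I (EFin \o Delta) (EFin \o (fun x => expR (ln (Delta x)))).
Proof.
have F : Filter (almost_everywhere mu) by exact: ae_filter_ringOfSetsType.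
case: Dpos => + _; apply: (@filterS _ _ F) => x h /h D0.
by rewrite /= lnK.
Qed.

Let ei : integ (fun x => expR (u x)).
Proof.
have me : measurable_fun I (fun x => expR (u x)).
  by apply: measurableT_comp; [exact: measurable_expR | exact: (integrable_measurable ui)].
have mD := integrable_measurable Di.
apply/integrableP; split; first exact/measurable_EFinP.
case/integrableP: Di => _; apply: le_lt_trans; rewrite le_eqVlt; apply/orP; left.
apply/eqP; apply: ae_eq_integral => //.
- by apply: measurableT_comp => //; exact/measurable_EFinP.
- by apply: measurableT_comp => //; exact/measurable_EFinP.
- have F : Filter (almost_everywhere mu) by exact: ae_filter_ringOfSetsType.
  by apply: (@filterS _ _ F) ae_expR_ln => x h /h /= [<-].
Qed.

Let Hc r th := Re (H r th).
Let Hs r th := Im (H r th).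
Let Ac r th := Re (A r th).
Let As r th := Im (A r th).

Let cHc r th : 0 <= r < 1 -> series (fun k => c k * r ^+ k * cos (k%:R * th)) @ \oo --> Hc r th.
Proof. by move=> /(disc_expansion_polar th MAc)[]. Qed.

Let cHs r th : 0 <= r < 1 -> series (fun k => c k * r ^+ k * sin (k%:R * th)) @ \oo --> Hs r th.
Proof. by move=> /(disc_expansion_polar th MAc)[]. Qed.

Let cAc r th : 0 <= r < 1 -> series (fun k => a k * r ^+ k * cos (k%:R * th)) @ \oo --> Ac r th.
Proof. by move=> /(disc_expansion_polar th ARa)[]. Qed.

Let cAs r th : 0 <= r < 1 -> series (fun k => a k * r ^+ k * sin (k%:R * th)) @ \oo --> As r th.
Proof. by move=> /(disc_expansion_polar th ARa)[]. Qed.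

Let HA_re r th : Hc r th * Ac r th - Hs r th * As r th = -1.
Proof. by rewrite -complex_ReM HA. Qed.

Let HA_im r th : Hc r th * As r th + Hs r th * Ac r th = 0.
Proof. by rewrite -complex_ImM HA /= oppr0. Qed.

Let H_norm r th : 0 <= r < 1 -> Hc r th ^+ 2 + Hs r th ^+ 2 = 2 * pi * expR (poisson r u th).
Proof. exact: outer_fun_norm. Qed.

Lemma spectral_yule_walker (i : int) : wsum a (fun p => exp_cov u (p%:Z + i)) = - cext c i.
Proof.
exact: (yule_walker ui ei cHc cHs cAc cAs (fun r th _ => HA_re r th) (fun r th _ => HA_im r th) H_norm cva).
Qed.

Lemma spectral_sum_sq_le N : \sum_(k < N) c k ^+ 2 <= exp_cov u 0.
Proof. exact: (sum_sq_le ui ei cHc cHs H_norm). Qed.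

Lemma spectral_sum_sq_cvg : (fun N => \sum_(k < N) c k ^+ 2) @ \oo --> exp_cov u 0.
Proof. exact: (@sum_sq_cvg _ _ _ ui ei _ _ cHc cHs H_norm). Qed.

Lemma MA_coef_le k : `|c k| <= Num.sqrt (exp_cov u 0).
Proof.
rewrite -sqrtr_sqr ler_wsqrtr//.
by apply: le_trans (spectral_sum_sq_le k.+1); rewrite big_ord_recr /= lerDr sumr_ge0// => i _; rewrite sqr_ge0.
Qed.

Lemma MA_AR_conv n : conv c a n = - (n == 0%N)%:R.
Proof.
have r01 r : 0 < r < 1 -> 0 <= r < 1 by move=> /andP[/ltW -> ->].
apply: (@conv_reciprocal R c a (Hc ^~ 0) (Ac ^~ 0) _ cva MA_coef_le) => r /r01 h.
- exact: (@cHc0 _ _ _ cHc).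
- exact: (@cAc0 _ _ _ cAc).
- exact: (@c_abs _ _ _ cHc).
- by rewrite -(HA_re r 0) (Hs0 cHs h) mul0r subr0.
Qed.

Variable gam : int -> R.
Hypothesis sd : spectral_density gam Delta.

Lemma spectral_gam : gam = exp_cov u.
Proof.
apply/funext => n; case: sd => _ _ _ /(_ n) /(congr1 Re) /= ->.
transitivity (\int[mu]_(x in I) (cos (n%:~R * x) * Delta x)).
  by apply: eq_Rintegral => x _; rewrite mulr0 subr0 expR0 mul1r.
rewrite /exp_cov /Rintegral; congr fine.
have mcos : measurable_fun I (fun x => cos (n%:~R * x)).
  exact: measurable_I_continuous (@continuous_cosM _ n%:~R).
apply: ae_eq_integral => //.
- by apply/measurable_EFinP; apply: measurable_funM => //; exact: (integrable_measurable Di).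
- by apply/measurable_EFinP; apply: measurable_funM => //; exact: (integrable_measurable ei).
- have F : Filter (almost_everywhere mu) by exact: ae_filter_ringOfSetsType.
  by apply: (@filterS _ _ F) ae_expR_ln => x h /h /= [<-].
Qed.

End SpectralLink.

(** * Projections in L2 *)

Section InnerProduct.
Context {d : measure_display} {T : measurableType d} {R : realType}.
Variable P : probability T R.
Implicit Types (Y Z W : T -> R) (k : R).
Local Notation L2 := (Lfun P 2%:E).
Local Notation ip := (inner P).

Let le12 : (1 <= 2%:E :> \bar R)%E.
Proof. by rewrite lee_fin ler1n. Qed.

Lemma L2_lin k Y Z : Y \in L2 -> Z \in L2 -> k *: Y + Z \in L2.
Proof. exact: (Lfun_submod_closed P le12).2. Qed.

Lemma L2_0 : (0 : T -> R) \in L2.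
Proof. exact: (Lfun_submod_closed P le12).1. Qed.

Lemma L2_sub Y Z : Y \in L2 -> Z \in L2 -> Y - Z \in L2.
Proof. by move=> LY LZ; rewrite addrC -scaleN1r; apply: L2_lin. Qed.

Lemma L2_sum (J : Type) (s : seq J) (k : J -> R) (F : J -> T -> R) :
  (forall j, F j \in L2) -> \sum_(j <- s) k j *: F j \in L2.
Proof.
move=> LF; elim: s => [|j s IH]; first by rewrite big_nil L2_0.
by rewrite big_cons L2_lin.
Qed.

Lemma innerC Y Z : ip Y Z = ip Z Y.
Proof. by rewrite /inner; congr (fine 'E_P[_]); apply/funext => x; rewrite /= mulrC. Qed.

Lemma inner_lin k Y Z W : Y \in L2 -> Z \in L2 -> W \in L2 ->
  ip (k *: Y + Z) W = k * ip Y W + ip Z W.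
Proof.
move=> LY LZ LW; have YW := Lfun2_mul_Lfun1 LY LW; have ZW := Lfun2_mul_Lfun1 LZ LW.
rewrite /inner (_ : _ \* W = (k \o* (Y \* W)) \+ (Z \* W)); last first.
  by apply/funext => x; rewrite /= mulrDl /GRing.scale /= mulrC mulrA mulrC; ring.
rewrite expectationD//; last by apply: Lfun_scale.
rewrite expectationZl// fineD ?fineM ?expectation_fin_num//.
by rewrite fin_numM ?expectation_fin_num.
Qed.

Lemma inner0 W : W \in L2 -> ip 0 W = 0.
Proof.
move=> LW; have := inner_lin 1 L2_0 L2_0 LW.
rewrite scale1r addr0 mul1r => /eqP; rewrite -subr_eq0 opprD addrA subrr sub0r oppr_eq0.
by move/eqP.
Qed.

Lemma inner_sub Y Z W : Y \in L2 -> Z \in L2 -> W \in L2 -> ip (Y - Z) W = ip Y W - ip Z W.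
Proof.
move=> LY LZ LW; rewrite addrC -scaleN1r inner_lin//.
by rewrite mulN1r addrC.
Qed.

Lemma inner_sum (J : Type) (s : seq J) (k : J -> R) (F : J -> T -> R) W :
  (forall j, F j \in L2) -> W \in L2 ->
  ip (\sum_(j <- s) k j *: F j) W = \sum_(j <- s) k j * ip (F j) W.
Proof.
move=> LF LW; elim: s => [|j s IH]; first by rewrite !big_nil inner0.
by rewrite !big_cons inner_lin ?IH//; exact: L2_sum.
Qed.

Lemma inner_ge0 Y : 0 <= ip Y Y.
Proof. by rewrite /inner fine_ge0// expectation_ge0// => x; rewrite /= -expr2 sqr_ge0. Qed.

Lemma inner_cauchy_schwarz Y Z : Y \in L2 -> Z \in L2 ->
  ip Y Z ^+ 2 <= ip Y Y * ip Z Z.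
Proof.
move=> LY LZ; apply: deg2_discr; first exact: inner_ge0.
move=> x; apply: le_trans (inner_ge0 (x *: Y + Z)) _.
rewrite inner_lin ?L2_lin// 2!(innerC _ (x *: Y + Z)) !inner_lin// (innerC Z Y).
by rewrite le_eqVlt; apply/orP; left; apply/eqP; ring.
Qed.

Lemma inner_le_Lnorm Y e : Y \in L2 -> ('N[P]_2%:E[EFin \o Y] < e%:E)%E -> ip Y Y <= e ^+ 2.
Proof.
move=> LY Ne.
have N0 := Lnorm_ge0 P 2%:E (EFin \o Y).
have YY := Lfun2_mul_Lfun1 LY LY.
have E : ('E_P[Y \* Y] = 'N[P]_2%:E[EFin \o Y] `^ 2)%E.
  rewrite powR_Lnorm// unlock; apply: eq_integral => x _.
  by rewrite /= powR_mulrn// real_normK ?num_real// expr2.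
rewrite /inner E; case: ('N[P]_2%:E[_])%E N0 Ne => [r| |]//= .
rewrite !lee_fin lte_fin => r0 re; rewrite powR_mulrn//.
by rewrite lerXn2r ?nnegrE// ltW// (le_lt_trans r0).
Qed.

End InnerProduct.

Section Projection.
Context {d : measure_display} {T : measurableType d} {R : realType}.
Variables (P : probability T R) (X : int -> T -> R).
Hypothesis LX : forall k, X k \in Lfun P 2%:E.
Implicit Types (J : interval int) (Y Z W V : T -> R).

Lemma lin_span_L2 J Z : lin_span X J Z -> Z \in Lfun P 2%:E.
Proof. by move=> [s [k [_ ->]]]; exact: L2_sum. Qed.

Lemma lin_span_closed J Z : lin_span X J Z -> closed_span P X J Z.
Proof.
move=> JZ; split; first exact: lin_span_L2 JZ.
move=> e e0; exists Z => //.
rewrite (_ : EFin \o _ = cst 0%E) ?Lnorm0//.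
by apply/funext => x; rewrite /= subrr.
Qed.

Lemma lin_span_gen J k : k \in J -> lin_span X J (X k).
Proof.
move=> kJ; exists [:: k], (fun=> 1); split; last by rewrite big_seq1 scale1r.
by move=> j; rewrite inE => /eqP ->.
Qed.

(** Cauchy-Schwarz against [W - Z], with [Z] in the span close to [W], bounds the inner product by
    the norm of [V] times any [e]. *)
Lemma orthogonal_closed_span J V W : V \in Lfun P 2%:E ->
  (forall k, k \in J -> inner P V (X k) = 0) -> closed_span P X J W -> inner P V W = 0.
Proof.
move=> LV V0 [LW cW].
have small e : 0 < e -> inner P V W ^+ 2 <= inner P V V * e ^+ 2.
  move=> e0; have [Z JZ Ne] := cW e e0.
  have LZ := lin_span_L2 JZ.
  have VZ : inner P V Z = 0.
    case: JZ => s [k [sJ ->]]; rewrite innerC inner_sum// big_seq big1// => j js.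
    by rewrite innerC V0 ?mulr0// sJ.
  have LD : W - Z \in Lfun P 2%:E by exact: L2_sub.
  have <- : inner P V (W - Z) = inner P V W.
    by rewrite innerC inner_sub// !(innerC _ _ V) VZ subr0.
  apply: le_trans (inner_cauchy_schwarz LV LD) _.
  by rewrite ler_wpM2l ?inner_ge0//; exact: inner_le_Lnorm.
apply/eqP; rewrite -sqrf_eq0; apply/eqP/le_anti; rewrite sqr_ge0 andbT.
apply/ler_addgt0Pr => e e0; rewrite add0r.
have VV := inner_ge0 P V.
have D0 : 0 < inner P V V + 1 by lra.
have d0 : 0 < e / (inner P V V + 1) by rewrite divr_gt0.
apply: le_trans (small (Num.sqrt (e / (inner P V V + 1))) _) _; first by rewrite sqrtr_gt0.
rewrite sqr_sqrtr ?(ltW d0)// mulrCA ger_pMr// ler_pdivrMr//; lra.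
Qed.

End Projection.

(** * Normal equations of the predictor *)

Section Stationary.
Context {d : measure_display} {T : measurableType d} {R : realType}.
Variables (P : probability T R) (X : int -> T -> R).
Hypothesis SX : stationary_process P X.
Local Notation gam := (autocov P X).

Let LX k : X k \in Lfun P 2%:E.
Proof. by case: SX. Qed.

Lemma inner_autocov i j : inner P (X i) (X j) = gam (i - j).
Proof. by case: SX => _ _ h; rewrite -(h (i - j) j) subrK. Qed.

Lemma autocov_even i : gam (- i) = gam i.
Proof. by rewrite -[i in RHS]subr0 -inner_autocov innerC inner_autocov sub0r. Qed.

Lemma autocov_psd (t : seq (R * int)) : 0 <= gram gam t t.
Proof.
have := inner_ge0 P (\sum_(x <- t) x.1 *: X x.2).
rewrite inner_sum//; last exact: L2_sum.
rewrite (_ : \sum_(x <- t) _ = gram gam t t)//.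
apply: eq_bigr => x _; rewrite innerC inner_sum// mulr_sumr; apply: eq_bigr => y _.
by rewrite innerC inner_autocov mulrA.
Qed.

(** The candidate lies in the span, so being the projection reduces to orthogonality to the
    generators [X_(-1), ..., X_(-n)]. The index [s] stands for [j - 1]. *)
Lemma predictor_coefP (n m : nat) (phi : nat -> R) :
  predictor_coef P X n m phi <->
  (forall r, (r < n)%N -> \sum_(0 <= s < n) phi s.+1 * gam (s%:Z - r%:Z) = gam (m + r.+1)%N%:Z).
Proof.
set Z := \sum_(1 <= j < n.+1) phi j *: X (- j%:Z).
have LZ : Z \in Lfun P 2%:E by exact: L2_sum.
have LD : X m%:Z - Z \in Lfun P 2%:E by exact: L2_sub.
have JZ : lin_span X `[- n%:Z, -1] Z.
  exists [seq - j%:Z | j <- index_iota 1 n.+1], (fun k => phi `|k|%N); split.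
    by move=> k /mapP[j]; rewrite mem_index_iota in_itv /= => /andP[j1 jn] ->; apply/andP; split; lia.
  rewrite big_map; apply: eq_bigr => j _.
  by rewrite (_ : `|- j%:Z|%N = j)//; lia.
have E (r : nat) : inner P (X m%:Z - Z) (X (- r.+1%:Z)) =
    gam (m + r.+1)%N%:Z - \sum_(0 <= s < n) phi s.+1 * gam (s%:Z - r%:Z).
  rewrite inner_sub// inner_autocov opprK -PoszD inner_sum//; congr (_ - _).
  rewrite big_add1 /=; apply: eq_bigr => s _; rewrite inner_autocov -autocov_even.
  by congr (_ * gam _); lia.
rewrite /predictor_coef -/Z; split=> [[_ PZ] r rn|H].
  have := PZ (X (- r.+1%:Z)).
  rewrite (_ : (X m%:Z \- Z) = X m%:Z - Z)// E => H; apply/esym/eqP; rewrite -subr_eq0 H//.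
  by apply: lin_span_closed => //; apply: lin_span_gen; rewrite in_itv /=; apply/andP; split; lia.
split; first exact: lin_span_closed.
move=> W; apply: orthogonal_closed_span => // k; rewrite in_itv /= => /andP[k1 k2].
have -> : k = - (`|k|%N.-1).+1%:Z by lia.
rewrite (_ : (X m%:Z \- Z) = X m%:Z - Z)// E H ?subrr//; lia.
Qed.

End Stationary.

Theorem theorem2p5 (d : measure_display) (T : measurableType d) (R : realType)
    (P : probability T R) (X : int -> T -> R) (Delta : R -> R) (c a : nat -> R) :
  stationary_process P X ->
  purely_nondeterministic P X ->
  spectral_density (autocov P X) Delta ->
  positive_log_integrable Delta ->
  MA_coef Delta c ->
  AR_coef Delta a ->
  cvgn [normed series a] ->
  forall n m : nat, (0 < n)%N ->
  [/\ forall j : nat, (1 <= j <= n)%N -> cvgn (gsum c a n m j),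
      forall phi : nat -> R, predictor_coef P X n m phi ->
        forall j : nat, (1 <= j <= n)%N -> phi j = limn (gsum c a n m j)
    & is_proj P X `[- n%:Z, - 1] (X m%:Z)
        (\sum_(1 <= j < n.+1) limn (gsum c a n m j) *: X (- j%:Z))].
Proof.
move=> SX _ sd Dpos MAc ARa cva n m n0.
have Di : lebesgue_measure.-integrable `[- pi, pi] (EFin \o Delta) by case: (sd).
have gE : autocov P X = exp_cov (fun x => ln (Delta x)) by exact: (spectral_gam Di Dpos sd).
have psd := autocov_psd SX.
have even := autocov_even SX.
have ca := MA_AR_conv Di Dpos MAc ARa cva.
have YW i : wsum a (fun p => autocov P X (p%:Z + i)) = - cext c i.
  by rewrite gE; exact: (spectral_yule_walker Di Dpos MAc ARa cva).
have c2 : (fun N => \sum_(k < N) c k ^+ 2) @ \oo --> autocov P X 0.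
  by rewrite gE; exact: (spectral_sum_sq_cvg Di Dpos MAc).
have uniq := @normal_uniq R _ c a psd even cva ca YW c2 n m n0.
have ordj j : (1 <= j <= n)%N -> exists s : 'I_n, j = s.+1.
  by case: j => // j /= jn; exists (Ordinal jn).
split.
- move=> _ /ordj[s ->]; apply/cvg_ex; eexists.
  exact: (@gsum_lim R _ c a psd even cva ca YW c2 n m n0 s).
- move=> phi /(predictor_coefP SX)/(uniq (fun s => phi s.+1)) H _ /ordj[s ->].
  exact: H.
- by apply/(predictor_coefP SX)/(uniq (fun s => limn (gsum c a n m s.+1))).
Qed.
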